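(* Let $\ell>0$. Assume that: (i) there exist $0<\sigma_0<\sigma_1<\infty$ with $\sigma_0\leq\sigma(\mathbf{x})\leq\sigma_1$ for all $\mathbf{x}\in\mathbb{R}^d$; (ii) there exists $C_1>0$ with $\mathbb{E}[|f^*(\mathbf{X})|]\leq C_1$; (iii) for every $y\in\mathbb{R}$ the map $t\mapsto\mathbb{P}_{\mathbf{X}}(p(y|\mathbf{X})\geq t)$ is continuous on $(0,\infty)$. Take $s=\log(\min(n,N))$, $M>4\sqrt{N}$ and $u=u_n\to0$. Assume that, as $n,N\to\infty$, $$\sqrt{s}\,\mathbb{E}\left[(\hat f(\mathbf{X})-f^*(\mathbf{X}))^2\right]\to0\quad\text{and}\quad s^{5/2}\,\mathbb{E}\left[|\hat\sigma^2(\mathbf{X})-\sigma^2(\mathbf{X})|\right]\to0.$$ Then, for a positive constant $C_2$ depending on $\sigma_0$, $$\mathbb{E}\left[\mathcal{E}_\ell(\hat\Gamma)\right]\leq C_2\,\mathbb{E}\left[\mathcal{H}(\hat\Gamma)\right]\to0\qquad\text{as } n,N\to\infty.$$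
   Context: Model: $(\mathbf{X},Y)\in\mathbb{R}^d\times\mathbb{R}$ satisfies $Y=f^*(\mathbf{X})+\sigma(\mathbf{X})\varepsilon$, where $\varepsilon\sim\mathcal{N}(0,1)$ is independent of $\mathbf{X}$, and $f^*:\mathbb{R}^d\to\mathbb{R}$ and $\sigma:\mathbb{R}^d\to(0,\infty)$ are measurable. The conditional density of $Y$ given $\mathbf{X}=\mathbf{x}$ is $p(y|\mathbf{x})=\frac{1}{\sqrt{2\pi}\sigma(\mathbf{x})}\exp\left(-\frac{(y-f^*(\mathbf{x}))^2}{2\sigma^2(\mathbf{x})}\right)$. $\mathbb{P}_{\mathbf{X}}$ is the law of $\mathbf{X}$. Oracle: $G(t)=\int_{\mathbb{R}}\mathbb{P}(p(y|\mathbf{X})\geq t)dy$ for $t>0$, $\lambda^*_\ell=G^{-1}(\ell)=\inf\{t>0:G(t)\leq\ell\}$, and $\Gamma^*_\ell(\mathbf{x})=\{y:p(y|\mathbf{x})\geq\lambda^*_\ell\}$. Data: $\mathcal{D}_n=\{(\mathbf{X}_i,Y_i)\}_{i=1}^n$ is a labeled sample of i.i.d. copies of $(\mathbf{X},Y)$, and $\mathcal{D}_N=\{\mathbf{X}_{n+1},\dots,\mathbf{X}_{n+N}\}$ is an unlabeled sample of i.i.d. copies of $\mathbf{X}$ independent of $\mathcal{D}_n$. Let $\hat f:\mathbb{R}^d\to\mathbb{R}$ and $\tilde\sigma^2:\mathbb{R}^d\to[0,\infty)$ be (measurable) estimators built from $\mathcal{D}_n$. For $s>0$ define $$\hat\sigma^2(\mathbf{x})=\tilde\sigma^2(\mathbf{x})\mathbf{1}_{\{s^{-1}\leq\tilde\sigma^2(\mathbf{x})\leq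 s\}}+s^{-1}\mathbf{1}_{\{\tilde\sigma^2(\mathbf{x})<s^{-1}\}}+s\mathbf{1}_{\{\tilde\sigma^2(\mathbf{x})>s\}},$$ $$\hat p(y|\mathbf{x})=\frac{1}{\sqrt{2\pi}\hat\sigma(\mathbf{x})}\exp\left(-\frac{(y-\hat f(\mathbf{x}))^2}{2\hat\sigma^2(\mathbf{x})}\right)\mathbf{1}_{\{|y|\leq s\}}.$$ Let $\zeta$ be uniform on $[0,u]$, $u>0$, independent of $(\mathbf{X},Y)$ and of the samples, and let $\zeta_1,\dots,\zeta_N$ be i.i.d. copies of $\zeta$, independent of everything else. Set $\hat p(y|\mathbf{x},z)=\hat p(y|\mathbf{x})+z\mathbf{1}_{\{|y|\leq s\}}$. Let $y_k=-s+2s(k-1)/M$, $k=1,\dots,M$, be the regular grid of $[-s,s]$, and put $$\hat G(t)=\frac{2s}{MN}\sum_{k=1}^M\sum_{i=1}^N\mathbf{1}_{\{\hat p(y_k|\mathbf{X}_{n+i},\zeta_i)>t\}},\qquad \hat G^{-1}(\ell)=\inf\{t\geq0:\hat G(t)\leq\ell\}.$$ The empirical prediction interval is $\hat\Gamma(\mathbf{X},\zeta)=\{y\in\mathbb{R}:\hat p(y|\mathbf{X},\zeta)\geq\hat G^{-1}(\ell)\}$. Performance measures: for a (possibly randomized) predictor $\Gamma$, $R_\ell(\Gamma)=\mathbb{P}(Y\notin\Gamma)+\lambda^*_\ell\,\mathbb{E}[L(\Gamma)]$, $\mathcal{E}_\ell(\Gamma)=R_\ell(\Gamma)-R_\ell(\Gamma^*_\ell)$,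 and $\mathcal{H}(\Gamma)=\mathbb{E}[L(\Gamma\triangle\Gamma^*_\ell(\mathbf{X}))]$, where $L$ is Lebesgue measure, $\triangle$ is symmetric difference, and the probabilities and expectations are over a fresh $(\mathbf{X},Y,\zeta)$ only, conditionally on the samples. The outer $\mathbb{E}$ also averages over the samples. *)

(* Defs.v *)
From HB Require Import structures.
From mathcomp Require Export all_boot all_order all_algebra.
From mathcomp Require Export all_classical all_reals all_analysis.

Set Implicit Arguments.
Unset Strict Implicit.
Unset Printing Implicit Defensive.

Import Order.TTheory GRing.Theory Num.Theory.
Import numFieldNormedType.Exports.

Local Open Scope classical_set_scope.
Local Open Scope ring_scope.

(* R^d is [d.-tuple R], which carries the product (hence Borel) sigma-algebra. *)

Section law_independence.
Context {disp : measure_display} {Omega : measurableType disp} {R : realType}.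
Variable P : probability Omega R.

Definition has_law {d'} {T : measurableType d'} (U : Omega -> T)
    (Q : set T -> \bar R) : Prop :=
  forall A : set T, measurable A -> P (U @^-1` A) = Q A.

Definition same_law {d'} {T : measurableType d'} (U V : Omega -> T) : Prop :=
  has_law U (fun A => P (V @^-1` A)).

Definition sigma_of {d'} {T : measurableType d'} (U : Omega -> T) :
    set (set Omega) :=
  preimage_set_system setT U measurable.

(* The injection j selects an arbitrary finite subfamily. *)
Definition mutually_independent {I : Type} (S : I -> set (set Omega)) : Prop :=
  forall (k : nat) (j : 'I_k -> I) (A : 'I_k -> set Omega),
    injective j -> (forall i, S (j i) (A i)) ->
    P (\bigcap_i A i) = (\prod_(i < k) P (A i))%E.

Definition independent_rv {d1} {T1 : measurableType d1}
    {d2} {T2 : measurableType d2} (U : Omega -> T1) (V : Omega -> T2) : Prop :=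
  mutually_independent (fun b : bool => if b then sigma_of U else sigma_of V).

End law_independence.

Section sampling_scheme.
Context {disp : measure_display} {Omega : measurableType disp} {R : realType}.
Variable P : probability Omega R.

(* The random objects used with sample sizes (n, N).  No relation is imposed
   between the objects attached to different sizes, so in particular the scheme
   where they are all read off infinite sequences, with
   unlabeled i = X_{n+i}, is covered. *)
Record sampling (d n N : nat) := Sampling {
  labeled : 'I_n -> {RV P >-> (d.-tuple R * R)%type} ;
  unlabeled : 'I_N -> {RV P >-> d.-tuple R} ;
  perturbation : 'I_N -> {RV P >-> R} ;
  fresh_perturbation : {RV P >-> R}
}.

Inductive source (n N : nat) : Type :=
  | FreshPair
  | FreshPerturbation
  | Labeled of 'I_n
  | Unlabeled of 'I_N
  | Perturbation of 'I_N.

Definition source_sigma {d n N : nat} (X : Omega -> d.-tuple R)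
    (Y : Omega -> R) (S : sampling d n N) (i : source n N) : set (set Omega) :=
  match i with
  | FreshPair => sigma_of (fun w => (X w, Y w))
  | FreshPerturbation => sigma_of (fresh_perturbation S)
  | Labeled i => sigma_of (labeled S i)
  | Unlabeled i => sigma_of (unlabeled S i)
  | Perturbation i => sigma_of (perturbation S i)
  end.

Definition valid_sampling {d n N : nat} (X : Omega -> d.-tuple R)
    (Y : Omega -> R) (u : R) (u_gt0 : 0 < u) (S : sampling d n N) : Prop :=
  [/\ forall i, same_law P (labeled S i) (fun w => (X w, Y w)),
      forall i, same_law P (unlabeled S i) X,
      forall i, has_law P (perturbation S i) (uniform_prob u_gt0),
      has_law P (fresh_perturbation S) (uniform_prob u_gt0)
    & mutually_independent P (source_sigma X Y S)].

Definition labeled_data {d n N : nat} (S : sampling d n N) (w : Omega) :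
    n.-tuple (d.-tuple R * R) :=
  [tuple labeled S i w | i < n].

End sampling_scheme.

Section oracle.
Context {disp : measure_display} {Omega : measurableType disp} {R : realType}.
Variables (P : probability Omega R) (d : nat) (X : Omega -> d.-tuple R).
Variables (f sigma : d.-tuple R -> R).

(* For a nonzero standard deviation s, [normal_pdf m s] is the usual density. *)
Definition cond_density (y : R) (x : d.-tuple R) : R :=
  normal_pdf (f x) (sigma x) y.

Definition oracle_G (t : R) : \bar R :=
  (\int[lebesgue_measure]_y P [set w | (t <= cond_density y (X w))%R])%E.

Definition oracle_level (l : R) : R :=
  inf [set t : R | 0 < t /\ (oracle_G t <= l%:E)%E].

Definition oracle_set (l : R) (x : d.-tuple R) : set R :=
  [set y | oracle_level l <= cond_density y x].

End oracle.

Section estimators.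
Context {R : realType} {d : nat}.

(* The three terms of the definition are summed as they stand; for s >= 1 this
   is the projection of v onto [1/s, s]. *)
Definition truncate_var (s v : R) : R :=
  v * (s^-1 <= v <= s)%R%:R + s^-1 * (v < s^-1)%R%:R + s * (s < v)%R%:R.

Definition hat_var (s : R) (tvar : d.-tuple R -> R) (x : d.-tuple R) : R :=
  truncate_var s (tvar x).

Definition hat_density (s : R) (fhat tvar : d.-tuple R -> R)
    (y : R) (x : d.-tuple R) : R :=
  normal_pdf (fhat x) (Num.sqrt (hat_var s tvar x)) y * (`|y| <= s)%R%:R.

Definition hat_density_pert (s : R) (fhat tvar : d.-tuple R -> R)
    (y : R) (x : d.-tuple R) (z : R) : R :=
  hat_density s fhat tvar y x + z * (`|y| <= s)%R%:R.

(* 0-based: grid_point s M k is y_{k+1}. *)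
Definition grid_point (s : R) (M k : nat) : R :=
  - s + 2 * s * k%:R / M%:R.

Definition hat_G (s : R) (fhat tvar : d.-tuple R -> R) (M N : nat)
    (xs : 'I_N -> d.-tuple R) (zs : 'I_N -> R) (t : R) : R :=
  2 * s / (M%:R * N%:R) *
  \sum_(k < M) \sum_(i < N)
    (t < hat_density_pert s fhat tvar (grid_point s M k) (xs i) (zs i))%R%:R.

Definition hat_level (s : R) (fhat tvar : d.-tuple R -> R) (M N : nat)
    (xs : 'I_N -> d.-tuple R) (zs : 'I_N -> R) (l : R) : R :=
  inf [set t : R | 0 <= t /\ hat_G s fhat tvar M xs zs t <= l].

Definition hat_set (s : R) (fhat tvar : d.-tuple R -> R) (M N : nat)
    (xs : 'I_N -> d.-tuple R) (zs : 'I_N -> R) (l : R)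
    (x : d.-tuple R) (z : R) : set R :=
  [set y | hat_level s fhat tvar M xs zs l <= hat_density_pert s fhat tvar y x z].

Definition trunc_level (n N : nat) : R := ln (minn n N)%:R.

End estimators.

(* The predictor Gam is a fixed (nonrandom) function of (x, z); the expectations
   below are over (X, Y, zeta) only. *)
Section performance.
Context {disp : measure_display} {Omega : measurableType disp} {R : realType}.
Variables (P : probability Omega R) (d : nat).
Variables (X : Omega -> d.-tuple R) (Y zeta : Omega -> R).
Variables (f sigma : d.-tuple R -> R) (l : R).

Definition risk (Gam : d.-tuple R -> R -> set R) : \bar R :=
  (P [set w | ~ Gam (X w) (zeta w) (Y w)] +
   (oracle_level P X f sigma l)%:E *
   \int[P]_w lebesgue_measure (Gam (X w) (zeta w)))%E.

Definition excess_risk (Gam : d.-tuple R -> R -> set R) : \bar R :=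
  (risk Gam - risk (fun x _ => oracle_set P X f sigma l x))%E.

Definition sym_diff_loss (Gam : d.-tuple R -> R -> set R) : \bar R :=
  (\int[P]_w lebesgue_measure
     (Gam (X w) (zeta w) `+` oracle_set P X f sigma l (X w)))%E.

End performance.

Section plug_in.
Context {disp : measure_display} {Omega : measurableType disp} {R : realType}.
Variables (P : probability Omega R) (d : nat).
Variables (X : Omega -> d.-tuple R) (Y : Omega -> R).
Variables (f sigma : d.-tuple R -> R) (l : R).
Variable S : forall n N : nat, sampling P d n N.
Variables fhat tvar : forall n, n.-tuple (d.-tuple R * R) -> d.-tuple R -> R.
Variable M : nat -> nat -> nat.

(* The empirical predictor once the samples are frozen at the outcome w. *)
Definition empirical_set (n N : nat) (w : Omega) :
    d.-tuple R -> R -> set R :=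
  let D := labeled_data (S n N) w in
  hat_set (trunc_level n N) (fhat D) (tvar D) (M n N)
    (fun i => unlabeled (S n N) i w) (fun i => perturbation (S n N) i w) l.

(* The outer integral averages over the samples, the inner expectations (in
   [excess_risk] and [sym_diff_loss]) over the fresh triple. *)
Definition mean_excess_risk (n N : nat) : \bar R :=
  (\int[P]_w excess_risk P X Y (fresh_perturbation (S n N)) f sigma l
     (empirical_set n N w))%E.

Definition mean_sym_diff_loss (n N : nat) : \bar R :=
  (\int[P]_w sym_diff_loss P X (fresh_perturbation (S n N)) f sigma l
     (empirical_set n N w))%E.

Definition regression_error (n N : nat) : \bar R :=
  'E_P[fun w => (fhat (labeled_data (S n N) w) (X w) - f (X w)) ^+ 2].

Definition variance_error (n N : nat) : \bar R :=
  'E_P[fun w => `|hat_var (trunc_level n N)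
                    (tvar (labeled_data (S n N) w)) (X w) - sigma (X w) ^+ 2|].

End plug_in.

(* Main.v *)
Require Import Defs.
From HB Require Import structures.
From mathcomp Require Import measurable_realfun.
From mathcomp Require Import ring lra.
Import Order.TTheory GRing.Theory Num.Theory.
Import numFieldNormedType.Exports.
Set Implicit Arguments.
Unset Strict Implicit.
Unset Printing Implicit Defensive.
Local Open Scope classical_set_scope.
Local Open Scope ring_scope.

(** The excess risk is compared with the loss pointwise. Given [X = x], the
    response has density [p = cond_density f sigma ^~ x], so the risk integrates
    [p] over the complement of the prediction set and the oracle level [lam] over
    the set itself. The oracle set keeps the cheaper of the two at every point,
    so any other set loses [|p - lam|] on the symmetric difference. Both [p] and
    [lam] are at most the peak of the Gaussian density of standard deviation
    [sigma0], which is the constant [C2] ([excess_risk_le]).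

    It remains to show that the mean symmetric difference vanishes. The oracle
    curve [G t] is the mean length of the superlevel set [{p >= t}], an interval
    around [f x] of length at most [1 / t]; the empirical curve averages the
    lengths, measured on the grid, of the superlevel sets of the fitted density
    at the unlabeled observations. The empirical level need not converge to [lam]
    when [G] is constant equal to [l] on an interval, but then the superlevel
    sets hardly change across that interval. So the proof fixes
    [t1 <= lam <= t2] with [G] above [l] slightly beyond [t1], below [l] slightly
    before [t2], and almost equal at [t1] and [t2] ([level_bracket], which uses
    the continuity of [G]).

    If the empirical level falls between [t1] and [t2], the loss at an
    observation whose fitted density is uniformly close to [p] is at most the
    length of [{t1 - dl <= p < t2 + dl}], small on average; at the other
    observations it is bounded. The two kinds are told apart by a certificate,
    [misfit], that sums the estimation errors and [|f|] over suitable constants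
    and is at least [1] at the bad observations: its mean is controlled by the
    hypotheses, both at a fresh observation and on average over the unlabeled
    ones, which are independent of the fits. The empirical level falls outside
    the bracket only if the average length of the true superlevel sets deviates
    from its mean (unlikely by Chebyshev, [average_deviation]) or if the average
    [misfit] is large (unlikely by Markov). Outside the bracket the loss is still
    bounded while the level exceeds some fixed [ts]. Below [ts] the only bound
    left comes from the support of the fitted density and grows like [2 * s]; but the level
    is so low only when half of the observations fail a much weaker test,
    [gross_misfit], whose mean is [o(1 / s)]: this is where the powers of [s] in
    the hypotheses, and the integrability of [f], come in.

    [mean_loss_le] gathers these bounds for fixed sample sizes, and
    [mean_loss_near] makes the terms small. *)

(** * Integrals and independence *)

Section integral_tools.
Context {d : measure_display} {T : measurableType d} {R : realType}.
Variable mu : {measure set T -> \bar R}.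
Local Open Scope ereal_scope.
Import HBNNSimple.

(** The integral of a nonnegative function is a supremum over the simple
    functions below it, hence monotone on all functions. This is how the loss,
    as a function of the samples, is compared with measurable bounds. *)
Lemma ge0_le_integral_nonmeas (f g : T -> \bar R) :
  (forall x, 0 <= f x) -> (forall x, f x <= g x) ->
  \int[mu]_x f x <= \int[mu]_x g x.
Proof.
move=> f0 fg; have g0 x : 0 <= g x by exact: le_trans (fg x).
rewrite !ge0_integralTE//; apply: ereal_sup_le => _ [h /= hf <-].
by exists h => // x; exact: le_trans (fg x).
Qed.

(** The bound may fail on a null set [Z]: adding [+oo] on [Z] to [g] restores
    it everywhere and leaves the integral of [g] unchanged. *)
Lemma ge0_le_integral_null (Z : set T) (f g : T -> \bar R) :
  measurable Z -> mu Z = 0 -> measurable_fun setT g ->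
  (forall x, 0 <= f x) -> (forall x, 0 <= g x) ->
  (forall x, ~ Z x -> f x <= g x) -> \int[mu]_x f x <= \int[mu]_x g x.
Proof.
move=> mZ Z0 mg f0 g0 fg.
have mi : measurable_fun setT (fun x => +oo * (\1_Z x)%:E : \bar R).
  apply: emeasurable_funM => //; exact/measurable_EFinP/measurable_indic.
have i0 x : 0 <= +oo * (\1_Z x)%:E :> \bar R by rewrite mule_ge0.
apply: (@le_trans _ _ (\int[mu]_x (g x + +oo * (\1_Z x)%:E))).
  apply: ge0_le_integral_nonmeas => // x; rewrite indicE.
  have [xZ|] := boolP (x \in Z).
    by rewrite mule1 addey ?leey// gt_eqF// (lt_le_trans _ (g0 x)).
  by rewrite notin_setE mule0 adde0 => /fg.
have mI : measurable_fun setT (fun x => (\1_Z x)%:E : \bar R).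
  exact/measurable_EFinP/measurable_indic.
rewrite ge0_integralD// ge0_integralZl// integral_indic// setIT Z0.
by rewrite mule0 adde0.
Qed.

Lemma le_integralZl_nonmeas (c : R) (f g : T -> \bar R) :
  (0 < c)%R -> (forall x, 0 <= g x) -> (forall x, f x <= c%:E * g x) ->
  \int[mu]_x f x <= c%:E * \int[mu]_x g x.
Proof.
move=> c0 g0 fg.
(* The sign of [f] is arbitrary, so it is first replaced by its positive part. *)
apply: (@le_trans _ _ (\int[mu]_x (f^\+ x))).
  rewrite integralE -[leRHS]sube0; apply: leeB => //; exact: integral_ge0.
have fg' x : f^\+ x <= c%:E * g x.
  by rewrite funeposE ge_max fg mule_ge0// lee_fin ltW.
rewrite [leLHS]ge0_integralTE//; apply: ge_ereal_sup => _ [h /= hf <-].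
have ci0 : (0 <= c^-1)%R by rewrite invr_ge0 ltW.
have -> : sintegral mu h = c%:E * sintegral mu (scale_nnsfun h ci0).
  by rewrite sintegralrM muleA -EFinM divff ?gt_eqF// mul1e.
apply: lee_pmul => //; first by rewrite lee_fin ltW.
  exact: sintegral_ge0.
rewrite ge0_integralTE//; apply: ereal_sup_ubound.
exists (scale_nnsfun h ci0) => //= x.
by rewrite EFinM lee_pdivrMl// (le_trans (hf x)).
Qed.

End integral_tools.

Section independence.
Context {disp : measure_display} {Omega : measurableType disp} {R : realType}.
Variable P : probability Omega R.
Local Open Scope ereal_scope.

Definition indep_pair {d1} {T1 : measurableType d1} {d2} {T2 : measurableType d2}
    (U : Omega -> T1) (V : Omega -> T2) : Prop :=
  forall A B, measurable A -> measurable B ->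
    P (U @^-1` A `&` V @^-1` B) = P (U @^-1` A) * P (V @^-1` B).

Lemma same_law_integral {d1} {T1 : measurableType d1} (U V : {mfun Omega >-> T1})
    (h : T1 -> \bar R) :
  same_law P U V -> measurable_fun setT h -> (forall x, 0 <= h x) ->
  \int[P]_w h (U w) = \int[P]_w h (V w).
Proof.
move=> UV mh h0.
rewrite -(ge0_integral_distribution _ mh)// -(ge0_integral_distribution _ mh)//.
by apply: eq_measure_integral => //= A mA _; exact: UV.
Qed.

(** The joint law of an independent pair is the product of the two laws, so
    Tonelli applies. *)
Lemma indep_integral {d1} {T1 : measurableType d1} {d2} {T2 : measurableType d2}
    (U : {mfun Omega >-> T1}) (V : {mfun Omega >-> T2}) (h : T1 * T2 -> \bar R) :
  indep_pair U V -> measurable_fun setT h -> (forall x, 0 <= h x) ->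
  \int[P]_w h (U w, V w) = \int[P]_w \int[P]_w' h (U w, V w').
Proof.
move=> UV mh h0.
pose UVf : Omega -> (T1 * T2)%type := fun w => (U w, V w).
have mUV : measurable_fun setT UVf by exact: measurable_fun_pair.
pose UVm : {mfun Omega >-> (T1 * T2)%type} := HB.pack UVf (isMeasurableFun.Build _ _ _ _ _ mUV).
transitivity (\int[distribution P UVm]_z h z).
  by rewrite (ge0_integral_distribution (UVm : {RV P >-> _})).
transitivity (\int[distribution P U \x distribution P V]_z h z).
  apply: eq_measure_integral => //= A mA _; apply/esym.
  by apply: product_measure_unique => // B C mB mC; exact: UV.
rewrite fubini_tonelli1// /fubini_F.
rewrite (ge0_integral_distribution (U : {RV P >-> _}))//=; last 2 first.
- exact: (measurable_fun_fubini_tonelli_F (m2 := distribution P V)).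
- by move=> y; apply: integral_ge0.
apply: eq_integral => w _; rewrite (ge0_integral_distribution (V : {RV P >-> _}))//=.
exact: measurableT_comp.
Qed.

Lemma measurable_inner_integral {d1} {T1 : measurableType d1}
    {d2} {T2 : measurableType d2} (V : {mfun Omega >-> T2})
    (h : T1 * T2 -> \bar R) :
  measurable_fun setT h -> (forall x, 0 <= h x) ->
  measurable_fun setT (fun u => \int[P]_w h (u, V w)).
Proof.
move=> mh h0.
have := measurable_fun_fubini_tonelli_F (m2 := distribution P V) h mh h0.
congr (measurable_fun _ _); apply/funext => u.
rewrite /fubini_F (ge0_integral_distribution (V : {RV P >-> _}))//=.
exact: measurableT_comp.
Qed.

End independence.

Section independent_families.
Context {disp : measure_display} {Omega : measurableType disp} {R : realType}.
Variable P : probability Omega R.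
Local Open Scope ereal_scope.

Lemma mutually_independent2 {I : Type} (S : I -> set (set Omega)) (i j : I)
    (A B : set Omega) :
  mutually_independent P S -> i <> j -> S i A -> S j B ->
  P (A `&` B) = P A * P B.
Proof.
move=> indS ij SA SB.
pose k (m : 'I_2) := if m == ord0 then i else j.
pose C (m : 'I_2) := if m == ord0 then A else B.
have -> : A `&` B = \bigcap_m C m.
  apply/seteqP; split=> [w [Aw Bw] m _|w ABw]; first by rewrite /C; case: ifP.
  by split; [exact: (ABw ord0)|exact: (ABw ord_max)].
rewrite (indS _ k) ?big_ord_recl ?big_ord0 ?mule1//.
- move=> a b; rewrite /k => e; apply/val_inj.
  case: a b e => [[|[]]//= ?] [[|[]]//= ?] //= e; exfalso; apply: ij;
    first [exact: e | exact: esym e].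
- by move=> m; rewrite /k /C; case: ifP.
Qed.

(** Boxes are stable under intersection and generate the product
    sigma-algebra, so two finite measures that agree on boxes are equal; the two
    measures here are the law of the tuple restricted to the event [V @^-1` C]
    and that law scaled by the probability of the event. *)
Lemma indep_pair_tuple {d1} {T1 : measurableType d1} {d2} {T2 : measurableType d2}
    {n} (U : 'I_n -> {mfun Omega >-> T1}) (V : {mfun Omega >-> T2}) :
  (forall (B : 'I_n -> set T1) (C : set T2),
     (forall i, measurable (B i)) -> measurable C ->
     P ((\bigcap_i (U i @^-1` B i)) `&` V @^-1` C) =
     P (\bigcap_i (U i @^-1` B i)) * P (V @^-1` C)) ->
  indep_pair P (fun w => [tuple U i w | i < n]) V.
Proof.
move=> UV A C mA mC.
pose W : Omega -> n.-tuple T1 := fun w => [tuple U i w | i < n].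
have mW : measurable_fun setT W.
  apply/measurable_fun_tnthP => i.
  by apply: eq_measurable_fun (measurable_funPT (U i)) => w _ /=; rewrite tnth_mktuple.
pose Wm : {mfun Omega >-> n.-tuple T1} := HB.pack W (isMeasurableFun.Build _ _ _ _ _ mW).
have mVC : measurable (V @^-1` C) by rewrite -[X in measurable X]setTI; exact: measurable_funPT.
pose m1 := pushforward (mrestr P mVC) Wm.
have fC : P (V @^-1` C) \is a fin_num by exact: fin_num_measure.
pose r : {nonneg R} := NngNum (fine_ge0 (measure_ge0 P (V @^-1` C))).
pose m2 := mscale r (distribution P Wm).
pose G : set (set (n.-tuple T1)) := [set D | exists2 B : 'I_n -> set T1,
  (forall i, measurable (B i)) & D = \bigcap_i ((@tnth n T1 ^~ i) @^-1` B i)].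
have WB (B : 'I_n -> set T1) :
    W @^-1` (\bigcap_i ((@tnth n T1 ^~ i) @^-1` B i)) = \bigcap_i (U i @^-1` B i).
  by apply/seteqP; split=> w /= Bw i _; have := Bw i Logic.I; rewrite /= tnth_mktuple.
have : m1 A = m2 A.
  apply: (g_sigma_algebra_measure_unique G _ (fun=> setT)) => //.
  - move=> _ [B mB ->]; apply: fin_bigcap_measurable => [|i _]; first exact: finite_finset.
    by rewrite -[X in measurable X]setTI; exact: measurable_tnth.
  - by move=> _; exists (fun=> setT) => //; apply/seteqP; split.
  - by rewrite bigcup_const.
  - move=> _ _ [B mB ->] [B' mB' ->]; exists (fun i => B i `&` B' i).
      by move=> i; exact: measurableI.
    by rewrite -bigcapI.
  - move=> _ [B mB ->].
    set D := \bigcap_i _.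
    change (P (W @^-1` D `&` V @^-1` C) = (fine (P (V @^-1` C)))%:E * P (W @^-1` D)).
    by rewrite WB UV// fineK// muleC.
  - move=> _; change (P (W @^-1` setT `&` V @^-1` C) < +oo).
    by rewrite preimage_setT setTI (le_lt_trans (probability_le1 _ _)) ?ltry.
  - rewrite [X in X A]/measurable/= in mA.
    move: A mA; apply: smallest_sub; first exact: smallest_sigma_algebra.
    move=> D; rewrite -bigcup_seq => -[i _ [B mB <-]]; apply: sub_sigma_algebra.
    exists (fun j => if j == i then B else setT) => [j|]; first by case: ifP.
    rewrite setTI; apply/seteqP; split => w /=.
      by move=> Bw j _ /=; case: eqP => // ->.
    by move=> /(_ i Logic.I)/=; rewrite eqxx.
change (P (W @^-1` A `&` V @^-1` C) = (fine (P (V @^-1` C)))%:E * P (W @^-1` A) ->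
  P (W @^-1` A `&` V @^-1` C) = P (W @^-1` A) * P (V @^-1` C)).
by move=> ->; rewrite fineK// muleC.
Qed.

Lemma probability_integral_cst (r : \bar R) : \int[P]_w r = r.
Proof.
rewrite integral_cst// -[RHS]mule1; congr (_ * _); exact: probability_setT.
Qed.

Lemma markov_event (E : set Omega) (h : Omega -> \bar R) (c : R) :
  measurable E -> (0 < c)%R -> (forall w, 0 <= h w) ->
  (forall w, E w -> c%:E <= h w) -> P E <= (c^-1)%:E * \int[P]_w h w.
Proof.
move=> mE c0 h0 Eh; rewrite lee_pdivlMl//.
have mi : measurable_fun setT (fun w => (\1_E w)%:E : \bar R).
  exact/measurable_EFinP/measurable_indic.
have <- : \int[P]_w (c%:E * (\1_E w)%:E) = c%:E * P E.
  rewrite ge0_integralZl//; last by rewrite lee_fin ltW.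
  by rewrite integral_indic// setIT.
apply: ge0_le_integral_nonmeas => w; first by rewrite -EFinM lee_fin mulr_ge0 // ltW.
rewrite indicE; have [/[!inE] Ew|] := boolP (w \in E); first by rewrite mule1 Eh.
by rewrite mule0.
Qed.

(** The second moment of the sum splits into [N] diagonal terms, each at most
    [C ^+ 2], and off-diagonal terms that factor; this gives variance at most
    [C ^+ 2 / N] for the average. *)
Lemma average_deviation {d1} {T : measurableType d1} (N : nat)
    (U : 'I_N -> {mfun Omega >-> T}) (X : {mfun Omega >-> T})
    (g : T -> R) (C m k : R) :
  (0 < N)%N -> (0 < k)%R ->
  (forall i, same_law P (U i) X) -> (forall i j, i != j -> indep_pair P (U i) (U j)) ->
  measurable_fun setT g -> (forall x, (0 <= g x <= C)%R) ->
  \int[P]_w (g (X w))%:E = m%:E ->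
  P [set w | (k <= `|N%:R^-1 * (\sum_(i < N) g (U i w)) - m|)%R]
    <= (C ^+ 2 / (N%:R * k ^+ 2))%:E.
Proof.
move=> N0 k0 UX UU mg gC gm.
have g0 x : (0 <= g x)%R by have /andP[] := gC x.
have C0 : (0 <= C)%R by have /andP[/le_trans] := gC point; apply.
have m0 : (0 <= m)%R by rewrite -lee_fin -gm integral_ge0// => w _; rewrite lee_fin.
have mgU i : measurable_fun setT (fun w => g (U i w)) by exact: measurableT_comp.
pose A w := (\sum_(i < N) g (U i w))%R.
have A0 w : (0 <= A w)%R by exact: sumr_ge0.
have mA : measurable_fun setT A by exact: measurable_sum.
have Egi i : \int[P]_w (g (U i w))%:E = m%:E.
  rewrite -gm (same_law_integral (h := EFin \o g) (UX i))//.
  exact/measurable_EFinP.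
have EA : \int[P]_w (A w)%:E = (N%:R * m)%:E.
  under eq_integral do rewrite /A -sumEFin.
  rewrite ge0_integral_sum//; last 2 first.
  - by move=> i; exact/measurable_EFinP.
  - by move=> i w _; rewrite lee_fin.
  under eq_bigr do rewrite Egi.
  by rewrite sumEFin sumr_const card_ord mulr_natl.
have EA2 : \int[P]_w ((A w) ^+ 2)%:E <= (N%:R * C ^+ 2 + N%:R ^+ 2 * m ^+ 2)%:E.
  have -> : \int[P]_w ((A w) ^+ 2)%:E =
      \sum_(i < N) \sum_(j < N) \int[P]_w (g (U i w) * g (U j w))%:E.
    have e w : ((A w) ^+ 2)%:E = \sum_(i < N) \sum_(j < N) (g (U i w) * g (U j w))%:E.
      rewrite expr2 /A mulr_suml -sumEFin; apply: eq_bigr => i _.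
      by rewrite mulr_sumr -sumEFin.
    under eq_integral do rewrite e.
    rewrite ge0_integral_sum//; last 2 first.
    - by move=> i; apply: emeasurable_sum => j; exact/measurable_EFinP/measurable_funM.
    - by move=> i w _; apply: sume_ge0 => j _; rewrite lee_fin mulr_ge0.
    apply: eq_bigr => i _; rewrite ge0_integral_sum//.
    - by move=> j; exact/measurable_EFinP/measurable_funM.
    - by move=> j w _; rewrite lee_fin mulr_ge0.
  have t (i j : 'I_N) : \int[P]_w (g (U i w) * g (U j w))%:E <=
      ((i == j)%:R * C ^+ 2 + m ^+ 2)%:E.
    have [->|ij] := eqVneq i j.
      apply: (@le_trans _ _ (\int[P]_w (C ^+ 2)%:E)).
        apply: ge0_le_integral_nonmeas => w; first by rewrite lee_fin mulr_ge0.
        have /andP[a b] := gC (U j w).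
        by rewrite lee_fin expr2 ler_pM.
      rewrite probability_integral_cst lee_fin mul1r lerDl.
      exact: sqr_ge0.
    rewrite mul0r add0r.
    have mgg : measurable_fun setT (fun z : T * T => (g z.1 * g z.2)%:E : \bar R).
      by apply/measurable_EFinP/measurable_funM; exact: measurableT_comp.
    rewrite (indep_integral (h := fun z => (g z.1 * g z.2)%:E) (UU i j ij))//; last first.
      by move=> z; rewrite lee_fin mulr_ge0.
    have Egg x : \int[P]_w' (g x * g (U j w'))%:E = (g x)%:E * m%:E.
      under eq_integral do rewrite EFinM.
      rewrite ge0_integralZl ?Egi//=.
      - exact/measurable_EFinP.
      - by move=> ? _; rewrite lee_fin.
      - by rewrite lee_fin.
    under eq_integral do rewrite Egg.
    rewrite ge0_integralZr//=; last 2 first.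
    - exact/measurable_EFinP.
    - by move=> ? _; rewrite lee_fin.
    by rewrite Egi -EFinM -expr2.
  apply: (@le_trans _ _ (\sum_(i < N) \sum_(j < N) ((i == j)%:R * C ^+ 2 + m ^+ 2)%:E)).
    by apply: lee_sum => i _; apply: lee_sum => j _; exact: t.
  under eq_bigr do rewrite sumEFin.
  rewrite sumEFin lee_fin.
  under eq_bigr => i _.
    rewrite big_split/= -mulr_suml (bigD1 i)//= eqxx big1 ?addr0 ?mul1r; last first.
      by move=> j /negbTE; rewrite eq_sym => ->.
    rewrite sumr_const card_ord.
    over.
  rewrite sumr_const card_ord -[leLHS]mulr_natl -(mulr_natl (m ^+ 2)).
  rewrite le_eqVlt; apply/orP; left; apply/eqP; ring.
have mE : measurable [set w | (k <= `|N%:R^-1 * A w - m|)%R].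
  rewrite -[X in measurable X]setTI; apply: measurable_fun_le => //.
  by apply: measurableT_comp => //; apply: measurable_funB => //; exact: measurable_funM.
have Nr : (0 < N%:R :> R)%R by rewrite ltr0n.
have c0 : (0 < N%:R ^+ 2 * k ^+ 2 :> R)%R by rewrite mulr_gt0 ?exprn_gt0.
have h0 w : 0 <= ((A w - N%:R * m) ^+ 2)%:E by rewrite lee_fin sqr_ge0.
apply: (le_trans (markov_event mE c0 h0 _)) => [w /= kA|].
  rewrite lee_fin -exprMn -[leRHS]ger0_norm ?sqr_ge0// normrX lerXn2r ?nnegrE ?mulr_ge0 ?(ltW Nr) ?(ltW k0)//.
  apply: le_trans (ler_wpM2l (ltW Nr) kA) _.
  rewrite -[X in (X * _)%R](gtr0_norm Nr) -normrM mulrBr mulrA divff ?gt_eqF//.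
  by rewrite mul1r.
have V : \int[P]_w ((A w - N%:R * m) ^+ 2)%:E <= (N%:R * C ^+ 2)%:E.
  have mh : measurable_fun setT (fun w => ((A w - N%:R * m) ^+ 2)%:E : \bar R).
    by apply/measurable_EFinP; apply: measurable_funX; exact: measurable_funB.
  have : \int[P]_w ((A w - N%:R * m) ^+ 2)%:E + (2 * (N%:R * m) * (N%:R * m))%:E =
      \int[P]_w ((A w) ^+ 2)%:E + ((N%:R * m) ^+ 2)%:E.
    have -> : (2 * (N%:R * m) * (N%:R * m))%:E = \int[P]_w ((2 * (N%:R * m))%:E * (A w)%:E).
      rewrite ge0_integralZl ?EA//.
      - exact/measurable_EFinP.
      - by move=> w _; rewrite lee_fin.
      - by rewrite lee_fin !mulr_ge0.
    have -> : ((N%:R * m) ^+ 2)%:E = \int[P]_w ((N%:R * m) ^+ 2)%:E.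
      by rewrite probability_integral_cst.
    rewrite -!ge0_integralD//; last 5 first.
    - by move=> w _; rewrite lee_fin sqr_ge0.
    - exact/measurable_EFinP/measurable_funX.
    - by move=> w _; rewrite lee_fin sqr_ge0.
    - by move=> w _; rewrite -EFinM lee_fin !mulr_ge0.
    - by apply/measurable_EFinP; exact: measurable_funM.
    apply: eq_integral => w _; rewrite -EFinM -!EFinD; congr EFin; ring.
  move=> e; rewrite -(@leeD2rE _ (2 * (N%:R * m) * (N%:R * m))%:E)// e.
  apply: (le_trans (leeD2r _ EA2)); rewrite -!EFinD lee_fin; lra.
apply: (le_trans (lee_pmul _ _ (lexx _) V)).
- by rewrite lee_fin invr_ge0 ltW.
- by apply: integral_ge0 => w _.
rewrite -EFinM lee_fin le_eqVlt; apply/orP; left; apply/eqP; field.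
by rewrite !gt_eqF.
Qed.

End independent_families.

(** * Gaussian densities and counting on a grid *)

Section gaussian_density.
Context {R : realType}.
Implicit Types (m a b t y v : R).

Definition gauss_exp v x : R := expR (- (x ^+ 2 / (2 * v))).

Lemma normal_pdf_gauss_exp m a y : 0 < a ->
  normal_pdf m a y = normal_peak a * gauss_exp (a ^+ 2) (y - m).
Proof.
move=> a0; rewrite normal_pdfE ?gt_eqF// /normal_fun /gauss_exp mulNr.
by rewrite mulr_natl.
Qed.

Lemma gauss_exp_gt0 v x : 0 < gauss_exp v x. Proof. exact: expR_gt0. Qed.

Lemma gauss_exp_le1 v x : 0 < v -> gauss_exp v x <= 1.
Proof.
move=> v0; rewrite -[leRHS]expR0 ler_expR oppr_le0 divr_ge0 ?sqr_ge0//.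
by rewrite mulr_ge0// ltW.
Qed.

Lemma peak_arg_gt0 v : 0 < v -> 0 < v * pi *+ 2.
Proof. by move=> v0; rewrite mulrn_wgt0// mulr_gt0// pi_gt0. Qed.

Lemma peak_argV_le v w : 0 < v -> v <= w ->
  (Num.sqrt (w * pi *+ 2))^-1 <= (Num.sqrt (v * pi *+ 2))^-1.
Proof.
move=> v0 vw; have w0 : 0 < w by exact: lt_le_trans vw.
rewrite lef_pV2 ?posrE ?sqrtr_gt0 ?peak_arg_gt0//.
by rewrite ler_wsqrtr// lerMn2r/= ler_pM2r ?pi_gt0.
Qed.

Lemma normal_peak_le a b : 0 < a -> a <= b -> normal_peak b <= normal_peak a.
Proof.
move=> a0 ab; have b0 : 0 < b by exact: lt_le_trans ab.
by rewrite peak_argV_le ?exprn_gt0// ler_pXn2r ?nnegrE ?(ltW a0) ?(ltW b0).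
Qed.

(** The half-length of the interval on which the density is at least [t]; it is
    negative exactly when there is no such point. *)
Definition level_radius a t : R :=
  let q := - (2 * a ^+ 2 * ln (t / normal_peak a)) in
  if 0 <= q then Num.sqrt q else -1.

Lemma normal_superlevel m a t y : 0 < a -> 0 < t ->
  (t <= normal_pdf m a y) = (`|y - m| <= level_radius a t).
Proof.
move=> a0 t0; have p0 : 0 < normal_peak a by rewrite normal_peak_gt0 ?gt_eqF.
rewrite normal_pdf_gauss_exp// mulrC -ler_pdivrMr//.
have tp : 0 < t / normal_peak a by rewrite divr_gt0.
rewrite -[X in X <= _](lnK tp) /gauss_exp ler_expR lerNr.
have a2 : 0 < 2 * a ^+ 2 by rewrite mulr_gt0 ?exprn_gt0.
rewrite ler_pdivrMr// mulNr mulrC /level_radius.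
set q := - _; case: ifP => [q0|/negbT]; last first.
  rewrite -ltNge => q0; rewrite leNgt (lt_le_trans q0) ?sqr_ge0//=.
  by apply/esym/negbTE; rewrite -ltNge; apply: lt_le_trans (normr_ge0 _); lra.
by rewrite -ler_sqrt ?sqrtr_sqr.
Qed.

Lemma lebesgue_ball m r :
  lebesgue_measure [set y : R | `|y - m| <= r] = (2 * Num.max r 0)%:E.
Proof.
have -> : [set y : R | `|y - m| <= r] = `[m - r, m + r]%classic.
  by apply/seteqP; split=> y /=; rewrite in_itv/= ler_distl.
rewrite lebesgue_measure_itv/= lte_fin; case: ltP => h.
  by rewrite -EFinB; congr EFin; rewrite max_l; lra.
by congr EFin; rewrite max_r ?mulr0//; lra.
Qed.

(** On its superlevel set the density is at least [t], and it integrates to [1],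
    so the set has length at most [t^-1]. *)
Lemma level_radius_le a t : 0 < a -> 0 < t -> 2 * Num.max (level_radius a t) 0 <= t^-1.
Proof.
move=> a0 t0; rewrite -lee_fin -(lebesgue_ball 0).
set D := [set y | _].
have mD : measurable D.
  rewrite -[X in measurable X]setTI; apply: measurable_fun_le => //.
  by apply: measurableT_comp => //; exact: measurable_funB.
rewrite -[leRHS]mule1 -(integral_normal_pdf 0 a) lee_pdivlMl//.
have -> : (t%:E * lebesgue_measure D = \int[lebesgue_measure]_(y in D) t%:E)%E.
  by rewrite integral_cst.
apply: (@le_trans _ _ (\int[lebesgue_measure]_(y in D) (normal_pdf 0 a y)%:E)%E).
  apply: ge0_le_integral => //.
  - by move=> y _; rewrite lee_fin ltW.
  - by apply/measurable_EFinP; apply: measurable_funTS; exact: measurable_normal_pdf.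
  - by move=> y /= Dy; rewrite lee_fin normal_superlevel.
apply: ge0_subset_integral => //.
- by apply/measurable_EFinP; exact: measurable_normal_pdf.
- by move=> y _; rewrite lee_fin normal_pdf_ge0.
Qed.

(** Convexity of the exponential: the slope of the chord is at most that of its
    steeper end. *)
Lemma expRN_diff (A B : R) : A <= B -> expR (- A) - expR (- B) <= (B - A) * expR (- A).
Proof.
move=> AB; have -> : - B = - (B - A) + - A by ring.
rewrite expRD; have := expR_ge1Dx (- (B - A)); have := expR_gt0 (- A); nra.
Qed.

Lemma mul_expRN_le1 (A : R) : A * expR (- A) <= 1.
Proof.
rewrite expRN ler_pdivrMr ?expR_gt0// mul1r.
by have := expR_ge1Dx A; lra.
Qed.

(** Changing the variance multiplies the exponent [A] by a factor [c >= 1], and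
    [A * expR (- A) <= 1], so the change is at most [c - 1] whatever [A] is. *)
Lemma gauss_exp_variance v w x : 0 < v -> 0 < w -> v <= w ->
  `|gauss_exp w x - gauss_exp v x| <= (w - v) / v.
Proof.
move=> v0 w0 vw; rewrite /gauss_exp.
set A := x ^+ 2 / (2 * w); set B := x ^+ 2 / (2 * v).
have A0 : 0 <= A by rewrite divr_ge0 ?sqr_ge0 ?mulr_ge0// ltW.
have BE : B = A * (w / v) by rewrite /A /B; field; rewrite !gt_eqF.
have AB : A <= B by rewrite BE ler_peMr// ler_pdivlMr// mul1r.
rewrite ger0_norm ?subr_ge0 ?ler_expR ?lerN2//.
apply: (le_trans (expRN_diff AB)).
have -> : (B - A) * expR (- A) = ((w - v) / v) * (A * expR (- A)).
  by rewrite BE; field; rewrite gt_eqF.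
by rewrite ler_piMr ?mul_expRN_le1// divr_ge0 ?subr_ge0// ltW.
Qed.

(** The derivative of [p |-> expR (- (p ^+ 2 * K))] is bounded: the exponential
    brings [2 * p * K <= (1 + p ^+ 2) * K] below [K + 1] by [mul_expRN_le1]. The quadratic
    term absorbs the distance between the two points. *)
Lemma gauss_exp_shift v x z : 0 < v ->
  `|gauss_exp v x - gauss_exp v z| <=
  ((2 * v)^-1 + 1) * (`|x - z| + `|x - z| ^+ 2).
Proof.
move=> v0; set K := (2 * v)^-1.
have K0 : 0 < K by rewrite invr_gt0 mulr_gt0.
have sym u : gauss_exp v u = gauss_exp v `|u|.
  by rewrite /gauss_exp -normrX ger0_norm ?sqr_ge0.
wlog xz : x z / `|x| <= `|z|.
  move=> H; case: (leP `|x| `|z|) => [/H//|/ltW/H].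
  by rewrite distrC (distrC z).
set D := `|x - z|; have D0 : 0 <= D by exact: normr_ge0.
have dD : `|z| - `|x| <= D by rewrite /D distrC (le_trans (ler_norm _)) ?ler_dist_dist.
rewrite sym [X in _ - X]sym /gauss_exp -/K.
set p := `|x| in xz dD *; set q := `|z| in xz dD *.
have p0 : 0 <= p by exact: normr_ge0.
have AB : p ^+ 2 * K <= q ^+ 2 * K.
  by rewrite ler_pM2r// ler_pXn2r ?nnegrE//; exact: le_trans xz.
rewrite ger0_norm ?subr_ge0 ?ler_expR ?lerN2//.
apply: (le_trans (expRN_diff AB)).
set E := expR _; have E0 : 0 < E by exact: expR_gt0.
have E1 : E <= 1 by rewrite -[leRHS]expR0 ler_expR oppr_le0 mulr_ge0 ?sqr_ge0// ltW.
have pE : p ^+ 2 * K * E <= 1 by exact: mul_expRN_le1.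
have qp : q ^+ 2 - p ^+ 2 <= 2 * p * D + D ^+ 2 by nra.
apply: (@le_trans _ _ ((2 * p * D + D ^+ 2) * K * E)).
  by rewrite -mulrBl ler_pM2r// ler_pM2r.
have h : 2 * p * K * E <= K + 1.
  have : 2 * p * K * E <= (1 + p ^+ 2) * K * E by rewrite !ler_pM2r//; have := sqr_ge0 (p - 1); rewrite sqrrB expr1n mulr1; lra.
  have : K * E <= K by nra.
  lra.
have -> : (2 * p * D + D ^+ 2) * K * E = (2 * p * K * E) * D + D ^+ 2 * (K * E) by ring.
have KE : K * E <= K + 1 by nra.
rewrite mulrDr; apply: lerD; first by rewrite ler_wpM2r.
by rewrite mulrC ler_wpM2r ?sqr_ge0.
Qed.

Lemma normal_peak_variance v0 a b : 0 < v0 -> 0 < a -> 0 < b ->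
  v0 <= a ^+ 2 -> v0 <= b ^+ 2 ->
  `|normal_peak a - normal_peak b| <=
    pi * 2 * (Num.sqrt (v0 * pi *+ 2))^-1 ^+ 3 * `|a ^+ 2 - b ^+ 2|.
Proof.
move=> v00 a0 b0 va vb; rewrite /normal_peak.
have pi0 : 0 < pi :> R by exact: pi_gt0.
set p := Num.sqrt (a ^+ 2 * _ *+ _); set q := Num.sqrt (b ^+ 2 * _ *+ _).
set c := Num.sqrt (v0 * _ *+ _).
have c0 : 0 < c by rewrite sqrtr_gt0 mulrn_wgt0// mulr_gt0.
have cp : c <= p by rewrite ler_wsqrtr// lerMn2r/= ler_pM2r.
have cq : c <= q by rewrite ler_wsqrtr// lerMn2r/= ler_pM2r.
have p0 : 0 < p by exact: lt_le_trans cp.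
have q0 : 0 < q by exact: lt_le_trans cq.
have p2 : p ^+ 2 = a ^+ 2 * pi *+ 2.
  by rewrite sqr_sqrtr// mulrn_wge0// mulr_ge0 ?sqr_ge0// ltW.
have q2 : q ^+ 2 = b ^+ 2 * pi *+ 2.
  by rewrite sqr_sqrtr// mulrn_wge0// mulr_ge0 ?sqr_ge0// ltW.
have -> : p^-1 - q^-1 = (q ^+ 2 - p ^+ 2) / (p * q * (p + q)).
  by field; rewrite !gt_eqF// addr_gt0.
have -> : q ^+ 2 - p ^+ 2 = (pi * 2) * (b ^+ 2 - a ^+ 2) by rewrite p2 q2; ring.
rewrite normrM normrM gtr0_norm ?mulr_gt0// distrC -mulrA -[leRHS]mulrA.
rewrite ler_pM2l ?mulr_gt0// mulrC ler_wpM2r//.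
rewrite gtr0_norm ?invr_gt0 ?mulr_gt0 ?addr_gt0//.
rewrite exprVn lef_pV2 ?posrE ?mulr_gt0 ?addr_gt0 ?exprn_gt0//.
by rewrite exprSr expr2 !ler_pM ?mulr_ge0 ?(ltW c0)//; lra.
Qed.

(** The two densities are compared through the one with the first mean and the
    second variance, all three peaks and exponentials being bounded in terms of
    the lower bound [v0] on the variances. *)
Lemma normal_pdf_lipschitz v0 : 0 < v0 -> exists2 C : R, 0 < C &
  forall m1 m2 a b y, 0 < a -> 0 < b -> v0 <= a ^+ 2 -> v0 <= b ^+ 2 ->
    `|normal_pdf m1 a y - normal_pdf m2 b y| <=
    C * (`|a ^+ 2 - b ^+ 2| + (`|m1 - m2| + `|m1 - m2| ^+ 2)).
Proof.
move=> v00; have pi0 : 0 < pi :> R by exact: pi_gt0.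
pose c : R := (Num.sqrt (v0 * pi *+ 2))^-1.
have c0 : 0 < c by rewrite invr_gt0 sqrtr_gt0 mulrn_wgt0// mulr_gt0.
pose C1 := pi * 2 * c ^+ 3.
have C10 : 0 < C1 by rewrite !mulr_gt0// exprn_gt0.
exists (C1 + c * v0^-1 + c * ((2 * v0)^-1 + 1)).
  by rewrite !addr_gt0// mulr_gt0// ?addr_gt0// invr_gt0// mulr_gt0.
move=> m1 m2 a b y a0 b0 va vb.
have peakc e : 0 < e -> v0 <= e ^+ 2 -> normal_peak e <= c.
  by move=> e0 ve; exact: peak_argV_le.
have a20 : 0 < a ^+ 2 by rewrite exprn_gt0.
have b20 : 0 < b ^+ 2 by rewrite exprn_gt0.
rewrite !normal_pdf_gauss_exp//.
set g1 := gauss_exp _ _; set g2 := gauss_exp _ _; set g := gauss_exp (b ^+ 2) (y - m1).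
set p := normal_peak a; set q := normal_peak b.
have q0 : 0 < q by rewrite normal_peak_gt0 ?gt_eqF.
have -> : p * g1 - q * g2 = (p - q) * g1 + q * (g1 - g) + q * (g - g2) by ring.
have h1 : `|(p - q) * g1| <= C1 * `|a ^+ 2 - b ^+ 2|.
  rewrite normrM (gtr0_norm (gauss_exp_gt0 _ _)).
  apply: le_trans (normal_peak_variance v00 a0 b0 va vb).
  by rewrite ler_piMr// gauss_exp_le1.
have h2 : `|q * (g1 - g)| <= c * v0^-1 * `|a ^+ 2 - b ^+ 2|.
  rewrite normrM gtr0_norm// -mulrA; apply: ler_pM => //; first exact: ltW.
    exact: peakc.
  case: (leP (a ^+ 2) (b ^+ 2)) => ab.
    rewrite distrC (le_trans (gauss_exp_variance _ _ _ _))//.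
    rewrite distrC ger0_norm ?subr_ge0// mulrC ler_wpM2r ?subr_ge0//.
    by rewrite lef_pV2 ?posrE.
  rewrite (le_trans (gauss_exp_variance _ _ _ (ltW ab)))//.
  rewrite gtr0_norm ?subr_gt0// mulrC ler_pM2r ?subr_gt0//.
  by rewrite lef_pV2 ?posrE.
have h3 : `|q * (g - g2)| <= c * ((2 * v0)^-1 + 1) * (`|m1 - m2| + `|m1 - m2| ^+ 2).
  rewrite normrM gtr0_norm// -mulrA; apply: ler_pM => //; first exact: ltW.
    exact: peakc.
  apply: (le_trans (gauss_exp_shift _ _ b20)).
  have -> : y - m1 - (y - m2) = m2 - m1 by ring.
  rewrite distrC ler_wpM2r ?addr_ge0 ?sqr_ge0// lerD2r lef_pV2 ?posrE ?mulr_gt0//.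
  by rewrite ler_pM2l.
apply: (le_trans (ler_normD _ _)); apply: (le_trans (lerD (ler_normD _ _) (lexx _))).
apply: (le_trans (lerD (lerD h1 h2) h3)).
set u := `|a ^+ 2 - _|; set w := `|m1 - m2| + _.
have u0 : 0 <= u by exact: normr_ge0.
have w0 : 0 <= w by rewrite addr_ge0 ?sqr_ge0.
have v1 : 0 < (2 * v0)^-1 + 1 by rewrite addr_gt0// invr_gt0 mulr_gt0.
have v2 : 0 < v0^-1 by rewrite invr_gt0.
move: (_ + 1) (v0^-1) v1 v2 => e1 e2 e10 e20.
have : 0 <= C1 * w by rewrite mulr_ge0// ltW.
have : 0 <= c * e2 * w by rewrite !mulr_ge0// ltW.
have : 0 <= c * e1 * u by rewrite !mulr_ge0// ltW.
lra.
Qed.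

(** Bounds the density from below on a whole ball, uniformly over the variances
    in a compact range: this keeps the empirical level away from [0]. *)
Lemma normal_pdf_lower v0 v1 K m a y : 0 < v0 -> 0 < a -> v0 <= a ^+ 2 <= v1 ->
  `|y - m| <= K ->
  (Num.sqrt (v1 * pi *+ 2))^-1 * expR (- (K ^+ 2 / (2 * v0))) <= normal_pdf m a y.
Proof.
move=> v00 a0 /andP[va av] yK; rewrite normal_pdf_gauss_exp// /normal_peak.
have pi0 : 0 < pi :> R by exact: pi_gt0.
have a20 : 0 < a ^+ 2 by rewrite exprn_gt0.
have v10 : 0 < v1 by exact: lt_le_trans av.
have K0 : 0 <= K by exact: le_trans yK.
apply: ler_pM; rewrite ?invr_ge0 ?expR_ge0//.
  exact: peak_argV_le.
rewrite ler_expR lerN2 ler_pM ?sqr_ge0 ?invr_ge0 ?(mulr_ge0 _ (ltW a20))//.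
  by rewrite -[leLHS]real_normK ?num_real// ler_pXn2r ?nnegrE.
by rewrite lef_pV2 ?posrE ?mulr_gt0// ler_pM2l.
Qed.

End gaussian_density.

(** The points of the grid in an interval are the integers of a rescaled
    interval, so their number times the step is the length up to one step. *)
Section grid.
Context {R : realType}.
Implicit Types (al be m r s : R).

(** The induction needs the sharper bound where [be] is cut at the last integer
    available. *)
Lemma count_integers_le al be (M : nat) : al <= be ->
  \sum_(k < M) (al <= k%:R <= be)%R%:R <= be - al + 1.
Proof.
move=> ab; suff : \sum_(k < M) (al <= k%:R <= be)%R%:R <=
    Num.max 0 (Num.min be (M%:R - 1) - al + 1).
  move=> /le_trans; apply; rewrite ge_max; apply/andP; split; first lra.
  by rewrite lerD2r lerD2r ge_min lexx.
elim: M => [|M IH]; first by rewrite big_ord0 le_max lexx.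
rewrite big_ord_recr/= -natr1 addrK.
case: (boolP (_ <= _ <= _)) => [/andP[h1 h2]|_].
  rewrite (min_r h2) le_max; apply/orP; right.
  rewrite lerD2r; apply: (le_trans IH); rewrite ge_max; apply/andP; split; first lra.
  have : Num.min be (M%:R - 1) <= M%:R - 1 by rewrite ge_min lexx orbT.
  lra.
rewrite addr0; apply: (le_trans IH); rewrite ge_max !le_max lexx/=.
apply/orP; right; rewrite !lerD2r le_min ge_min lexx/= ge_min.
by apply/orP; right; lra.
Qed.

Lemma count_integers_ge al be (M : nat) : 0 <= al -> be <= M%:R ->
  be - al - 1 <= \sum_(k < M) (al <= k%:R <= be)%R%:R.
Proof.
move=> al0 beM; suff : Num.min be M%:R - al - 1 <= \sum_(k < M) (al <= k%:R <= be)%R%:R.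
  by rewrite min_l.
elim: M {beM} => [|M IH].
  have : Num.min be 0 <= 0 by rewrite ge_min lexx orbT.
  by rewrite big_ord0; lra.
rewrite big_ord_recr/= -natr1.
have S0 : 0 <= \sum_(k < M) (al <= k%:R <= be)%R%:R :> R by exact: sumr_ge0.
have h1 : Num.min be (M%:R + 1) <= M%:R + 1 by rewrite ge_min lexx orbT.
have h2 : Num.min be (M%:R + 1) <= be by rewrite ge_min lexx.
case: (leP al M%:R) => ha /=; last by lra.
case: (leP be M%:R) => hb.
  move: IH; rewrite (min_l hb) min_l; last by lra.
  by move=> IH; rewrite (le_trans IH)// lerDl.
move: IH; rewrite (min_r (ltW hb)) (ltW hb)/=; lra.
Qed.

Lemma grid_point_dist s (M k : nat) m r : 0 < s -> (0 < M)%N ->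
  (`|grid_point s M k - m| <= r) =
  ((m - r + s) * (M%:R / (2 * s)) <= k%:R <= (m + r + s) * (M%:R / (2 * s))).
Proof.
move=> s0 M0; have Mr : 0 < M%:R :> R by rewrite ltr0n.
have c0 : 0 < M%:R / (2 * s) by rewrite divr_gt0// mulr_gt0.
have e : k%:R = (2 * s * k%:R / M%:R) * (M%:R / (2 * s)) :> R.
  by field; rewrite !gt_eqF.
rewrite ler_distl /grid_point {3 4}e !ler_pM2r//.
set g := 2 * s * _ / _; by apply/idP/idP => /andP[h1 h2]; apply/andP; split; lra.
Qed.

Lemma grid_count_le s (M : nat) m r (Q : nat -> bool) : 0 < s -> (0 < M)%N -> 0 <= r ->
  (forall k, Q k -> `|grid_point s M k - m| <= r) ->
  2 * s / M%:R * (\sum_(k < M) (Q k)%:R) <= 2 * r + 2 * s / M%:R.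
Proof.
move=> s0 M0 r0 Qr; have Mr : 0 < M%:R :> R by rewrite ltr0n.
have c0 : 0 < M%:R / (2 * s) by rewrite divr_gt0// mulr_gt0.
have d0 : 0 < 2 * s / M%:R by rewrite divr_gt0// mulr_gt0.
have -> : 2 * r + 2 * s / M%:R = 2 * s / M%:R * ((m + r + s) * (M%:R / (2 * s)) - (m - r + s) * (M%:R / (2 * s)) + 1).
  by field; rewrite !gt_eqF.
rewrite ler_pM2l//; apply: le_trans (count_integers_le M _); last first.
  by rewrite ler_pM2r//; lra.
apply: ler_sum => k _; rewrite -grid_point_dist//.
by case: (boolP (Q k)) => [/Qr ->|_].
Qed.

Lemma grid_count_ge s (M : nat) m r (Q : nat -> bool) : 0 < s -> (0 < M)%N ->
  - s <= m - r -> m + r <= s ->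
  (forall k, `|grid_point s M k - m| <= r -> Q k) ->
  2 * r - 2 * s / M%:R <= 2 * s / M%:R * (\sum_(k < M) (Q k)%:R).
Proof.
move=> s0 M0 h1 h2 Qr; have Mr : 0 < M%:R :> R by rewrite ltr0n.
have c0 : 0 < M%:R / (2 * s) by rewrite divr_gt0// mulr_gt0.
have d0 : 0 < 2 * s / M%:R by rewrite divr_gt0// mulr_gt0.
have -> : 2 * r - 2 * s / M%:R = 2 * s / M%:R * ((m + r + s) * (M%:R / (2 * s)) - (m - r + s) * (M%:R / (2 * s)) - 1).
  by field; rewrite !gt_eqF.
set al := (m - r + s) * _; set be := (m + r + s) * _.
rewrite ler_pM2l//; apply: le_trans (@count_integers_ge al be M _ _) _.
- by rewrite mulr_ge0 ?(ltW c0)//; lra.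
- have e : M%:R = (2 * s) * (M%:R / (2 * s)) :> R by field; rewrite gt_eqF.
  rewrite [leRHS]e ler_pM2r//; lra.
apply: ler_sum => k _; rewrite -grid_point_dist//.
by case: (boolP (_ <= r)) => [/Qr ->|_].
Qed.

Lemma grid_point_itv s (M k : nat) : 0 < s -> (k < M)%N -> `|grid_point s M k| <= s.
Proof.
move=> s0 kM; have M0 : 0 < M%:R :> R by rewrite ltr0n (leq_ltn_trans _ kM).
rewrite /grid_point ler_norml.
have h : 0 <= 2 * s * k%:R / M%:R <= 2 * s.
  rewrite divr_ge0 ?mulr_ge0 ?(ltW s0) ?(ltW M0)//=.
  by rewrite ler_pdivrMr// ler_pM2l ?mulr_gt0// ler_nat ltnW.
by case/andP: h => h1 h2; apply/andP; split; lra.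
Qed.

End grid.

(** * The oracle level *)

Section measurability.
Context {d : measure_display} {T : measurableType d} {R : realType}.

Lemma measurable_bool_set (b : T -> bool) :
  measurable_fun setT b -> measurable [set w | b w].
Proof.
move=> mb; rewrite (_ : [set w | b w] = setT `&` b @^-1` [set true]).
  exact: mb.
by rewrite setTI; apply/seteqP; split.
Qed.

Lemma measurable_boolR (b : T -> bool) :
  measurable_fun setT b -> measurable_fun setT (fun w => (b w)%:R : R).
Proof.
move=> mb; rewrite (_ : (fun w => _) = (fun w => if b w then 1 else 0 : R)).
  exact: measurable_fun_ifT.
by apply/funext => w; case: (b w).
Qed.

Lemma measurable_invr_gt0 (g : T -> R) : (forall w, 0 < g w) ->
  measurable_fun setT g -> measurable_fun setT (fun w => (g w)^-1).
Proof.
move=> g0 mg; rewrite (_ : (fun w => _) = (fun w => expR (- ln (g w)))).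
  by apply: measurableT_comp => //; apply: measurableT_comp => //; exact: measurableT_comp.
by apply/funext => w; rewrite expRN lnK// posrE.
Qed.

Lemma measurable_sqrtr (g : T -> R) :
  measurable_fun setT g -> measurable_fun setT (fun w => Num.sqrt (g w)).
Proof.
move=> mg; apply: measurableT_comp => //.
by apply: continuous_measurable_fun; exact: sqrt_continuous.
Qed.

Lemma measurable_normal_pdf_comp (m a y : T -> R) : (forall w, 0 < a w) ->
  measurable_fun setT m -> measurable_fun setT a -> measurable_fun setT y ->
  measurable_fun setT (fun w => normal_pdf (m w) (a w) (y w)).
Proof.
move=> a0 mm ma my.
rewrite (_ : (fun w => _) = fun w =>
    (Num.sqrt (a w ^+ 2 * pi *+ 2))^-1 *
    expR (- ((y w - m w) ^+ 2 * (2 * a w ^+ 2)^-1))); last first.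
  by apply/funext => w; rewrite normal_pdf_gauss_exp.
apply: measurable_funM.
  apply: measurable_invr_gt0.
    by move=> w; rewrite sqrtr_gt0 peak_arg_gt0// exprn_gt0.
  apply: measurable_sqrtr; under eq_fun do rewrite -mulr_natr.
  apply: measurable_funM => //; apply: measurable_funM => //.
  exact: measurable_funX.
apply: measurableT_comp => //; apply: measurableT_comp => //.
apply: measurable_funM.
  by apply: measurable_funX; exact: measurable_funB.
apply: measurable_invr_gt0; first by move=> w; rewrite mulr_gt0// exprn_gt0.
by apply: measurable_funM => //; exact: measurable_funX.
Qed.

End measurability.

Section oracle_levels.
Context {disp : measure_display} {Omega : measurableType disp} {R : realType}.
Variables (P : probability Omega R) (d : nat) (X : {mfun Omega >-> d.-tuple R}).
Variables (f sigma : d.-tuple R -> R) (sigma0 sigma1 : R).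
Hypothesis f_meas : measurable_fun setT f.
Hypothesis sigma_meas : measurable_fun setT sigma.
Hypothesis sigma0_gt0 : 0 < sigma0.
Hypothesis sigma_bounds : forall x, sigma0 <= sigma x <= sigma1.

Let sigma_gt0 x : 0 < sigma x.
Proof. by have /andP[h _] := sigma_bounds x; exact: lt_le_trans h. Qed.

Let sigma_ge x : sigma0 <= sigma x. Proof. by have /andP[] := sigma_bounds x. Qed.

Let sigma1_gt0 : 0 < sigma1.
Proof.
by have /andP[h h'] := sigma_bounds point; rewrite (lt_le_trans sigma0_gt0)// (le_trans h).
Qed.

Lemma cond_density_le y x : cond_density f sigma y x <= normal_peak sigma0.
Proof.
apply: (le_trans (normal_pdf_ub _ _ _)); first by rewrite gt_eqF.
exact: normal_peak_le.
Qed.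

Lemma measurable_cond_density :
  measurable_fun setT (fun z : d.-tuple R * R => cond_density f sigma z.2 z.1).
Proof.
by apply: measurable_normal_pdf_comp => //=; exact: measurableT_comp.
Qed.

(** The length of the superlevel set of the density at [x]; see
    [lebesgue_level_set]. *)
Definition level_length (t : R) (x : d.-tuple R) : R :=
  2 * Num.max (level_radius (sigma x) t) 0.

Lemma level_length_ge0 t x : 0 <= level_length t x.
Proof. by rewrite mulr_ge0// le_max lexx orbT. Qed.

Lemma level_length_le t x : 0 < t -> level_length t x <= t^-1.
Proof. by move=> t0; exact: level_radius_le. Qed.

Lemma level_set_eq t x : 0 < t ->
  [set y | t <= cond_density f sigma y x] =
  [set y | `|y - f x| <= level_radius (sigma x) t].
Proof. by move=> t0; apply/seteqP; split => y /=; rewrite normal_superlevel. Qed.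

Lemma lebesgue_level_set t x : 0 < t ->
  lebesgue_measure [set y | t <= cond_density f sigma y x] = (level_length t x)%:E.
Proof. by move=> t0; rewrite level_set_eq// lebesgue_ball. Qed.

Let ind (t : R) (z : d.-tuple R * R) : R := (t <= cond_density f sigma z.2 z.1)%R%:R.

Let mind (t : R) : measurable_fun setT (ind t).
Proof.
apply: measurable_boolR; apply: measurable_fun_ler => //; exact: measurable_cond_density.
Qed.

Let integral_ind_y (t : R) x : 0 < t ->
  (\int[lebesgue_measure]_y (ind t (x, y))%:E = (level_length t x)%:E)%E.
Proof.
move=> t0; rewrite -lebesgue_level_set//.
have mD : measurable [set y | t <= cond_density f sigma y x].
  apply: measurable_bool_set; apply: measurable_fun_ler => //.
  exact: measurable_normal_pdf.
rewrite -[in RHS](setIT [set y | _]) -integral_indic//.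
by apply: eq_integral => y _; rewrite indicE /ind mem_setE.
Qed.

Lemma measurable_level_length t : 0 < t -> measurable_fun setT (level_length t).
Proof.
move=> t0; apply/measurable_EFinP.
have mh : measurable_fun setT (EFin \o ind t) by exact/measurable_EFinP.
have h0 z : (0 <= (EFin \o ind t) z)%E by rewrite /= lee_fin /ind.
have := measurable_fun_fubini_tonelli_F (m2 := lebesgue_measure) _ mh h0.
congr (measurable_fun _ _); apply/funext => x; rewrite /fubini_F/=.
exact: integral_ind_y.
Qed.

Let integral_ind_w (t y : R) :
  (\int[P]_w (ind t (X w, y))%:E = P [set w | (t <= cond_density f sigma y (X w))%R])%E.
Proof.
have mD : measurable [set w | (t <= cond_density f sigma y (X w))%R].
  apply: measurable_bool_set; apply: measurable_fun_ler => //.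
  by apply: measurable_normal_pdf_comp => //; exact: measurableT_comp.
rewrite -[in RHS](setIT [set w | _]) -integral_indic//.
by apply: eq_integral => w _; rewrite indicE /ind mem_setE.
Qed.

Let mindw (t : R) : measurable_fun setT (fun z : Omega * R => (ind t (X z.1, z.2))%:E).
Proof.
apply/measurable_EFinP; apply: (measurableT_comp (mind t)).
by apply: measurable_fun_pair => //; exact: measurableT_comp.
Qed.

(** By Tonelli, [oracle_G t] is the mean length of the superlevel set, which is
    what the empirical [hat_G] estimates by an average over observations. *)
Lemma oracle_GE t : 0 < t ->
  (oracle_G P X f sigma t = \int[P]_w (level_length t (X w))%:E)%E.
Proof.
move=> t0; rewrite /oracle_G.
under eq_integral do rewrite -integral_ind_w.
under [RHS]eq_integral do rewrite -integral_ind_y//.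
have h0 (z : Omega * R) : (0 <= (ind t (X z.1, z.2))%:E)%E by rewrite lee_fin.
exact: (esym (fubini_tonelli (m1 := P) (m2 := lebesgue_measure) _ (mindw t) h0)).
Qed.

Lemma measurable_tail t :
  measurable_fun setT (fun y => P [set w | (t <= cond_density f sigma y (X w))%R]).
Proof.
have h0 (z : Omega * R) : (0 <= (ind t (X z.1, z.2))%:E)%E by rewrite lee_fin.
have := measurable_fun_fubini_tonelli_G (m1 := P) _ (mindw t) h0.
by congr (measurable_fun _ _); apply/funext => y; exact: integral_ind_w.
Qed.

Definition level_mass (t : R) : R := fine (oracle_G P X f sigma t).

Lemma oracle_G_le t : 0 < t -> (oracle_G P X f sigma t <= (t^-1)%:E)%E.
Proof.
move=> t0; rewrite oracle_GE// -[leRHS](probability_integral_cst P).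
apply: ge0_le_integral_nonmeas => w; rewrite lee_fin ?level_length_ge0//.
exact: level_length_le.
Qed.

Lemma oracle_G_ge0 t : (0 <= oracle_G P X f sigma t)%E.
Proof. exact: integral_ge0. Qed.

Lemma level_massE t : 0 < t -> oracle_G P X f sigma t = (level_mass t)%:E.
Proof.
move=> t0; rewrite /level_mass fineK// ge0_fin_numE ?oracle_G_ge0//.
by rewrite (le_lt_trans (oracle_G_le t0))// ltry.
Qed.

Lemma tail_le t1 t2 y : t1 <= t2 ->
  (P [set w | (t2 <= cond_density f sigma y (X w))%R] <=
   P [set w | (t1 <= cond_density f sigma y (X w))%R])%E.
Proof.
move=> t12; apply: le_measure; rewrite ?inE.
1,2: apply: measurable_bool_set; apply: measurable_fun_ler => //;
  by apply: measurable_normal_pdf_comp => //; exact: measurableT_comp.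
by move=> w /=; exact: le_trans.
Qed.

Lemma level_mass_le t1 t2 : 0 < t1 -> t1 <= t2 -> level_mass t2 <= level_mass t1.
Proof.
move=> t10 t12; have t20 : 0 < t2 by exact: lt_le_trans t12.
rewrite -lee_fin -!level_massE//.
by apply: ge0_le_integral_nonmeas => y; [exact: measure_ge0|exact: tail_le].
Qed.

Lemma level_mass_large t : normal_peak sigma0 < t -> level_mass t = 0.
Proof.
move=> tp; rewrite /level_mass /oracle_G integral0_eq// => y _.
rewrite [X in P X](_ : _ = set0) ?measure0//.
apply/seteqP; split=> // w /=; rewrite leNgt => /negP; apply.
exact: le_lt_trans (cond_density_le _ _) _.
Qed.

(** The witness bounds the density from below at distance [K] from its centre,
    whatever the variance. *)
Lemma level_mass_small K : 0 < K -> exists2 t : R, 0 < t & 2 * K <= level_mass t.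
Proof.
move=> K0.
pose t := (Num.sqrt (sigma1 ^+ 2 * pi *+ 2))^-1 * expR (- (K ^+ 2 / (2 * sigma0 ^+ 2))).
have t0 : 0 < t.
  by rewrite mulr_gt0 ?expR_gt0// invr_gt0 sqrtr_gt0 peak_arg_gt0// exprn_gt0.
exists t => //; rewrite -lee_fin -level_massE// oracle_GE//.
rewrite -[leLHS](probability_integral_cst P).
apply: ge0_le_integral_nonmeas => w; rewrite lee_fin ?mulr_ge0 ?(ltW K0)//.
rewrite ler_pM2l// le_max; apply/orP; left.
have -> : K = `|f (X w) + K - f (X w)| by rewrite addrC addKr gtr0_norm.
rewrite -normal_superlevel//.
have /andP[h1 h2] := sigma_bounds (X w).
apply: (normal_pdf_lower (exprn_gt0 2 sigma0_gt0)) => //.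
  by rewrite !ler_pXn2r ?nnegrE ?(ltW (sigma_gt0 _)) ?(ltW sigma0_gt0) ?(ltW sigma1_gt0)// h1.
by rewrite addrC addKr gtr0_norm.
Qed.

Hypothesis tail_cont : forall y : R, {in `]0, +oo[, continuous
  (fun t : R => fine (distribution P X [set x | t <= cond_density f sigma y x]))}.

(** The continuity of the tail probabilities gives pointwise convergence;
    dominated convergence applies because, on a neighbourhood of [t], the tails
    are below the one at [t / 2], of integral at most [2 / t]. *)
Let level_mass_cvg (t : R) (u : R^nat) : 0 < t -> (forall k, t / 2 <= u k) ->
  u @ \oo --> t -> level_mass (u k) @[k --> \oo] --> level_mass t.
Proof.
move=> t0 ut uc.
have t20 : 0 < t / 2 by lra.
have u0 k : 0 < u k by exact: lt_le_trans (ut k).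
suff /fine_cvgP[] : oracle_G P X f sigma (u k) @[k --> \oo] --> (level_mass t)%:E by [].
rewrite -level_massE//.
pose F v y := P [set w | (v <= cond_density f sigma y (X w))%R].
have finF v y : F v y \is a fin_num.
  apply: fin_num_measure; apply: measurable_bool_set; apply: measurable_fun_ler => //.
  by apply: measurable_normal_pdf_comp => //; exact: measurableT_comp.
apply: (@dominated_cvg _ _ _ lebesgue_measure _ measurableT
  (fun k => F (u k)) (F t) (F (t / 2))).
- by move=> k; exact: measurable_tail.
- move=> y _.
  have ty : t \in `]0, +oo[ by rewrite in_itv/= t0.
  have cu := cvg_comp _ _ uc (tail_cont ty).
  rewrite -(fineK (finF t y)); apply/fine_cvgP; split; last exact: cu.
  by near=> k; exact: finF.
- by move=> y _; exact: finF.
- apply/integrableP; split; first exact: measurable_tail.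
  under eq_integral do rewrite gee0_abs//.
  by rewrite (le_lt_trans (oracle_G_le t20))// ltry.
- move=> k y _; rewrite gee0_abs ?measure_ge0//; exact: tail_le.
Unshelve. all: by end_near. Qed.

Lemma level_mass_modulus (t e : R) : 0 < t -> 0 < e ->
  exists2 dl : R, 0 < dl < t & level_mass (t - dl) <= level_mass (t + dl) + e.
Proof.
move=> t0 e0.
have c1 : t / 2 / k.+1%:R @[k --> \oo] --> (0 : R).
  rewrite -(mulr0 (t / 2)); apply: cvgMr.
  exact: cvg_harmonic.
have le1 k : t / 2 / k.+1%:R <= t / 2.
  by rewrite ler_pdivrMr ?ltr0n// ler_peMr ?ler1n//; lra.
have gt1 k : 0 < t / 2 / k.+1%:R by rewrite divr_gt0 ?divr_gt0// ltr0n.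
have cm : level_mass (t - t / 2 / k.+1%:R) @[k --> \oo] --> level_mass t.
  apply: level_mass_cvg => //; first by move=> k; move: (le1 k); move: (_ / _ / _) => v; lra.
  by rewrite -[X in _ --> X]subr0; apply: cvgB => //; exact: cvg_cst.
have cp : level_mass (t + t / 2 / k.+1%:R) @[k --> \oo] --> level_mass t.
  apply: level_mass_cvg => //; first by move=> k; move: (gt1 k); move: (_ / _ / _) => v; lra.
  by rewrite -[X in _ --> X]addr0; apply: cvgD => //; exact: cvg_cst.
have e20 : 0 < e / 2 by lra.
move/cvgrPdist_le : cm => /(_ _ e20) cm; move/cvgrPdist_le : cp => /(_ _ e20) cp.
near \oo => k.
exists (t / 2 / k.+1%:R); first by rewrite gt1/= (le_lt_trans (le1 k))//; lra.
have : `|level_mass t - level_mass (t - t / 2 / k.+1%:R)| <= e / 2 by near: k.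
have : `|level_mass t - level_mass (t + t / 2 / k.+1%:R)| <= e / 2 by near: k.
rewrite !ler_norml => /andP[? ?] /andP[? ?]; lra.
Unshelve. all: by end_near. Qed.

Variable l : R.
Hypothesis l_gt0 : 0 < l.

Let lam := oracle_level P X f sigma l.
Let A := [set t : R | 0 < t /\ (oracle_G P X f sigma t <= l%:E)%E].

Let A_lb : has_lbound A. Proof. by exists 0 => t [/ltW]. Qed.

Let A_large t : normal_peak sigma0 < t -> A t.
Proof.
have p0 : 0 < normal_peak sigma0 by rewrite normal_peak_gt0 ?gt_eqF.
move=> pt; have t0 : 0 < t by exact: lt_trans pt.
by split => //; rewrite level_massE// level_mass_large// lee_fin ltW.
Qed.

Lemma oracle_level_le : oracle_level P X f sigma l <= normal_peak sigma0.
Proof.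
apply/ler_addgt0Pr => e e0; apply: ge_inf => //.
by apply: A_large; rewrite ltrDl.
Qed.

Lemma level_mass_gt t : 0 < t -> t < oracle_level P X f sigma l -> l < level_mass t.
Proof.
move=> t0; rewrite ltNge => /negP tl; rewrite ltNge; apply/negP => h; apply: tl.
by apply: ge_inf => //; split => //; rewrite level_massE// lee_fin.
Qed.

Let A_inf : has_inf A.
Proof. by split=> //; exists (normal_peak sigma0 + 1); apply: A_large; rewrite ltrDl. Qed.

Lemma level_mass_le_level t : oracle_level P X f sigma l < t -> level_mass t <= l.
Proof.
move=> lt; have d0 : 0 < t - lam by rewrite subr_gt0.
have [v [v0 vl]] := inf_adherent d0 A_inf.
rewrite -/(oracle_level P X f sigma l) -/lam addrC subrK => vt.
by rewrite (le_trans (level_mass_le v0 (ltW vt)))// -lee_fin -level_massE.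
Qed.

Lemma oracle_level_gt0 : 0 < oracle_level P X f sigma l.
Proof.
have [t t0 ht] := level_mass_small l_gt0.
apply: (lt_le_trans t0); rewrite leNgt; apply/negP => /level_mass_le_level h.
by have l0 := l_gt0; lra.
Qed.

(** Flat stretches of [level_mass] are the reason for bracketing: there the
    empirical level need not converge, but the level sets between [t1] and [t2]
    have small mass anyway. *)
Lemma level_bracket (e : R) : 0 < e -> exists t1 t2 dl : R,
  [/\ 0 < dl, dl < t1, t1 <= oracle_level P X f sigma l,
      oracle_level P X f sigma l <= t2 &
  [/\ l < level_mass (t1 + dl), level_mass (t2 - dl) < l &
      level_mass (t1 - dl) <= level_mass (t2 + dl) + e]].
Proof.
move=> e0; have e20 : 0 < e / 2 by lra.
have lam0 := oracle_level_gt0; rewrite -/lam in lam0 *.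
have [d1 /andP[d10 d1l] h1] := level_mass_modulus lam0 e20.
have lamd1 : lam < lam + d1 by lra.
have ha := level_mass_le_level lamd1.
(* [inf B] is the right end of the stretch where [level_mass] equals [l], the
   oracle level being its left end; the two may coincide. *)
pose B := [set t : R | 0 < t /\ level_mass t < l].
have B_lb : has_lbound B by exists 0 => t [/ltW].
have p0 : 0 < normal_peak sigma0 by rewrite normal_peak_gt0 ?gt_eqF.
have B_ne : B !=set0.
  by exists (normal_peak sigma0 + 1); split; [exact: addr_gt0|rewrite level_mass_large// ltrDl].
have B_inf : has_inf B by [].
pose b := inf B.
have lamb : lam <= b.
  apply: lb_le_inf => // t [t0 tl]; apply: ge_inf => //.
  by split=> //; rewrite level_massE// lee_fin ltW.
have b0 : 0 < b by exact: lt_le_trans lamb.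
have [d2 /andP[d20 d2b] h2] := level_mass_modulus b0 e20.
have hb : l <= level_mass (b - d2).
  rewrite leNgt; apply/negP => h; have : b <= b - d2 by apply: ge_inf => //; split => //=; lra.
  lra.
have [v [v0 vl]] := inf_adherent d20 B_inf; rewrite -/b => vb.
have bv : b <= v by apply: ge_inf.
pose dl := Num.min (d1 / 4) ((b + d2 - v) / 2).
have dl1 : dl <= d1 / 4 by rewrite ge_min lexx.
have dl2 : dl <= (b + d2 - v) / 2 by rewrite ge_min lexx orbT.
have dl0 : 0 < dl by rewrite lt_min; apply/andP; split; lra.
exists (lam - d1 / 2), (v + (b + d2 - v) / 2), dl; split; [by []|lra|lra|lra|].
split.
- by apply: level_mass_gt; rewrite -/lam; lra.
- by apply: le_lt_trans vl; apply: level_mass_le => //; lra.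
- have : level_mass (lam - d1 / 2 - dl) <= level_mass (lam - d1).
    by apply: level_mass_le; lra.
  have : level_mass (b + d2) <= level_mass (v + (b + d2 - v) / 2 + dl).
    by apply: level_mass_le; lra.
  lra.
Qed.

End oracle_levels.

(** * Excess risk and symmetric difference *)

Section affine_change_of_variable.
Context {R : realType}.
Variables (m a : R).
Hypothesis a_gt0 : 0 < a.

Let aff (e : R) : measurableTypeR R := m + a * e.

Let measurable_aff : measurable_fun setT (aff : measurableTypeR R -> measurableTypeR R).
Proof. by apply: measurable_funD => //; exact: measurable_funM. Qed.

Lemma ge0_integral_affine (g : R -> \bar R) :
  measurable_fun setT g -> (forall y, (0 <= g y)%E) ->
  (\int[lebesgue_measure]_y g y = a%:E * \int[lebesgue_measure]_e g (m + a * e)%R)%E.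
Proof.
move=> mg g0; pose r : {nonneg R} := NngNum (ltW a_gt0).
pose mu := mscale r lebesgue_measure.
transitivity (\int[pushforward mu aff]_y g y)%E.
  apply: eq_measure_integral => //= A mA _.
  apply: (@lebesgue_measure_unique _ (pushforward mu aff)) => // _ [[c e] _ <-].
  change (lebesgue_measure `]c, e]%classic =
    (a%:E * lebesgue_measure (aff @^-1` `]c, e]%classic))%E).
  have -> : aff @^-1` `]c, e]%classic = `](c - m) / a, (e - m) / a]%classic.
    apply/seteqP; split => y /=; rewrite !in_itv/= /aff ltr_pdivrMr// ler_pdivlMr// => /andP[? ?];
      apply/andP; split; lra.
  rewrite !lebesgue_measure_itv/= !lte_fin ltr_pM2r ?invr_gt0// ltrD2r.
  case: ifP => _; last by rewrite mule0.
  by rewrite -!EFinB -EFinM; congr EFin; field; rewrite gt_eqF.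
rewrite ge0_integral_pushforward// preimage_setT ge0_integral_mscale//.
  exact: (measurable_comp measurableT).
by move=> e _; exact: g0.
Qed.

Lemma normal_pdf_affine e : a * normal_pdf m a (m + a * e) = normal_pdf 0 1 e.
Proof.
rewrite !normal_pdf_gauss_exp// /normal_peak /gauss_exp addrC addKr subr0 expr1n mul1r mulr1.
rewrite mulrA -mulrnAr sqrtrM ?sqr_ge0// sqrtr_sqr gtr0_norm//.
have -> : (a * e) ^+ 2 / (2 * a ^+ 2) = e ^+ 2 / 2 by field; rewrite gt_eqF.
congr (_ * _).
by rewrite invfM mulrA divff ?mul1r// gt_eqF.
Qed.

End affine_change_of_variable.

Lemma indic_comp {R : realType} {T U : Type} (K : set U) (g : T -> U) w :
  \1_[set v | K (g v)] w = \1_K (g w) :> R.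
Proof.
by rewrite !indicE (_ : (w \in [set v | K (g v)]) = (g w \in K)).
Qed.

Section excess_risk_bound.
Context {disp : measure_display} {Omega : measurableType disp} {R : realType}.
Variables (P : probability Omega R) (d : nat) (X : {mfun Omega >-> d.-tuple R}).
Variables (Y eps zeta : {mfun Omega >-> R}).
Variables (f sigma : d.-tuple R -> R) (sigma0 sigma1 : R).
Hypothesis f_meas : measurable_fun setT f.
Hypothesis sigma_meas : measurable_fun setT sigma.
Hypothesis sigma0_gt0 : 0 < sigma0.
Hypothesis sigma_bounds : forall x, sigma0 <= sigma x <= sigma1.
Hypothesis eps_normal : has_law P eps (normal_prob 0 1).
Hypothesis eps_indep : indep_pair P X eps.
Hypothesis Y_model : forall w, Y w = f (X w) + sigma (X w) * eps w.
Hypothesis zeta_indep : indep_pair P zeta (fun w => (X w, Y w)).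

Let sigma_gt0 x : 0 < sigma x.
Proof. by have /andP[h _] := sigma_bounds x; exact: lt_le_trans h. Qed.

Let T := ((d.-tuple R * R) * R)%type.

Let dens (q : T) : R := cond_density f sigma q.2 q.1.1.

Let mdens : measurable_fun setT dens.
Proof.
apply: measurable_normal_pdf_comp => //=.
- by apply: measurableT_comp => //; apply: measurableT_comp.
- by apply: measurableT_comp => //; apply: measurableT_comp.
Qed.

Let zeta_indep_X : indep_pair P zeta X.
Proof.
move=> A B mA mB; have := zeta_indep mA (measurableX mB (@measurableT _ R)).
have -> // : (fun w => (X w, Y w)) @^-1` (B `*` setT) = X @^-1` B.
by apply/seteqP; split => w //= [].
Qed.

Let mXY : measurable_fun setT (fun w => (X w, Y w)).
Proof. exact: measurable_fun_pair. Qed.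

Let XY : {mfun Omega >-> (d.-tuple R * R)%type} :=
  HB.pack (fun w => (X w, Y w)) (isMeasurableFun.Build _ _ _ _ _ mXY).

(** Given [X] and the independent [zeta], the response [Y] has density
    [cond_density]: the Gaussian noise is integrated first. *)
Let prob_density (K : set T) : measurable K ->
  (P [set w | K ((X w, zeta w), Y w)] =
   \int[P]_w \int[lebesgue_measure]_y (\1_K ((X w, zeta w), y) * dens ((X w, zeta w), y))%:E)%E.
Proof.
move=> mK.
have mi : measurable_fun setT (fun q : T => (\1_K q)%:E : \bar R).
  exact/measurable_EFinP/measurable_indic.
have mE : measurable [set w | K ((X w, zeta w), Y w)].
  rewrite -[X in measurable X]setTI.
  have := measurable_fun_pair (measurable_fun_pair (measurable_funPT X) (measurable_funPT zeta)) (measurable_funPT Y).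
  exact.
rewrite -(setIT [set w | _]) -integral_indic//.
pose h (q : R * (d.-tuple R * R)) : \bar R := (\1_K ((q.2.1, q.1), q.2.2))%:E.
have mh : measurable_fun setT h.
  apply: (measurableT_comp mi); apply: measurable_fun_pair.
    by apply: measurable_fun_pair => //; apply: measurableT_comp.
  by apply: measurableT_comp.
transitivity (\int[P]_w h (zeta w, XY w))%E.
  by apply: eq_integral => w _; rewrite /h /= (indic_comp K (fun v => ((X v, zeta v), Y v))).
rewrite (indep_integral (U := zeta) (V := XY) zeta_indep mh); last by move=> q; rewrite lee_fin.
pose q (z : R) (x : d.-tuple R) : \bar R :=
  (\int[lebesgue_measure]_y (\1_K ((x, z), y) * dens ((x, z), y))%:E)%E.
have mkd : measurable_fun setT (fun p : T => (\1_K p * dens p)%:E : \bar R).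
  by apply/measurable_EFinP; exact: measurable_funM.
have kd0 (p : T) : (0 <= (\1_K p * dens p)%:E)%E.
  by rewrite lee_fin mulr_ge0// normal_pdf_ge0.
have mq : measurable_fun setT (fun p : R * d.-tuple R => q p.1 p.2).
  pose g (p : (R * d.-tuple R) * R) : \bar R :=
    (\1_K ((p.1.2, p.1.1), p.2) * dens ((p.1.2, p.1.1), p.2))%:E.
  apply: (measurable_fun_fubini_tonelli_F (m2 := lebesgue_measure) g) => [|p].
    apply: (measurableT_comp mkd); apply: measurable_fun_pair => //.
    by apply: measurable_fun_pair; apply: measurableT_comp => //; apply: measurableT_comp.
  exact: kd0.
have q0 p : (0 <= q p.1 p.2)%E by apply: integral_ge0 => y _; exact: kd0.
transitivity (\int[P]_w \int[P]_w' q (zeta w) (X w'))%E; last first.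
  by rewrite -(indep_integral (h := fun p => q p.1 p.2) zeta_indep_X mq q0).
apply: eq_integral => w _; set z := zeta w.
pose k (p : d.-tuple R * R) : \bar R := (\1_K ((p.1, z), f p.1 + sigma p.1 * p.2))%:E.
have mk : measurable_fun setT k.
  apply: (measurableT_comp mi); apply: measurable_fun_pair.
    by apply: measurable_fun_pair.
  apply: measurable_funD; first exact: measurableT_comp.
  by apply: measurable_funM => //; exact: measurableT_comp.
transitivity (\int[P]_w' k (X w', eps w'))%E.
  by apply: eq_integral => w' _; rewrite /h /k /= Y_model.
rewrite (indep_integral eps_indep mk); last by move=> p; rewrite lee_fin.
apply: eq_integral => w' _; set x := X w'.
rewrite /q (ge0_integral_affine (f x) (sigma_gt0 x)); last 2 first.
- exact: (measurableT_comp mkd).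
- by move=> y; exact: kd0.
have m1 : measurable_fun setT (fun e : R => ((x, z), f x + sigma x * e)).
  by apply: measurable_fun_pair => //; apply: measurable_funD => //; exact: measurable_funM.
pose D := [set e | K ((x, z), f x + sigma x * e)].
have mD : measurable D.
  by rewrite -[X in measurable X]setTI; exact: m1.
transitivity (P (eps @^-1` D)).
  have mE' : measurable (eps @^-1` D).
    by rewrite -[X in measurable X]setTI; exact: measurable_funPT.
  by rewrite -(setIT (eps @^-1` D)) -integral_indic.
rewrite eps_normal// /normal_prob integral_mkcond.
rewrite -ge0_integralZl//; last 2 first.
- exact: (measurableT_comp mkd m1).
- by rewrite lee_fin ltW.
apply: eq_integral => e _; rewrite patchE -EFinM /dens/= /cond_density.
rewrite mulrCA normal_pdf_affine// indicE.
have -> : (((x, z), f x + sigma x * e) \in K) = (e \in D).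
  by apply/idP/idP; rewrite !inE.
by case: ifP; rewrite ?mul1r ?mul0r.
Qed.

Let sample (p : Omega * R) : T := ((X p.1, zeta p.1), p.2).

Let msample : measurable_fun setT sample.
Proof.
apply: measurable_fun_pair => //.
by apply: measurable_fun_pair; apply: measurableT_comp.
Qed.

Let I (h : T -> R) : \bar R := (\int[P \x lebesgue_measure]_p (h (sample p))%:E)%E.

Let mI (h : T -> R) : measurable_fun setT h ->
  measurable_fun setT (fun p => (h (sample p))%:E).
Proof. by move=> mh; apply/measurable_EFinP; exact: measurableT_comp. Qed.

Let iterated_integral (h : T -> R) : measurable_fun setT h -> (forall q, 0 <= h q) ->
  (\int[P]_w \int[lebesgue_measure]_y (h ((X w, zeta w), y))%:E = I h)%E.
Proof.
move=> mh h0.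
have hs0 p : (0 <= (h (sample p))%:E)%E by rewrite lee_fin.
exact: (esym (fubini_tonelli1 (m1 := P) (m2 := lebesgue_measure) _ (mI mh) hs0)).
Qed.

Let integral_slice (K : set T) : measurable K ->
  (\int[P]_w lebesgue_measure [set y | K ((X w, zeta w), y)] = I (\1_K))%E.
Proof.
move=> mK; rewrite -iterated_integral//.
apply: eq_integral => w _.
have mKw : measurable [set y | K ((X w, zeta w), y)].
  rewrite -[X in measurable X]setTI.
  exact: (measurable_fun_pair (measurable_cst ((X w, zeta w) : d.-tuple R * R)) (@measurable_id _ R setT)).
by rewrite -(setIT [set y | _]) -integral_indic.
Qed.

Variable l : R.
Let lam := oracle_level P X f sigma l.
Hypothesis lam_gt0 : 0 < lam.
Hypothesis lam_le : lam <= normal_peak sigma0.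

Let riskE (K : set T) : measurable K ->
  risk P X Y zeta f sigma l (fun x z => [set y | K ((x, z), y)]) =
  (I (fun q => \1_(~` K) q * dens q)%R + lam%:E * I (\1_K))%E.
Proof.
move=> mK; rewrite /risk -/lam integral_slice//; congr (_ + _)%E.
have mKC : measurable (~` K) by exact: measurableC.
rewrite (prob_density mKC) -iterated_integral//; first exact: measurable_funM.
by move=> q; rewrite mulr_ge0// normal_pdf_ge0.
Qed.

Let Kstar : set T := [set q | lam <= dens q].

Let mKstar : measurable Kstar.
Proof. by apply: measurable_bool_set; apply: measurable_fun_ler. Qed.

(** With [p] the density and [c] a common upper bound of [p] and [lam], the
    pointwise losses satisfy
    [p 1_(~` K) + lam 1_K <= p 1_(~` L) + lam 1_L + c 1_(K `+` L)] where
    [L := [set q | lam <= p q]]; integrating gives the bound. *)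
Lemma excess_risk_le (Gam : d.-tuple R -> R -> set R) :
  measurable [set q : T | Gam q.1.1 q.1.2 q.2] ->
  (excess_risk P X Y zeta f sigma l Gam <=
   (normal_peak sigma0)%:E * sym_diff_loss P X zeta f sigma l Gam)%E.
Proof.
set K := [set q | _] => mK.
have p0 : 0 < normal_peak sigma0 by rewrite normal_peak_gt0 ?gt_eqF.
have dens0 q : 0 <= dens q by exact: normal_pdf_ge0.
have mY : measurable (K `+` Kstar) by apply: measurableU; apply: measurableD.
have -> : sym_diff_loss P X zeta f sigma l Gam = I (\1_(K `+` Kstar)).
  by rewrite -integral_slice.
have -> : excess_risk P X Y zeta f sigma l Gam =
    (risk P X Y zeta f sigma l (fun x z => [set y | K ((x, z), y)]) -
     risk P X Y zeta f sigma l (fun x z => [set y | Kstar ((x, z), y)]))%E by [].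
rewrite !riskE//.
pose loss (L : set T) (q : T) := \1_(~` L) q * dens q + lam * \1_L q.
have lossI L : measurable L ->
    (I (fun q => \1_(~` L) q * dens q)%R + lam%:E * I (\1_L) = I (loss L))%E.
  move=> mL; have mLC : measurable (~` L) by exact: measurableC.
  have m1 : measurable_fun setT (fun q => \1_(~` L) q * dens q) by exact: measurable_funM.
  have m2 : measurable_fun setT (fun q => lam * \1_L q : R) by exact: measurable_funM.
  have -> : (lam%:E * I (\1_L) = I (fun q => lam * \1_L q)%R)%E.
    rewrite /I -ge0_integralZl//; first exact: mI.
    by rewrite lee_fin ltW.
  rewrite /I -ge0_integralD//.
  - by move=> p _; rewrite lee_fin mulr_ge0.
  - exact: (mI m1).
  - by move=> p _; rewrite lee_fin mulr_ge0// ltW.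
  - exact: (mI m2).
have mloss L : measurable L -> measurable_fun setT (loss L).
  move=> mL; have mLC : measurable (~` L) by exact: measurableC.
  by apply: measurable_funD; exact: measurable_funM.
have loss0 L q : 0 <= loss L q by rewrite addr_ge0 ?mulr_ge0 ?(ltW lam_gt0).
rewrite !lossI//.
have fin : I (loss Kstar) \is a fin_num.
  rewrite ge0_fin_numE; last by apply: integral_ge0 => p _; rewrite lee_fin.
  rewrite -lossI// lte_add_pinfty//.
    rewrite /I; apply: (@le_lt_trans _ _ (I dens)).
      apply: ge0_le_integral_nonmeas => p; rewrite lee_fin ?mulr_ge0//.
      by rewrite ler_piMl// indicE lern1; case: (_ \in _).
    rewrite -iterated_integral//.
    under eq_integral do rewrite /dens/= integral_normal_pdf.
    by rewrite probability_integral_cst ltry.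
  apply: lte_mul_pinfty; rewrite ?lee_fin ?(ltW lam_gt0)//.
  rewrite -integral_slice//.
  apply: (@le_lt_trans _ _ (\int[P]_w (lam^-1)%:E)%E); last first.
    by rewrite probability_integral_cst ltry.
  apply: ge0_le_integral_nonmeas => w; first exact: measure_ge0.
  by rewrite /Kstar/= (lebesgue_level_set _ sigma0_gt0 sigma_bounds)// lee_fin;
    exact: level_length_le sigma0_gt0 sigma_bounds _ _ _.
rewrite leeBlDr//.
have mc : measurable_fun setT (fun q => normal_peak sigma0 * \1_(K `+` Kstar) q).
  by apply: measurable_funM => //; exact: measurable_indic.
have -> : ((normal_peak sigma0)%:E * I (\1_(K `+` Kstar)) =
    I (fun q => normal_peak sigma0 * \1_(K `+` Kstar) q)%R)%E.
  rewrite /I -ge0_integralZl//; first by apply: mI; exact: measurable_indic.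
  by rewrite lee_fin ltW.
rewrite /I -ge0_integralD//; last 4 first.
- by move=> p _; rewrite lee_fin mulr_ge0// ltW.
- exact: (mI mc).
- by move=> p _; rewrite lee_fin.
- exact: (mI (mloss _ mKstar)).
apply: ge0_le_integral_nonmeas => p; first by rewrite lee_fin.
rewrite -EFinD lee_fin /loss; set q := sample p.
have dc : dens q <= normal_peak sigma0 by exact: cond_density_le.
have d0 := dens0 q.
have KsE : (q \in Kstar) = (lam <= dens q) by apply/idP/idP; rewrite inE.
rewrite !indicE /setY in_setU !in_setD !in_setC KsE.
have c0 := ltW p0; have l0 := lam_gt0; have lc := lam_le.
have e1 : true%:R = 1 :> R by []. have e0 : false%:R = 0 :> R by [].
by case: (q \in K); case: (leP lam (dens q)) => h /=; rewrite ?e1 ?e0; lra.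
Qed.

End excess_risk_bound.

(** * The empirical level *)

Lemma truncate_var_gt0 {R : realType} (s v : R) : 0 < s -> 0 <= v -> 0 < truncate_var s v.
Proof.
move=> s0 v0; have si : 0 < s^-1 by rewrite invr_gt0.
have e1 : true%:R = 1 :> R by []. have e0 : false%:R = 0 :> R by [].
rewrite /truncate_var; case: (leP s^-1 v) => h1; case: (leP v s) => h2 /=;
  rewrite ?e1 ?e0; lra.
Qed.

Lemma finite_positive_lower_bound {R : realType} {I : finType} (g : I -> R) :
  (forall i, 0 < g i) -> exists2 t : R, 0 < t & forall i, t < g i.
Proof.
move=> g0; have gi i : 0 < (g i)^-1 by rewrite invr_gt0.
have S0 : 0 <= \sum_i (g i)^-1 by apply: sumr_ge0 => i _; exact: ltW.
exists (\sum_i (g i)^-1 + 1)^-1 => [|i]; first by rewrite invr_gt0; lra.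
rewrite invf_plt ?posrE//; last by lra.
rewrite (bigD1 i)//= -addrA ltrDl.
have : 0 <= \sum_(j | j != i) (g j)^-1 by apply: sumr_ge0 => j _; exact: ltW.
lra.
Qed.

Section empirical_level.
Context {R : realType} {d : nat}.
Variables (s : R) (fh tv : d.-tuple R -> R) (M N : nat).
Hypothesis s_gt0 : 0 < s.
Hypothesis tv_ge0 : forall x, 0 <= tv x.
Hypothesis M_gt0 : (0 < M)%N.
Hypothesis N_gt0 : (0 < N)%N.
Implicit Types (x : d.-tuple R) (y z t : R).

Definition hat_sd x : R := Num.sqrt (hat_var s tv x).

(** The fitted density before its restriction to [-s, s]. *)
Definition hat_normal y x : R := normal_pdf (fh x) (hat_sd x) y.

Lemma hat_var_gt0 x : 0 < hat_var s tv x. Proof. exact: truncate_var_gt0. Qed.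

Lemma hat_sd_gt0 x : 0 < hat_sd x. Proof. by rewrite sqrtr_gt0 hat_var_gt0. Qed.

Lemma hat_sd_sqr x : hat_sd x ^+ 2 = hat_var s tv x.
Proof. by rewrite sqr_sqrtr// ltW// hat_var_gt0. Qed.

Lemma hat_normal_gt0 y x : 0 < hat_normal y x.
Proof.
rewrite /hat_normal normal_pdf_gauss_exp ?hat_sd_gt0// mulr_gt0 ?gauss_exp_gt0//.
by rewrite normal_peak_gt0// gt_eqF// hat_sd_gt0.
Qed.

Let true1 : true%:R = 1 :> R. Proof. by []. Qed.
Let false0 : false%:R = 0 :> R. Proof. by []. Qed.

Lemma hat_density_pert_in y x z : `|y| <= s ->
  hat_density_pert s fh tv y x z = hat_normal y x + z.
Proof. by move=> ys; rewrite /hat_density_pert /hat_density ys true1 !mulr1. Qed.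

Lemma hat_density_pert_out y x z : s < `|y| -> hat_density_pert s fh tv y x z = 0.
Proof.
by rewrite ltNge => /negbTE ys; rewrite /hat_density_pert /hat_density ys false0 !mulr0 addr0.
Qed.

Lemma hat_density_pert_gt0 y x z t : 0 < t -> t <= hat_density_pert s fh tv y x z ->
  `|y| <= s /\ t <= hat_normal y x + z.
Proof.
move=> t0; case: (leP `|y| s) => ys; first by rewrite hat_density_pert_in.
by rewrite hat_density_pert_out// leNgt t0.
Qed.

(** The length of the level set of one observation, measured on the grid. *)
Definition grid_length t x z : R :=
  2 * s / M%:R * \sum_(k < M) (t < hat_density_pert s fh tv (grid_point s M k) x z)%R%:R.

Let step_gt0 : 0 < 2 * s / M%:R.
Proof. by rewrite divr_gt0 ?mulr_gt0// ltr0n. Qed.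

Lemma grid_length_ge0 t x z : 0 <= grid_length t x z.
Proof. by rewrite mulr_ge0 ?(ltW step_gt0)// sumr_ge0. Qed.

Lemma hat_GE xs zs t : hat_G s fh tv M (N := N) xs zs t =
  N%:R^-1 * \sum_(i < N) grid_length t (xs i) (zs i).
Proof.
rewrite /hat_G /grid_length exchange_big/= -mulr_sumr invfM !mulrA; congr (_ * _).
by rewrite mulrC !mulrA.
Qed.

Lemma hat_G_anti xs zs t1 t2 : t1 <= t2 ->
  hat_G s fh tv M (N := N) xs zs t2 <= hat_G s fh tv M (N := N) xs zs t1.
Proof.
move=> t12; rewrite !hat_GE ler_wpM2l ?invr_ge0//; apply: ler_sum => i _.
rewrite ler_wpM2l ?(ltW step_gt0)//; apply: ler_sum => k _.
by rewrite ler_nat; case: (boolP (t2 < _)) => // /(le_lt_trans t12) ->.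
Qed.

Variable l : R.
Hypothesis l_gt0 : 0 < l.

Lemma hat_level_le xs zs t : 0 <= t -> hat_G s fh tv M (N := N) xs zs t <= l ->
  hat_level s fh tv M xs zs l <= t.
Proof. by move=> t0 Gt; apply: ge_inf; [exists 0 => v []|]. Qed.

Lemma hat_level_ge xs zs t : l < hat_G s fh tv M (N := N) xs zs t ->
  t <= hat_level s fh tv M xs zs l.
Proof.
move=> Gt; apply: lb_le_inf; last first.
  move=> v [v0 Gv]; rewrite leNgt; apply/negP => /ltW /(hat_G_anti xs zs) h.
  by move: (lt_le_trans Gt h); rewrite ltNge Gv.
(* [t0] bounds all the perturbed densities, so the set whose infimum is the
   level is not empty. *)
pose t0 := \sum_(i < N) (normal_peak (hat_sd (xs i)) + `|zs i|).
have pk i : 0 <= normal_peak (hat_sd (xs i)) + `|zs i| by rewrite addr_ge0 ?normal_peak_ge0.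
have t00 : 0 <= t0 by exact: sumr_ge0.
exists t0; split => //; rewrite hat_GE big1 ?mulr0 ?(ltW l_gt0)// => i _.
rewrite /grid_length big1 ?mulr0// => k _.
suff -> : (t0 < hat_density_pert s fh tv (grid_point s M k) (xs i) (zs i)) = false by [].
apply/negbTE; rewrite -leNgt.
case: (leP `|grid_point s M k| s) => ys; last by rewrite hat_density_pert_out.
rewrite hat_density_pert_in//.
apply: (@le_trans _ _ (normal_peak (hat_sd (xs i)) + `|zs i|)).
  by rewrite lerD ?ler_norm// normal_pdf_ub// gt_eqF ?hat_sd_gt0.
by rewrite /t0 (bigD1 i)//= lerDl sumr_ge0.
Qed.

(** All the perturbed densities are positive at all the grid points, so that
    [hat_G] takes its maximal value [2 * s > l] on a neighbourhood of [0]. *)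
Lemma hat_level_gt0 xs zs : l < 2 * s -> (forall i, 0 <= zs i) ->
  0 < hat_level s fh tv M (N := N) xs zs l.
Proof.
move=> ls zs0.
pose g (p : 'I_M * 'I_N) := hat_density_pert s fh tv (grid_point s M p.1) (xs p.2) (zs p.2).
have g0 p : 0 < g p.
  rewrite /g hat_density_pert_in ?grid_point_itv//.
  by rewrite ltr_pwDl// hat_normal_gt0.
have [t t0 tg] := finite_positive_lower_bound g0.
apply: (lt_le_trans t0); apply: hat_level_ge; rewrite hat_GE.
rewrite (eq_bigr (fun=> 2 * s)) => [|i _].
  rewrite sumr_const card_ord -(mulr_natl (2 * s)) mulKf//.
  by rewrite pnatr_eq0 -lt0n.
rewrite /grid_length (eq_bigr (fun=> 1)) => [|k _]; last by rewrite (tg (k, i)).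
by rewrite sumr_const card_ord divfK// pnatr_eq0 -lt0n.
Qed.

End empirical_level.

(** * Loss and grid length at one observation *)

Lemma measurable_setY {d : measure_display} {T : measurableType d} (A B : set T) :
  measurable A -> measurable B -> measurable (A `+` B).
Proof. by move=> mA mB; apply: measurableU; exact: measurableD. Qed.

Section one_observation.
Context {R : realType} {d : nat}.
Variables (s : R) (fh tv : d.-tuple R -> R) (M : nat).
Hypothesis s_gt0 : 0 < s.
Hypothesis tv_ge0 : forall x, 0 <= tv x.
Hypothesis M_gt0 : (0 < M)%N.
Variables (f sigma : d.-tuple R -> R).
Hypothesis sigma_gt0 : forall x, 0 < sigma x.
Variables (x : d.-tuple R) (z : R).
Hypothesis z_ge0 : 0 <= z.

Local Notation p y := (cond_density f sigma y x).
Local Notation ph y := (hat_normal s fh tv y x).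
Local Notation pert y := (hat_density_pert s fh tv y x z).

Let sd_gt0 : 0 < hat_sd s tv x. Proof. exact: hat_sd_gt0. Qed.

Let superlevel_radius t : 0 < t ->
  (forall y, (t <= p y) = (`|y - f x| <= level_radius (sigma x) t)) /\
  level_radius (sigma x) t <= t^-1.
Proof.
move=> t0; split; first by move=> y; exact: normal_superlevel.
have := level_radius_le (sigma_gt0 x) t0.
have : level_radius (sigma x) t <= Num.max (level_radius (sigma x) t) 0 by rewrite le_max lexx.
have : 0 <= Num.max (level_radius (sigma x) t) 0 by rewrite le_max lexx orbT.
lra.
Qed.

Let mball m r : measurable [set y : R | `|y - m| <= r].
Proof.
apply: measurable_bool_set; apply: measurable_fun_ler => //.
by apply: measurableT_comp => //; exact: measurable_funB.
Qed.

Let mp t : measurable [set y : R | t <= p y].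
Proof.
by apply: measurable_bool_set; apply: measurable_fun_ler => //; exact: measurable_normal_pdf.
Qed.

Let mph t : measurable [set y : R | t <= ph y].
Proof.
by apply: measurable_bool_set; apply: measurable_fun_ler => //; exact: measurable_normal_pdf.
Qed.

Let mpert t : measurable [set y : R | t <= pert y].
Proof.
apply: measurable_bool_set; apply: measurable_fun_ler => //.
have mi : measurable_fun setT (fun y : R => (`|y| <= s)%R%:R : R).
  by apply: measurable_boolR; apply: measurable_fun_ler.
apply: measurable_funD; last exact: measurable_funM.
by apply: measurable_funM => //; exact: measurable_normal_pdf.
Qed.

Variables (lam v : R).
Hypothesis lam_gt0 : 0 < lam.

Local Notation loss :=
  (lebesgue_measure ([set y | v <= pert y] `+` [set y | lam <= p y])).

(** The oracle set has length at most [lam^-1], so only the fitted set remains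
    to be covered. *)
Let loss_le_add (C : set R) : measurable C -> [set y | v <= pert y] `<=` C ->
  (loss <= lebesgue_measure C + (lam^-1)%:E)%E.
Proof.
move=> mC AC.
apply: (@le_trans _ _ (lebesgue_measure (C `|` [set y | lam <= p y]))).
  apply: le_measure; rewrite ?inE.
  - exact: measurable_setY (mpert v) (mp lam).
  - exact: measurableU mC (mp lam).
  - by move=> y [[/AC ? _]|[? _]]; [left|right].
apply: (@le_trans _ _ (lebesgue_measure C + lebesgue_measure [set y | (lam <= p y)%R])%E).
  by apply: measureU2; [exact: mC|exact: mp].
rewrite leeD2l//.
have -> : [set y | lam <= p y] = [set y | `|y - f x| <= level_radius (sigma x) lam].
  by apply/seteqP; split => y /=; rewrite normal_superlevel.
by rewrite lebesgue_ball lee_fin level_radius_le.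
Qed.

(** The fitted density vanishes outside [-s, s]. *)
Lemma loss_le_support : 0 < v -> (loss <= (2 * s + lam^-1)%:E)%E.
Proof.
move=> v0; apply: (le_trans (loss_le_add (mball 0 s) _)) => [y /=|].
  by move=> /(hat_density_pert_gt0 v0)[]; rewrite subr0.
by rewrite lebesgue_ball -EFinD lee_fin max_l// ltW.
Qed.

Lemma loss_le_level c : 0 < c -> c <= v -> z <= c / 2 ->
  (loss <= (2 / c + lam^-1)%:E)%E.
Proof.
move=> c0 cv zc; have c20 : 0 < c / 2 by lra.
apply: (le_trans (loss_le_add (mph (c / 2)) _)) => [y /=|].
  by move=> /(hat_density_pert_gt0 (lt_le_trans c0 cv))[_]; lra.
have -> : [set y | c / 2 <= ph y] = [set y | `|y - fh x| <= level_radius (hat_sd s tv x) (c / 2)].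
  by apply/seteqP; split => y /=; rewrite normal_superlevel.
rewrite lebesgue_ball -EFinD lee_fin lerD2r.
by have := level_radius_le sd_gt0 c20; rewrite invf_div.
Qed.

(** Points where the two sets differ have a density between [t1 - dl] and
    [t2 + dl]; outside [-s, s] the true density is already below [t1 - dl]. *)
Lemma loss_le_bracket t1 t2 dl : 0 < dl -> dl < t1 -> t1 <= v <= t2 ->
  t1 <= lam <= t2 -> z <= dl / 2 ->
  (forall y, `|ph y - p y| <= dl / 2) -> `|f x| + (t1 - dl)^-1 <= s ->
  (loss <= (level_length sigma (t1 - dl) x - level_length sigma (t2 + dl) x)%:E)%E.
Proof.
move=> dl0 dlt1 /andP[t1v vt2] /andP[t1l lt2] zdl close fs.
have t1d0 : 0 < t1 - dl by lra.
have t2d0 : 0 < t2 + dl by lra.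
have t10 : 0 < t1 by lra.
have [E1 r1] := superlevel_radius t1d0.
have [E2 _] := superlevel_radius t2d0.
have leb t : 0 < t -> lebesgue_measure [set y | t <= p y] = (level_length sigma t x)%:E.
  move=> t0; have [E _] := superlevel_radius t0.
  have -> : [set y | t <= p y] = [set y | `|y - f x| <= level_radius (sigma x) t].
    by apply/seteqP; split => y /=; rewrite E.
  exact: lebesgue_ball.
apply: (@le_trans _ _ (lebesgue_measure ([set y | t1 - dl <= p y] `\` [set y | t2 + dl <= p y]))).
  apply: le_measure; rewrite ?inE.
  - exact: measurable_setY (mpert v) (mp lam).
  - exact: measurableD (mp _) (mp _).
  have cl y : ph y - dl / 2 <= p y <= ph y + dl / 2.
    by have := close y; rewrite ler_norml => /andP[? ?]; apply/andP; split; lra.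
  move=> y /= [[vy /negP]|[ly /negP]]; rewrite -ltNge => h.
    have [_ h1] := hat_density_pert_gt0 (lt_le_trans t10 t1v) vy.
    have /andP[h2 h3] := cl y.
    by split; [lra|apply/negP; rewrite -ltNge; lra].
  have ty : t1 - dl <= p y by lra.
  have ys : `|y| <= s.
    have := ty; rewrite E1 => yf.
    have -> : y = (y - f x) + f x by ring.
    by rewrite (le_trans (ler_normD _ _))//; lra.
  move: h; rewrite hat_density_pert_in// => h.
  have /andP[h2 h3] := cl y.
  by split => //; apply/negP; rewrite -ltNge; have z0 := z_ge0; lra.
rewrite measureD; [|exact: mp|exact: mp|exact: (eq_ind_r (fun u => u < +oo)%E (ltry _) (leb _ t1d0))].
have -> : [set y | t1 - dl <= p y] `&` [set y | t2 + dl <= p y] = [set y | t2 + dl <= p y].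
  by apply/setIidr => y /=; lra.
by rewrite EFinB -(leb _ t1d0) -(leb _ t2d0).
Qed.

Local Notation W := (fun t => grid_length s fh tv M t x z).
Local Notation h := (2 * s / M%:R).

Let h_gt0 : 0 < h.
Proof. by rewrite divr_gt0 ?mulr_gt0// ltr0n. Qed.

(** An estimated density centred well inside [-s, s], of moderate variance, is
    at least [t] on a whole ball of radius [K]. *)
Lemma grid_length_ge_moderate v0 v1 K t : 0 < v0 -> 0 < K ->
  v0 <= hat_var s tv x <= v1 -> `|fh x| + K <= s ->
  t < (Num.sqrt (v1 * pi *+ 2))^-1 * expR (- (K ^+ 2 / (2 * v0))) ->
  2 * K - h <= W t.
Proof.
move=> v00 K0 hv fK tK.
have := ler_norm (fh x); have := ler_norm (- fh x); rewrite normrN => n1 n2.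
apply: (@grid_count_ge _ s M (fh x) K (fun k => t < pert (grid_point s M k))) => //; [lra|lra|].
move=> k hk.
have ks : `|grid_point s M k| <= s.
  have -> : grid_point s M k = (grid_point s M k - fh x) + fh x by ring.
  by rewrite (le_trans (ler_normD _ _))//; lra.
rewrite hat_density_pert_in//; apply: (lt_le_trans tK).
rewrite -[leLHS]addr0 lerD//; apply: normal_pdf_lower => //.
by rewrite hat_sd_sqr.
Qed.

(** The interval where the true density is at least [t + dl] lies in [-s, s], and
    there the fitted density is above [t]. *)
Lemma grid_length_ge_close t dl : 0 < t -> 0 < dl ->
  (forall y, `|ph y - p y| <= dl / 2) -> `|f x| + (t + dl)^-1 <= s ->
  level_length sigma (t + dl) x - h <= W t.
Proof.
move=> t0 dl0 close fs; have td0 : 0 < t + dl by lra.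
have [E r1] := superlevel_radius td0.
rewrite /level_length; case: (leP (level_radius (sigma x) (t + dl)) 0) => r0.
  by have := grid_length_ge0 fh tv s_gt0 M_gt0 t x z; have := h_gt0; lra.
have := ler_norm (f x); have := ler_norm (- f x); rewrite normrN => n1 n2.
apply: (@grid_count_ge _ s M (f x) _ (fun k => t < pert (grid_point s M k))) => //; [lra|lra|].
move=> k hk.
have ks : `|grid_point s M k| <= s.
  have -> : grid_point s M k = (grid_point s M k - f x) + f x by ring.
  by rewrite (le_trans (ler_normD _ _))//; lra.
rewrite hat_density_pert_in//; move: hk; rewrite -E => hk.
by have := close (grid_point s M k); rewrite ler_norml => /andP[? ?]; have z0 := z_ge0; lra.
Qed.

Lemma grid_length_le_close t dl : 0 < dl -> dl < t -> z <= dl / 2 ->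
  (forall y, `|ph y - p y| <= dl / 2) ->
  W t <= level_length sigma (t - dl) x + h.
Proof.
move=> dl0 dlt zdl close; have td0 : 0 < t - dl by lra.
have t0 : 0 < t by lra.
have [E _] := superlevel_radius td0.
rewrite /level_length; apply: (@grid_count_le _ s M (f x) _ (fun k => t < pert (grid_point s M k))) => //.
  by rewrite le_max lexx orbT.
move=> k /ltW /(hat_density_pert_gt0 t0)[_ hk].
rewrite le_max -E; apply/orP; left.
by have := close (grid_point s M k); rewrite ler_norml => /andP[? ?]; lra.
Qed.

Lemma grid_length_le t : 0 < t -> z <= t / 2 -> W t <= 2 / t + h.
Proof.
move=> t0 zt; have t20 : 0 < t / 2 by lra.
apply: (@le_trans _ _ (2 * Num.max (level_radius (hat_sd s tv x) (t / 2)) 0 + h)).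
  apply: (@grid_count_le _ s M (fh x) _ (fun k => t < pert (grid_point s M k))) => //.
    by rewrite le_max lexx orbT.
  move=> k /ltW /(hat_density_pert_gt0 t0)[_ hk].
  rewrite le_max -normal_superlevel//; apply/orP; left.
  by rewrite -/(hat_normal _ _ _ _ _); lra.
by rewrite lerD2r; have := level_radius_le sd_gt0 t20; rewrite invf_div.
Qed.

End one_observation.

(** * Consequences of the sampling scheme *)

Section sampling_facts.
Context {disp : measure_display} {Omega : measurableType disp} {R : realType}.
Variables (P : probability Omega R) (d n N : nat).
Variables (X : {mfun Omega >-> d.-tuple R}) (Y : {mfun Omega >-> R}).
Variables (u : R) (u_gt0 : 0 < u) (S : sampling P d n N).
Hypothesis S_valid : valid_sampling X Y u_gt0 S.

Let indS : mutually_independent P (source_sigma X Y S).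
Proof. by case: S_valid. Qed.

Lemma sigma_of_preimage {d'} {T : measurableType d'} (U : Omega -> T) (B : set T) :
  measurable B -> sigma_of U (U @^-1` B).
Proof. by move=> mB; exists B => //; rewrite setTI. Qed.

Lemma fresh_pair_fst (B : set (d.-tuple R)) : measurable B ->
  source_sigma X Y S (FreshPair n N) (X @^-1` B).
Proof.
move=> mB; exists (B `*` setT); first exact: measurableX.
by rewrite setTI; apply/seteqP; split => w //= [].
Qed.

Lemma zeta_indep_fresh : indep_pair P (fresh_perturbation S) (fun w => (X w, Y w)).
Proof.
move=> A B mA mB.
apply: (mutually_independent2 (i := FreshPerturbation n N) (j := FreshPair n N) indS) => //;
  exact: sigma_of_preimage.
Qed.

Lemma unlabeled_indep i j : i != j -> indep_pair P (unlabeled S i) (unlabeled S j).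
Proof.
move=> ij A B mA mB.
apply: (mutually_independent2 (i := Unlabeled n i) (j := Unlabeled n j) indS).
- by case => /eqP; rewrite (negbTE ij).
- exact: sigma_of_preimage.
- exact: sigma_of_preimage.
Qed.

Lemma measurable_labeled_data : measurable_fun setT (labeled_data S).
Proof.
apply/measurable_fun_tnthP => i.
apply: eq_measurable_fun (measurable_funPT (labeled S i)) => w _ /=.
by rewrite tnth_mktuple.
Qed.

Let D : {mfun Omega >-> n.-tuple (d.-tuple R * R)} :=
  HB.pack (labeled_data S) (isMeasurableFun.Build _ _ _ _ _ measurable_labeled_data).

Lemma labeled_data_indep (i0 : source n N) (V : {mfun Omega >-> d.-tuple R}) :
  (forall i, i0 <> Labeled N i) ->
  (forall B, measurable B -> source_sigma X Y S i0 (V @^-1` B)) ->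
  indep_pair P (labeled_data S) V.
Proof.
move=> i0L i0V; apply: indep_pair_tuple => B C mB mC.
(* The source [i0] is prepended to the labeled ones to form one subfamily. *)
pose k (m : 'I_n.+1) := if unlift ord0 m is Some i then Labeled N i else i0.
pose A (m : 'I_n.+1) := if unlift ord0 m is Some i then labeled S i @^-1` B i
  else V @^-1` C.
have LB i : source_sigma X Y S (Labeled N i) (labeled S i @^-1` B i).
  exact: sigma_of_preimage.
have -> : \bigcap_i (labeled S i @^-1` B i) `&` V @^-1` C = \bigcap_m A m.
  apply/seteqP; split=> [w [Bw Cw] m _|w ABw].
    by rewrite /A; case: unliftP => [i _|_]; [exact: Bw|].
  split=> [i _|].
    by have := ABw (lift ord0 i) Logic.I; rewrite /A liftK.
  by have := ABw ord0 Logic.I; rewrite /A unlift_none.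
rewrite (indS (j := k) (A := A)); last 2 first.
- move=> a b; rewrite /k; case: unliftP => [i ->|->]; case: unliftP => [j ->|->] //.
  + by case => ->.
  + by move/esym/i0L.
  + by move/i0L.
- by move=> m; rewrite /k /A; case: unliftP => [i _|_]; [exact: LB|exact: i0V].
rewrite big_ord_recl muleC {2}/A unlift_none; congr (_ * _)%E.
rewrite (indS (j := Labeled N) (A := fun i => labeled S i @^-1` B i)) //.
  by apply: eq_bigr => i _; rewrite /A liftK.
by move=> a b [].
Qed.

Local Open Scope ereal_scope.

Lemma labeled_fresh_integral (h : n.-tuple (d.-tuple R * R) * d.-tuple R -> \bar R) :
  measurable_fun setT h -> (forall q, 0 <= h q) ->
  \int[P]_w h (labeled_data S w, X w) =
  \int[P]_w \int[P]_w' h (labeled_data S w, X w').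
Proof.
move=> mh h0.
have DX : indep_pair P D X.
  by apply: (labeled_data_indep (i0 := FreshPair n N)) => // B mB; exact: fresh_pair_fst.
exact: (indep_integral DX mh h0).
Qed.

(** Relative to the labeled data, an unlabeled observation plays the role of the
    fresh one: it is independent of them and has the same law. *)
Lemma labeled_unlabeled_integral i (h : n.-tuple (d.-tuple R * R) * d.-tuple R -> \bar R) :
  measurable_fun setT h -> (forall q, 0 <= h q) ->
  \int[P]_w h (labeled_data S w, unlabeled S i w) =
  \int[P]_w h (labeled_data S w, X w).
Proof.
move=> mh h0; rewrite labeled_fresh_integral//.
have DU : indep_pair P D (unlabeled S i).
  apply: (labeled_data_indep (i0 := Unlabeled n i)) => // B mB.
  exact: sigma_of_preimage.
transitivity (\int[P]_w \int[P]_w' h (labeled_data S w, unlabeled S i w')).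
  exact: (indep_integral DU mh h0).
apply: eq_integral => w _.
apply: (same_law_integral (h := fun x => h (labeled_data S w, x))) => //.
  by case: S_valid.
exact: measurableT_comp.
Qed.

Lemma unlabeled_average_integral (b : n.-tuple (d.-tuple R * R) * d.-tuple R -> R) :
  (0 < N)%N -> measurable_fun setT b -> (forall q, (0 <= b q)%R) ->
  \int[P]_w (N%:R^-1 * \sum_(i < N) b (labeled_data S w, unlabeled S i w))%R%:E =
  \int[P]_w (b (labeled_data S w, X w))%:E.
Proof.
move=> N0 mb b0.
have mbE : measurable_fun setT (fun q => (b q)%:E) by exact/measurable_EFinP.
have mbi i : measurable_fun setT (fun w => (b (labeled_data S w, unlabeled S i w))%:E).
  apply: (measurableT_comp mbE); apply: measurable_fun_pair => //.
  exact: measurable_labeled_data.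
have Ni : (0 <= N%:R^-1 :> R)%R by rewrite invr_ge0.
transitivity (\int[P]_w ((N%:R^-1)%:E *
    \sum_(i < N) (b (labeled_data S w, unlabeled S i w))%:E)).
  by apply: eq_integral => w _; rewrite sumEFin -EFinM.
rewrite ge0_integralZl//; last 2 first.
- exact: emeasurable_sum.
- by move=> w _; apply: sume_ge0 => i _; rewrite lee_fin.
rewrite ge0_integral_sum//; last by move=> i w _; rewrite lee_fin.
under eq_bigr do rewrite (labeled_unlabeled_integral _ mbE)//.
rewrite big_const_ord.
set J := \int[P]_w _.
have iterJ m : iter m (+%E J) 0 = m%:R%:E * J.
  elim: m => [|m IH]; first by rewrite mul0e.
  rewrite iterS IH -natr1 EFinD ge0_muleDl ?lee_fin//.
  by rewrite mul1e addeC.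
rewrite iterJ.
by rewrite muleA -EFinM mulVf ?mul1e// pnatr_eq0 -lt0n.
Qed.

Let out_itv (U : Omega -> R) :
  [set w | ~ (0 <= U w <= u)%R] = U @^-1` (~` `[0%R, u]).
Proof. by apply/seteqP; split => w /=; rewrite in_itv. Qed.

Let measurable_out (U : {RV P >-> R}) : measurable [set w | ~ (0 <= U w <= u)%R].
Proof.
rewrite out_itv -[X in measurable X]setTI; apply: measurable_funPT => //.
exact: measurableC.
Qed.

Let out_null (U : {RV P >-> R}) :
  has_law P U (uniform_prob u_gt0) -> P [set w | ~ (0 <= U w <= u)%R] = 0.
Proof.
move=> hU; rewrite out_itv hU; last exact: measurableC.
by rewrite /uniform_prob integral_uniform_pdf setICl integral_set0.
Qed.

Lemma measurable_bad_fresh : measurable [set w | ~ (0 <= fresh_perturbation S w <= u)%R].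
Proof. exact: measurable_out. Qed.

Lemma fresh_perturbation_null :
  P [set w | ~ (0 <= fresh_perturbation S w <= u)%R] = 0.
Proof. by case: S_valid => _ _ _ h _; exact: out_null. Qed.

Definition bad_perturbation : set Omega :=
  \bigcup_i [set w | ~ (0 <= perturbation S i w <= u)%R].

Lemma measurable_bad_perturbation : measurable bad_perturbation.
Proof.
apply: fin_bigcup_measurable; first exact: finite_finset.
by move=> i _; exact: measurable_out.
Qed.

Lemma bad_perturbation_null : P bad_perturbation = 0.
Proof.
have [_ _ h _ _] := S_valid.
pose F k : set Omega := if insub k is Some i
  then [set w | ~ (0 <= perturbation S i w <= u)%R] else set0.
apply/(negligibleP P measurable_bad_perturbation).
have -> : bad_perturbation = \bigcup_k F k.
  apply/seteqP; split=> w [i _].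
    by exists (val i) => //; rewrite /F valK.
  by rewrite /F; case: insubP => // j _ _; exists j.
apply: negligible_bigcup => k; rewrite /F; case: insubP => [i _ _|_].
  exact/(negligibleP P (measurable_out _))/out_null/h.
exact: negligible_set0.
Qed.

End sampling_facts.

(** * The mean loss for fixed sample sizes *)

Lemma measurable_truncate_var {d : measure_display} {T : measurableType d}
    {R : realType} (s : R) (v : T -> R) :
  measurable_fun setT v -> measurable_fun setT (fun w => truncate_var s (v w)).
Proof.
move=> mv; apply: measurable_funD; first apply: measurable_funD.
- apply: measurable_funM => //; apply: measurable_boolR.
  by apply: measurable_and; apply: measurable_fun_ler.
- by apply: measurable_funM => //; apply: measurable_boolR; apply: measurable_fun_ltr.
- by apply: measurable_funM => //; apply: measurable_boolR; apply: measurable_fun_ltr.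
Qed.

Section fixed_sizes.
Context {disp : measure_display} {Omega : measurableType disp} {R : realType}.
Variables (P : probability Omega R) (d n N : nat).
Variables (X : {mfun Omega >-> d.-tuple R}) (Y : {mfun Omega >-> R}).
Variables (u : R) (u_gt0 : 0 < u) (S : sampling P d n N).
Hypothesis S_valid : valid_sampling X Y u_gt0 S.
Variables (f sigma : d.-tuple R -> R) (sigma0 sigma1 : R).
Hypothesis f_meas : measurable_fun setT f.
Hypothesis sigma_meas : measurable_fun setT sigma.
Hypothesis sigma0_gt0 : 0 < sigma0.
Hypothesis sigma_bounds : forall x, sigma0 <= sigma x <= sigma1.
Let data := (n.-tuple (d.-tuple R * R))%type.
Variables fh tv : data -> d.-tuple R -> R.
Hypothesis fh_meas : measurable_fun setT (fun q : data * d.-tuple R => fh q.1 q.2).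
Hypothesis tv_meas : measurable_fun setT (fun q : data * d.-tuple R => tv q.1 q.2).
Hypothesis tv_ge0 : forall D x, 0 <= tv D x.
Variables (s l : R) (M : nat).
Hypothesis s_gt0 : 0 < s.
Hypothesis l_gt0 : 0 < l.
Hypothesis M_gt0 : (0 < M)%N.
Hypothesis N_gt0 : (0 < N)%N.

Definition fitted_set (w : Omega) : d.-tuple R -> R -> set R :=
  hat_set s (fh (labeled_data S w)) (tv (labeled_data S w)) M
    (fun i => unlabeled S i w) (fun i => perturbation S i w) l.

Lemma measurable_fitted_set w : measurable
  [set q : (d.-tuple R * R) * R | fitted_set w q.1.1 q.1.2 q.2].
Proof.
have m1 : measurable_fun setT (fun q : (d.-tuple R * R) * R => (labeled_data S w, q.1.1)).
  by apply: measurable_fun_pair => //; apply: measurableT_comp.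
have mi : measurable_fun setT (fun q : (d.-tuple R * R) * R => (`|q.2| <= s)%R%:R : R).
  by apply: measurable_boolR; apply: measurable_fun_ler => //; apply: measurableT_comp.
apply: measurable_bool_set; apply: measurable_fun_ler => //.
apply: measurable_funD; apply: measurable_funM => //; last exact: measurableT_comp.
apply: measurable_normal_pdf_comp => //.
- by move=> q; apply: hat_sd_gt0 => // x; exact: tv_ge0.
- exact: (measurableT_comp fh_meas m1).
- apply: measurable_sqrtr; apply: measurable_truncate_var.
  exact: (measurableT_comp tv_meas m1).
Qed.

Variables (t1 t2 dl eta kap e ts v0 : R).
Let lam := oracle_level P X f sigma l.
Hypothesis lam_gt0 : 0 < lam.
Hypothesis dl_gt0 : 0 < dl.
Hypothesis dl_lt : dl < t1.
Hypothesis t1_le : t1 <= lam.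
Hypothesis t2_ge : lam <= t2.
Hypothesis kap_gt0 : 0 < kap.
Let mass := level_mass P X f sigma.
Hypothesis mass_t1 : l + kap <= mass (t1 + dl).
Hypothesis mass_t2 : mass (t2 - dl) <= l - kap.
Hypothesis e_ge0 : 0 <= e.
Hypothesis mass_e : mass (t1 - dl) <= mass (t2 + dl) + e.
Hypothesis eta_gt0 : 0 < eta.
Hypothesis close : forall D x, `|fh D x - f x| <= eta ->
  `|hat_var s (tv D) x - sigma x ^+ 2| <= eta ->
  forall y, `|hat_normal s (fh D) (tv D) y x - cond_density f sigma y x| <= dl / 2.
Hypothesis ts_gt0 : 0 < ts.
Hypothesis ts_le : ts <= t1.
Hypothesis u_dl : u <= dl / 2.
Hypothesis u_ts : u <= ts / 2.
Hypothesis v0_gt0 : 0 < v0.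
Hypothesis v0_le : 2 * v0 <= sigma0 ^+ 2.
Let K := l + 1.
Hypothesis ts_low : ts < (Num.sqrt ((sigma1 ^+ 2 + v0) * pi *+ 2))^-1 *
  expR (- (K ^+ 2 / (2 * v0))).
Hypothesis s_K : 2 * K <= s.
Hypothesis s_t1 : (t1 - dl)^-1 < s.
Let h := 2 * s / M%:R.
Hypothesis h_kap : h <= kap / 3.
Hypothesis h_1 : h <= 1.

Let sigma_gt0 x : 0 < sigma x.
Proof. by have /andP[h' _] := sigma_bounds x; exact: lt_le_trans h'. Qed.

(** A value below [1] certifies that [x] is an observation at which the fitted
    density is uniformly close to the true one, which lives well inside
    [-s, s]. *)
Definition misfit (q : data * d.-tuple R) : R :=
  (fh q.1 q.2 - f q.2) ^+ 2 / eta ^+ 2 +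
  `|hat_var s (tv q.1) q.2 - sigma q.2 ^+ 2| / eta +
  `|f q.2| / (s - (t1 - dl)^-1).

(** A value below [1] only certifies that the fitted density has a moderate
    variance and is centred well inside [-s, s]. *)
Definition gross_misfit (q : data * d.-tuple R) : R :=
  (fh q.1 q.2 - f q.2) ^+ 2 * (16 / s ^+ 2) +
  `|hat_var s (tv q.1) q.2 - sigma q.2 ^+ 2| / v0 +
  (s / 4 < `|f q.2|)%R%:R.

Let sK'0 : 0 < s - (t1 - dl)^-1. Proof. by rewrite subr_gt0. Qed.

Lemma misfit_ge0 q : 0 <= misfit q.
Proof.
have sp := ltW sK'0; have ep := ltW eta_gt0.
by rewrite !addr_ge0 ?divr_ge0 ?sqr_ge0.
Qed.

Lemma gross_misfit_ge0 q : 0 <= gross_misfit q.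
Proof.
have vp := ltW v0_gt0.
have h16 : 0 <= 16 / s ^+ 2 by rewrite divr_ge0 ?sqr_ge0.
by rewrite !addr_ge0 ?divr_ge0 ?(mulr_ge0 (sqr_ge0 _) h16).
Qed.

Lemma measurable_fit_errors :
  [/\ measurable_fun setT (fun q : data * d.-tuple R => (fh q.1 q.2 - f q.2) ^+ 2),
      measurable_fun setT (fun q : data * d.-tuple R =>
        `|hat_var s (tv q.1) q.2 - sigma q.2 ^+ 2|) &
      measurable_fun setT (fun q : data * d.-tuple R => `|f q.2|)].
Proof.
have mf2 : measurable_fun setT (fun q : data * d.-tuple R => f q.2) by exact: measurableT_comp.
split.
- by apply: measurable_funX; exact: measurable_funB.
- apply: measurableT_comp => //; apply: measurable_funB.
    exact: measurable_truncate_var.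
  by apply: measurable_funX; exact: measurableT_comp.
- exact: measurableT_comp.
Qed.

Lemma measurable_misfit : measurable_fun setT misfit.
Proof.
have [m1 m2 m3] := measurable_fit_errors.
by apply: measurable_funD; [apply: measurable_funD|]; exact: measurable_funM.
Qed.

Lemma measurable_gross_misfit : measurable_fun setT gross_misfit.
Proof.
have [m1 m2 m3] := measurable_fit_errors.
apply: measurable_funD; [apply: measurable_funD; exact: measurable_funM|].
by apply: measurable_boolR; exact: measurable_fun_ltr.
Qed.

Lemma misfit_lt1 D x : misfit (D, x) < 1 ->
  (forall y, `|hat_normal s (fh D) (tv D) y x - cond_density f sigma y x| <= dl / 2) /\
  `|f x| + (t1 - dl)^-1 <= s.
Proof.
rewrite /misfit/= => b1.
have A0 : 0 <= (fh D x - f x) ^+ 2 / eta ^+ 2 by rewrite divr_ge0 ?sqr_ge0.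
have B0 : 0 <= `|hat_var s (tv D) x - sigma x ^+ 2| / eta by rewrite divr_ge0 ?(ltW eta_gt0).
have C0 : 0 <= `|f x| / (s - (t1 - dl)^-1) by rewrite divr_ge0 ?(ltW sK'0).
split; last first.
  have : `|f x| / (s - (t1 - dl)^-1) <= 1 by lra.
  by rewrite ler_pdivrMr// mul1r; lra.
apply: close.
  have : (fh D x - f x) ^+ 2 / eta ^+ 2 <= 1 by lra.
  rewrite ler_pdivrMr ?exprn_gt0// mul1r -[leLHS]real_normK ?num_real//.
  by rewrite ler_pXn2r ?nnegrE ?(ltW eta_gt0).
have : `|hat_var s (tv D) x - sigma x ^+ 2| / eta <= 1 by lra.
by rewrite ler_pdivrMr// mul1r.
Qed.

Lemma gross_misfit_lt1 D x : gross_misfit (D, x) < 1 ->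
  v0 <= hat_var s (tv D) x <= sigma1 ^+ 2 + v0 /\ `|fh D x| + K <= s.
Proof.
rewrite /gross_misfit/= => b1.
have A0 : 0 <= (fh D x - f x) ^+ 2 * (16 / s ^+ 2) by rewrite mulr_ge0 ?sqr_ge0// divr_ge0 ?sqr_ge0.
have B0 : 0 <= `|hat_var s (tv D) x - sigma x ^+ 2| / v0 by rewrite divr_ge0 ?(ltW v0_gt0).
have e1 : true%:R = 1 :> R by [].
have C0 : 0 <= (s / 4 < `|f x|)%R%:R :> R by [].
split.
  have : `|hat_var s (tv D) x - sigma x ^+ 2| / v0 <= 1 by lra.
  rewrite ler_pdivrMr// mul1r ler_norml => /andP[h1 h2].
  have /andP[g1 g2] := sigma_bounds x.
  have s0 := sigma0_gt0.
  have k1 : sigma0 ^+ 2 <= sigma x ^+ 2 by rewrite ler_pXn2r ?nnegrE ?(ltW s0) ?(ltW (sigma_gt0 x)).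
  have k2 : sigma x ^+ 2 <= sigma1 ^+ 2.
    by rewrite ler_pXn2r ?nnegrE ?(ltW (sigma_gt0 x))// (le_trans (ltW (sigma_gt0 x))).
  by have k3 := v0_le; apply/andP; split; lra.
have fx : `|f x| <= s / 4.
  by case: (leP `|f x| (s / 4)) => // hf; move: b1; rewrite hf e1; lra.
have fd : `|fh D x - f x| <= s / 4.
  have : (fh D x - f x) ^+ 2 * (16 / s ^+ 2) <= 1 by lra.
  rewrite mulrA ler_pdivrMr ?exprn_gt0// mul1r => hs.
  rewrite -(@ler_pXn2r _ 2)// ?nnegrE ?divr_ge0 ?(ltW s_gt0)//.
  rewrite real_normK ?num_real//.
  have -> : (s / 4) ^+ 2 = s ^+ 2 / 16 by field.
  lra.
have -> : fh D x = (fh D x - f x) + f x by ring.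
have := ler_normD (fh D x - f x) (f x); have := s_K; lra.
Qed.

Let C := 2 / ts + lam^-1.

Let C_gt0 : 0 < C.
Proof. by rewrite addr_gt0 ?divr_gt0 ?invr_gt0. Qed.

Let level w := hat_level s (fh (labeled_data S w)) (tv (labeled_data S w)) M
    (fun i => unlabeled S i w) (fun i => perturbation S i w) l.

Let H w := sym_diff_loss P X (fresh_perturbation S) f sigma l (fitted_set w).

(** Almost surely the fresh perturbation lies between [0] and [u], so only those
    values matter. *)
Let H_le_cst w (c : R) : 0 <= c ->
  (forall x z, 0 <= z <= u ->
    (lebesgue_measure (fitted_set w x z `+` oracle_set P X f sigma l x) <= c%:E)%E) ->
  (H w <= c%:E)%E.
Proof.
move=> c0 hc; rewrite -(probability_integral_cst P c%:E).
rewrite /H /sym_diff_loss.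
apply: (ge0_le_integral_null (measurable_bad_fresh u S) (fresh_perturbation_null S_valid)) => //.
- by move=> w' /contrapT zu; exact: hc.
Qed.

Lemma loss_le_of_positive_level w : 0 < level w -> (H w <= (2 * s + lam^-1)%:E)%E.
Proof.
move=> L0; apply: H_le_cst => [|x z /andP[z0 zu]].
  by rewrite addr_ge0 ?mulr_ge0 ?invr_ge0 ?(ltW s_gt0) ?(ltW lam_gt0).
exact: loss_le_support.
Qed.

Lemma loss_le_of_level w : ts <= level w -> (H w <= C%:E)%E.
Proof.
move=> L0; apply: H_le_cst => [|x z /andP[z0 zu]]; first exact: ltW.
apply: loss_le_level => //.
by have hu := u_ts; lra.
Qed.

Let level_length_anti t t' x : 0 < t -> t <= t' ->
  level_length sigma t' x <= level_length sigma t x.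
Proof.
move=> t0 tt'; have t'0 : 0 < t' by exact: lt_le_trans tt'.
have mp v : measurable [set y | v <= cond_density f sigma y x].
  by apply: measurable_bool_set; apply: measurable_fun_ler => //; exact: measurable_normal_pdf.
rewrite -lee_fin -!(lebesgue_level_set f sigma0_gt0 sigma_bounds)//.
by apply: le_measure; rewrite ?inE//; [exact: mp|exact: mp|move=> y /=; exact: le_trans].
Qed.

Let mlen t : 0 < t -> measurable_fun setT (fun w => level_length sigma t (X w)).
Proof.
move=> t0; apply: measurableT_comp => //.
exact: (measurable_level_length f_meas sigma_meas sigma0_gt0 sigma_bounds).
Qed.

Let length_integral t : 0 < t ->
  (\int[P]_w (level_length sigma t (X w))%:E = (mass t)%:E)%E.
Proof.
move=> t0; rewrite -(oracle_GE P X f_meas sigma_meas sigma0_gt0 sigma_bounds)//.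
exact: (level_massE P X f_meas sigma_meas sigma0_gt0 sigma_bounds).
Qed.

Let mean_misfit (w : Omega) : \bar R := (\int[P]_w' (misfit (labeled_data S w, X w'))%:E)%E.

Lemma loss_le_of_bracket w : t1 <= level w <= t2 ->
  (H w <= e%:E + C%:E * mean_misfit w)%E.
Proof.
move=> Lw; have t1d0 : 0 < t1 - dl by rewrite subr_gt0.
have td12 : t1 - dl <= t2 + dl by have := t1_le; have := t2_ge; have := dl_gt0; lra.
have t2d0 : 0 < t2 + dl by exact: lt_le_trans td12.
pose g w' := level_length sigma (t1 - dl) (X w') - level_length sigma (t2 + dl) (X w').
pose b w' := misfit (labeled_data S w, X w').
have g0 w' : 0 <= g w' by rewrite subr_ge0 level_length_anti.
have b0 w' : 0 <= b w' by exact: misfit_ge0.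
have mg : measurable_fun setT g by apply: measurable_funB; exact: mlen.
have mb : measurable_fun setT b.
  by apply: (measurableT_comp measurable_misfit); apply: measurable_fun_pair.
have mCb : measurable_fun setT (fun w' => C * b w') by exact: measurable_funM.
apply: (@le_trans _ _ (\int[P]_w' (g w' + C * b w')%:E)%E).
  rewrite /H /sym_diff_loss.
  apply: (ge0_le_integral_null (measurable_bad_fresh u S) (fresh_perturbation_null S_valid)) => //.
  - by apply/measurable_EFinP; exact: measurable_funD.
  - by move=> w'; rewrite lee_fin addr_ge0// mulr_ge0// ltW.
  move=> w' /contrapT /andP[z0 zu].
  case: (ltP (b w') 1) => b1.
    have [cl fs] := misfit_lt1 b1.
    have zdl : fresh_perturbation S w' <= dl / 2 by exact: le_trans zu u_dl.
    apply: (@le_trans _ _ (g w')%:E); last first.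
      by rewrite lee_fin lerDl mulr_ge0// ltW.
    have lamt : t1 <= lam <= t2 by apply/andP.
    have := loss_le_bracket sigma_gt0 z0 dl_gt0 dl_lt Lw lamt zdl cl fs.
    exact.
  apply: (@le_trans _ _ C%:E); last first.
    by rewrite lee_fin (le_trans _ (lerD (g0 w') (lexx _)))// add0r ler_peMr// ltW.
  apply: loss_le_level => //; last by rewrite (le_trans zu)//; have := u_ts.
  by case/andP: Lw => Lw _; exact: le_trans ts_le Lw.
under eq_integral do rewrite EFinD EFinM.
rewrite ge0_integralD//; last 4 first.
- by move=> w' _; rewrite lee_fin.
- exact/measurable_EFinP.
- by move=> w' _; rewrite mule_ge0// lee_fin// ltW.
- by apply/measurable_EFinP.
rewrite ge0_integralZl//; last 3 first.
- exact/measurable_EFinP.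
- by move=> w' _; rewrite lee_fin.
- by rewrite lee_fin ltW.
rewrite leeD2r//.
have : (\int[P]_w' (g w')%:E + (mass (t2 + dl))%:E = (mass (t1 - dl))%:E)%E.
  rewrite -!length_integral// -ge0_integralD//; last 4 first.
  - by move=> w' _; rewrite lee_fin.
  - exact/measurable_EFinP.
  - by move=> w' _; rewrite lee_fin (level_length_ge0).
  - by apply/measurable_EFinP; exact: mlen.
  by apply: eq_integral => w' _; rewrite -EFinD subrK.
move=> eg; rewrite -(@leeD2rE _ (mass (t2 + dl))%:E)// eg -EFinD lee_fin.
by rewrite [leRHS]addrC; exact: mass_e.
Qed.

Let avg (c : 'I_N -> R) : R := N%:R^-1 * \sum_(i < N) c i.

Let Nr_gt0 : 0 < N%:R :> R. Proof. by rewrite ltr0n. Qed.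

Let avg_le c c' : (forall i, c i <= c' i) -> avg c <= avg c'.
Proof.
by move=> cc; rewrite ler_wpM2l ?invr_ge0 ?(ltW Nr_gt0)//; apply: ler_sum => i _.
Qed.

Let avg_ge0 c : (forall i, 0 <= c i) -> 0 <= avg c.
Proof.
by move=> c0; rewrite mulr_ge0 ?invr_ge0 ?(ltW Nr_gt0)// sumr_ge0.
Qed.

Let avg_affine (c c' : 'I_N -> R) (a b : R) :
  avg (fun i => c i + a * c' i + b) = avg c + a * avg c' + b.
Proof.
rewrite /avg big_split/= big_split/= -mulr_sumr sumr_const card_ord -(mulr_natl b).
by rewrite !mulrDr mulKf ?gt_eqF// mulrCA.
Qed.

Let mis w i := misfit (labeled_data S w, unlabeled S i w).
Let gross w i := gross_misfit (labeled_data S w, unlabeled S i w).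
Let len t w i := level_length sigma t (unlabeled S i w).

Let h_gt0 : 0 < h. Proof. by rewrite divr_gt0 ?mulr_gt0// ltr0n. Qed.

Let level_length_le' t x : 0 < t -> level_length sigma t x <= t^-1.
Proof. exact: (level_length_le sigma0_gt0 sigma_bounds). Qed.

Let good_perturbation w : ~ bad_perturbation u S w ->
  forall i, 0 <= perturbation S i w <= u.
Proof. by move=> bw i; apply: contrapT => h'; apply: bw; exists i. Qed.

Let cells w t := fun i => grid_length s (fh (labeled_data S w))
  (tv (labeled_data S w)) M t (unlabeled S i w) (perturbation S i w).

Let GE w t : hat_G s (fh (labeled_data S w)) (tv (labeled_data S w)) M
    (fun i => unlabeled S i w) (fun i => perturbation S i w) t = avg (cells w t).
Proof. exact: hat_GE. Qed.

(** As long as fewer than half of the observations are gross misfits, half of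
    them have at the level [ts] a superlevel set of length [2 * K], more than
    [2 * l]. *)
Lemma level_ge_ts w : ~ bad_perturbation u S w -> avg (gross w) < 1 / 2 ->
  ts <= level w.
Proof.
move=> /good_perturbation zu gw; apply: hat_level_ge => //; rewrite GE.
have h1 := h_1; have l0 := l_gt0.
(* Each cell is at least [(2 * K - h) * (1 - gross w i)]: this is nonpositive
   as soon as [gross w i] reaches [1]. On average it exceeds [(2 * K - 1) / 2 > l]. *)
apply: (@lt_le_trans _ _ (avg (fun i => 0 + (- (2 * K - h)) * gross w i + (2 * K - h)))).
  rewrite avg_affine (_ : avg (fun=> 0) = 0); last by rewrite /avg big1 ?mulr0.
  by rewrite add0r /K in gw *; nra.
apply: avg_le => i; have /andP[z0 _] := zu i.
have g0 : 0 <= gross w i by exact: gross_misfit_ge0.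
have K0 : 0 < K by rewrite /K; lra.
case: (ltP (gross w i) 1) => g1; last first.
  apply: (le_trans _ (grid_length_ge0 _ _ s_gt0 M_gt0 _ _ _)).
  by rewrite /K in K0 *; nra.
have [hv fK] := gross_misfit_lt1 g1.
have := grid_length_ge_moderate s_gt0 (tv_ge0 _) M_gt0 z0 v0_gt0 K0 hv fK ts_low.
by rewrite -/h /cells; move: (grid_length _ _ _ _ _ _ _) => W; rewrite /K in K0 *; nra.
Qed.

(** The mass at [t1 + dl] exceeds [l] by [kap], to be shared between the
    fluctuation of the average, the misfits and the grid step. *)
Lemma level_ge_t1 w : ~ bad_perturbation u S w ->
  `|avg (len (t1 + dl) w) - mass (t1 + dl)| < kap / 3 ->
  (t1 + dl)^-1 * avg (mis w) < kap / 3 -> t1 <= level w.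
Proof.
move=> /good_perturbation zu; rewrite ltr_norml => /andP[dev _] bad.
have dl0 := dl_gt0; have dlt := dl_lt.
have t10 : 0 < t1 by lra.
have td0 : 0 < t1 + dl by lra.
apply: hat_level_ge => //; rewrite GE.
(* A misfit costs at most [(t1 + dl)^-1], the largest possible length. *)
apply: (@lt_le_trans _ _ (avg (fun i => len (t1 + dl) w i + (- (t1 + dl)^-1) * mis w i - h))).
  by rewrite avg_affine; have := mass_t1; have := h_kap; lra.
apply: avg_le => i; have /andP[z0 _] := zu i.
have m0 : 0 <= mis w i by exact: misfit_ge0.
have ti : 0 < (t1 + dl)^-1 by rewrite invr_gt0.
have tm : 0 <= (t1 + dl)^-1 * mis w i by rewrite mulr_ge0 ?(ltW ti).
case: (ltP (mis w i) 1) => m1.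
  have [cl fs] := misfit_lt1 m1.
  have fs' : `|f (unlabeled S i w)| + (t1 + dl)^-1 <= s.
    apply: (le_trans _ fs); rewrite lerD2l lef_pV2 ?posrE ?subr_gt0//; lra.
  have := grid_length_ge_close s_gt0 M_gt0 sigma_gt0 z0 t10 dl0 cl fs'.
  by rewrite -/h /cells /len; lra.
have := level_length_le' (unlabeled S i w) td0.
have := grid_length_ge0 (fh (labeled_data S w)) (tv (labeled_data S w)) s_gt0 M_gt0 t1
  (unlabeled S i w) (perturbation S i w).
have : (t1 + dl)^-1 <= (t1 + dl)^-1 * mis w i by rewrite ler_peMr// ltW.
by have hp := h_gt0; rewrite /cells /len; lra.
Qed.

Lemma level_le_t2 w : ~ bad_perturbation u S w ->
  `|avg (len (t2 - dl) w) - mass (t2 - dl)| < kap / 3 ->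
  2 / t2 * avg (mis w) < kap / 3 -> level w <= t2.
Proof.
move=> /good_perturbation zu; rewrite ltr_norml => /andP[_ dev] bad.
have dl0 := dl_gt0; have dlt := dl_lt; have t1l := t1_le; have t2l := t2_ge.
have dlt2 : dl < t2 by lra.
have t20 : 0 < t2 by lra.
apply: hat_level_le; [exact: ltW|rewrite GE].
apply: (@le_trans _ _ (avg (fun i => len (t2 - dl) w i + 2 / t2 * mis w i + h))); last first.
  by rewrite avg_affine; have := mass_t2; have := h_kap; lra.
apply: avg_le => i; have /andP[z0 zu'] := zu i.
have m0 : 0 <= mis w i by exact: misfit_ge0.
have ti : 0 < 2 / t2 by rewrite divr_gt0.
have tm : 0 <= 2 / t2 * mis w i by rewrite mulr_ge0 ?(ltW ti).
have udl := u_dl.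
case: (ltP (mis w i) 1) => m1.
  have [cl fs] := misfit_lt1 m1.
  have zdl : perturbation S i w <= dl / 2 by lra.
  have := grid_length_le_close s_gt0 M_gt0 sigma_gt0 dl0 dlt2 zdl cl.
  by rewrite -/h /cells /len; lra.
have zt : perturbation S i w <= t2 / 2 by lra.
have : cells w t2 i <= 2 / t2 + h by exact: (grid_length_le _ s_gt0 (tv_ge0 _) M_gt0 _ t20 zt).
have := level_length_ge0 sigma (t2 - dl) (unlabeled S i w).
have : 2 / t2 <= 2 / t2 * mis w i by rewrite ler_peMr// ltW.
by rewrite -/h /cells /len; lra.
Qed.

Let c3 := 3 / kap * ((t1 + dl)^-1 + 2 / t2).

Let Dev t : set Omega := [set w | kap / 3 <= `|avg (len t w) - mass t|].

Let mDev t : 0 < t -> measurable (Dev t).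
Proof.
move=> t0; apply: measurable_bool_set; apply: measurable_fun_ler => //.
apply: measurableT_comp => //; apply: measurable_funB => //.
apply: measurable_funM => //; apply: measurable_sum => i.
apply: measurableT_comp => //.
exact: (measurable_level_length f_meas sigma_meas sigma0_gt0 sigma_bounds).
Qed.

Let Dev_le t : 0 < t -> (P (Dev t) <= (t^-1 ^+ 2 / (N%:R * (kap / 3) ^+ 2))%:E)%E.
Proof.
move=> t0; apply: (average_deviation (X := X)) => //.
- by rewrite divr_gt0.
- by case: S_valid.
- by move=> i j ij; exact: (unlabeled_indep S_valid).
- exact: (measurable_level_length f_meas sigma_meas sigma0_gt0 sigma_bounds).
- by move=> x; rewrite level_length_ge0; exact: level_length_le'.
- exact: length_integral.
Qed.

Let loss_bound (w : Omega) : \bar R :=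
  (e%:E + C%:E * mean_misfit w +
   C%:E * ((\1_(Dev (t1 + dl)) w)%:E + (\1_(Dev (t2 - dl)) w)%:E + c3%:E * (avg (mis w))%:E) +
   (2 * (2 * s + lam^-1))%:E * (avg (gross w))%:E)%E.

Let mis0 w : 0 <= avg (mis w).
Proof. by apply: avg_ge0 => i; exact: misfit_ge0. Qed.

Let gross0 w : 0 <= avg (gross w).
Proof. by apply: avg_ge0 => i; exact: gross_misfit_ge0. Qed.

Let mean_misfit0 w : (0 <= mean_misfit w)%E.
Proof. by apply: integral_ge0 => w' _; rewrite lee_fin; exact: misfit_ge0. Qed.

Let t2_gt0 : 0 < t2.
Proof. have h1 := dl_gt0; have h2 := dl_lt; have h3 := t1_le; have h4 := t2_ge; lra. Qed.

Let t1dl_gt0 : 0 < t1 + dl.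
Proof. have h1 := dl_gt0; have h2 := dl_lt; lra. Qed.

Let t2dl_gt0 : 0 < t2 - dl.
Proof. have h1 := dl_gt0; have h2 := dl_lt; have h3 := t1_le; have h4 := t2_ge; lra. Qed.

Let c3_ge0 : 0 <= c3.
Proof.
by rewrite mulr_ge0 ?divr_ge0 ?addr_ge0 ?invr_ge0 ?divr_ge0 ?(ltW kap_gt0) ?(ltW t1dl_gt0) ?(ltW t2_gt0).
Qed.

Let G4_gt0 : 0 < 2 * (2 * s + lam^-1).
Proof. by rewrite mulr_gt0// addr_gt0 ?mulr_gt0 ?invr_gt0. Qed.

(** Three regimes: the empirical level is bracketed by [t1] and [t2]; it is not
    but exceeds [ts]; it is below [ts]. The last one costs up to [2 * s], hence
    the separate, much less demanding, certificate [gross_misfit]. *)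
Lemma loss_le_bound w : ~ bad_perturbation u S w -> (H w <= loss_bound w)%E.
Proof.
move=> bw.
have cm0 : (0 <= C%:E * mean_misfit w)%E by rewrite mule_ge0// lee_fin ltW.
pose g3 := \1_(Dev (t1 + dl)) w + \1_(Dev (t2 - dl)) w + c3 * avg (mis w).
pose g4 := 2 * (2 * s + lam^-1) * avg (gross w).
have cmis : 0 <= c3 * avg (mis w) := mulr_ge0 c3_ge0 (mis0 w).
have g30 : 0 <= g3 by rewrite !addr_ge0.
have g40 : 0 <= g4 := mulr_ge0 (ltW G4_gt0) (gross0 w).
have -> : loss_bound w = (e%:E + C%:E * mean_misfit w + (C * g3 + g4)%:E)%E.
  by rewrite (EFinD (C * g3) g4) (EFinM C g3) addeA.
have Cg3 : 0 <= C * g3 by rewrite mulr_ge0// ltW.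
have ecm : (0 <= e%:E + C%:E * mean_misfit w)%E by rewrite adde_ge0// lee_fin.
have finish (c : R) : (H w <= c%:E)%E -> c <= C * g3 + g4 ->
    (H w <= e%:E + C%:E * mean_misfit w + (C * g3 + g4)%:E)%E.
  move=> Hc cc; apply: (le_trans Hc); apply: (@le_trans _ _ (C * g3 + g4)%:E).
    by rewrite lee_fin.
  by rewrite leeDr.
case: (ltP (avg (gross w)) (1 / 2)) => gw; last first.
  have L0 : 0 < level w.
    rewrite /level; apply: hat_level_gt0 => //.
      by have h1 := s_K; have h2 := l_gt0; rewrite /K in h1; lra.
    by move=> i; have /andP[] := good_perturbation bw i.
  apply: (finish _ (loss_le_of_positive_level L0)).
  have : 2 * (2 * s + lam^-1) * (1 / 2) <= g4 by rewrite ler_pM2l.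
  lra.
have Lts := level_ge_ts bw gw.
have [/= |notin] := boolP (t1 <= level w <= t2).
  move=> Lw; apply: (le_trans (loss_le_of_bracket Lw)).
  by rewrite leeDl// lee_fin addr_ge0.
apply: (finish _ (loss_le_of_level Lts)).
suff : 1 <= g3 by move=> h1; have := C_gt0; nra.
have i1 : 0 <= \1_(Dev (t1 + dl)) w :> R by [].
have i2 : 0 <= \1_(Dev (t2 - dl)) w :> R by [].
have m0 := mis0 w.
have cm : 0 <= c3 * avg (mis w) by rewrite mulr_ge0.
have [D1|D1] := pselect (Dev (t1 + dl) w).
  have : \1_(Dev (t1 + dl)) w = 1 :> R by rewrite indicE mem_set.
  rewrite /g3; lra.
have [D2|D2] := pselect (Dev (t2 - dl) w).
  have : \1_(Dev (t2 - dl)) w = 1 :> R by rewrite indicE mem_set.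
  rewrite /g3; lra.
suff : 1 <= c3 * avg (mis w) by rewrite /g3; lra.
have k0 := kap_gt0.
have a1 : 0 <= (t1 + dl)^-1 * avg (mis w) by rewrite mulr_ge0 ?invr_ge0 ?(ltW t1dl_gt0).
have a2 : 0 <= 2 / t2 * avg (mis w) by rewrite mulr_ge0 ?divr_ge0 ?(ltW t2_gt0).
have c3E : c3 * avg (mis w) = ((t1 + dl)^-1 * avg (mis w) + 2 / t2 * avg (mis w)) / (kap / 3).
  by rewrite /c3; field; rewrite !gt_eqF.
rewrite c3E ler_pdivlMr ?mul1r; last by lra.
move: D1 D2 => /negP; rewrite -ltNge => D1 /negP; rewrite -ltNge => D2.
move: notin; rewrite negb_and -!ltNge => /orP[|] L.
  rewrite leNgt; apply/negP => lt.
  have lt1 : (t1 + dl)^-1 * avg (mis w) < kap / 3 by lra.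
  by have := level_ge_t1 bw D1 lt1; rewrite leNgt L.
rewrite leNgt; apply/negP => lt.
have lt1 : 2 / t2 * avg (mis w) < kap / 3 by lra.
by have := level_le_t2 bw D2 lt1; rewrite leNgt L.
Qed.

(** The certificates are averaged over the unlabeled observations in
    [loss_bound]; in expectation each average is that over a fresh one. *)
Let mean_error := (\int[P]_w (misfit (labeled_data S w, X w))%:E)%E.
Let mean_gross := (\int[P]_w (gross_misfit (labeled_data S w, X w))%:E)%E.

Lemma mean_loss_le :
  (\int[P]_w sym_diff_loss P X (fresh_perturbation S) f sigma l (fitted_set w) <=
   e%:E + C%:E * mean_error +
   C%:E * (((t1 + dl)^-1 ^+ 2 / (N%:R * (kap / 3) ^+ 2))%:E +
           ((t2 - dl)^-1 ^+ 2 / (N%:R * (kap / 3) ^+ 2))%:E + c3%:E * mean_error) +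
   (2 * (2 * s + lam^-1))%:E * mean_gross)%E.
Proof.
have mmE : measurable_fun setT (fun q => (misfit q)%:E) by apply/measurable_EFinP; exact: measurable_misfit.
have mm : measurable_fun setT mean_misfit.
  have := measurable_inner_integral P X mmE (fun q => misfit_ge0 q).
  by move=> m; apply: (measurableT_comp m); exact: measurable_labeled_data.
have mavg (b : data * d.-tuple R -> R) : measurable_fun setT b ->
    measurable_fun setT (fun w => (avg (fun i => b (labeled_data S w, unlabeled S i w)))%:E).
  move=> mb; apply/measurable_EFinP; apply: measurable_funM => //.
  apply: measurable_sum => i; apply: (measurableT_comp mb).
  by apply: measurable_fun_pair => //; exact: measurable_labeled_data.
have m1 := mavg _ measurable_misfit; have m2 := mavg _ measurable_gross_misfit.
have mi t : 0 < t -> measurable_fun setT (fun w => (\1_(Dev t) w)%:E : \bar R).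
  by move=> t0; apply/measurable_EFinP; apply: measurable_indic; exact: mDev.
have mi1 := mi _ t1dl_gt0; have mi2 := mi _ t2dl_gt0.
have Cp := ltW C_gt0; have Gp := ltW G4_gt0.
have i0 t w : (0 <= (\1_(Dev t) w)%:E :> \bar R)%E by rewrite lee_fin.
have mis0E w : (0 <= (avg (mis w))%:E)%E by rewrite lee_fin.
have gross0E w : (0 <= (avg (gross w))%:E)%E by rewrite lee_fin.
have q1 w : (0 <= c3%:E * (avg (mis w))%:E)%E by rewrite mule_ge0// lee_fin.
have mq1 : measurable_fun setT (fun w => c3%:E * (avg (mis w))%:E)%E by exact: emeasurable_funM.
pose q2 w := ((\1_(Dev (t1 + dl)) w)%:E + (\1_(Dev (t2 - dl)) w)%:E + c3%:E * (avg (mis w))%:E)%E.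
have q20 w : (0 <= q2 w)%E by rewrite !adde_ge0.
have mi12 : measurable_fun setT (fun w => (\1_(Dev (t1 + dl)) w)%:E + (\1_(Dev (t2 - dl)) w)%:E : \bar R)%E.
  exact: emeasurable_funD.
have mq2 : measurable_fun setT q2 by exact: emeasurable_funD.
have i012 w : (0 <= (\1_(Dev (t1 + dl)) w)%:E + (\1_(Dev (t2 - dl)) w)%:E :> \bar R)%E.
  by rewrite adde_ge0.
have a2 w : (0 <= C%:E * mean_misfit w)%E by rewrite mule_ge0// lee_fin.
have a3 w : (0 <= C%:E * q2 w)%E by rewrite mule_ge0// lee_fin.
have a4 w : (0 <= (2 * (2 * s + lam^-1))%:E * (avg (gross w))%:E)%E by rewrite mule_ge0// lee_fin.
have ma2 : measurable_fun setT (fun w => C%:E * mean_misfit w)%E by exact: emeasurable_funM.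
have ma3 : measurable_fun setT (fun w => C%:E * q2 w)%E by exact: emeasurable_funM.
have ma4 : measurable_fun setT (fun w => (2 * (2 * s + lam^-1))%:E * (avg (gross w))%:E)%E.
  exact: emeasurable_funM.
have a1 (w : Omega) : (0 <= e%:E)%E by rewrite lee_fin.
have ma1 : measurable_fun setT (fun w : Omega => e%:E) by [].
have a12 w : (0 <= e%:E + C%:E * mean_misfit w)%E by rewrite adde_ge0.
have ma12 : measurable_fun setT (fun w => e%:E + C%:E * mean_misfit w)%E by exact: emeasurable_funD.
have a123 w : (0 <= e%:E + C%:E * mean_misfit w + C%:E * q2 w)%E by rewrite adde_ge0.
have ma123 : measurable_fun setT (fun w => e%:E + C%:E * mean_misfit w + C%:E * q2 w)%E.
  exact: emeasurable_funD.
have mloss : measurable_fun setT loss_bound by exact: emeasurable_funD.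
have loss0 w : (0 <= loss_bound w)%E by rewrite adde_ge0.
apply: (@le_trans _ _ (\int[P]_w loss_bound w)%E).
  apply: (ge0_le_integral_null (measurable_bad_perturbation u S)
    (bad_perturbation_null S_valid)) => //.
  - by move=> w; apply: integral_ge0 => w' _; exact: measure_ge0.
  - by move=> w bw; exact: loss_le_bound.
have ID (f1 f2 : Omega -> \bar R) : (forall w, 0 <= f1 w)%E -> measurable_fun setT f1 ->
    (forall w, 0 <= f2 w)%E -> measurable_fun setT f2 ->
    (\int[P]_w (f1 w + f2 w) = \int[P]_w f1 w + \int[P]_w f2 w)%E.
  by move=> f10 mf1 f20 mf2; exact: ge0_integralD.
have IZ (k : R) (g : Omega -> \bar R) : 0 <= k -> (forall w, 0 <= g w)%E ->
    measurable_fun setT g -> (\int[P]_w (k%:E * g w) = k%:E * \int[P]_w g w)%E.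
  by move=> k0 g0 mg; rewrite ge0_integralZl.
have -> : (\int[P]_w loss_bound w = \int[P]_w (e%:E + C%:E * mean_misfit w + C%:E * q2 w) +
    \int[P]_w ((2 * (2 * s + lam^-1))%:E * (avg (gross w))%:E))%E.
  exact: (ID _ _ a123 ma123 a4 ma4).
rewrite (IZ _ _ Gp gross0E m2).
have -> : (\int[P]_w (avg (gross w))%:E = mean_gross)%E.
  exact: (unlabeled_average_integral S_valid N_gt0 measurable_gross_misfit gross_misfit_ge0).
have -> : (\int[P]_w (e%:E + C%:E * mean_misfit w + C%:E * q2 w) =
    \int[P]_w (e%:E + C%:E * mean_misfit w) + \int[P]_w (C%:E * q2 w))%E.
  exact: (ID _ _ a12 ma12 a3 ma3).
have -> : (\int[P]_w (e%:E + C%:E * mean_misfit w) = e%:E + C%:E * mean_error)%E.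
  transitivity (\int[P]_w e%:E + \int[P]_w (C%:E * mean_misfit w))%E.
    exact: (ID _ _ a1 ma1 a2 ma2).
  rewrite probability_integral_cst (IZ _ _ Cp mean_misfit0 mm); congr (_ + _ * _)%E.
  exact: (esym (labeled_fresh_integral S_valid mmE (fun q => misfit_ge0 q))).
rewrite leeD2r// leeD2l// (IZ _ _ Cp q20 mq2) lee_pmul2l ?lte_fin//.
have -> : (\int[P]_w q2 w = P (Dev (t1 + dl)) + P (Dev (t2 - dl)) + c3%:E * mean_error)%E.
  transitivity (\int[P]_w ((\1_(Dev (t1 + dl)) w)%:E + (\1_(Dev (t2 - dl)) w)%:E) +
      \int[P]_w (c3%:E * (avg (mis w))%:E))%E.
    exact: (ID _ _ i012 mi12 q1 mq1).
  rewrite (IZ _ _ c3_ge0 mis0E m1); congr (_ + _ * _)%E; last first.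
    exact: (unlabeled_average_integral S_valid N_gt0 measurable_misfit misfit_ge0).
  transitivity (\int[P]_w (\1_(Dev (t1 + dl)) w)%:E + \int[P]_w (\1_(Dev (t2 - dl)) w)%:E)%E.
    exact: (ID _ _ (i0 _) mi1 (i0 _) mi2).
  by rewrite !integral_indic ?setIT//; exact: mDev.
by rewrite leeD2r// leeD// Dev_le.
Qed.

Let mean_sqr_error : \bar R := 'E_P[fun w => (fh (labeled_data S w) (X w) - f (X w)) ^+ 2].
Let mean_var_error : \bar R :=
  'E_P[fun w => `|hat_var s (tv (labeled_data S w)) (X w) - sigma (X w) ^+ 2|].
Let mean_abs_f : \bar R := 'E_P[fun w => `|f (X w)|].

Let fit_error_integral (a b c : R) (g : data * d.-tuple R -> R) :
  0 <= a -> 0 <= b -> 0 <= c -> measurable_fun setT g -> (forall q, 0 <= g q) ->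
  (\int[P]_w ((fh (labeled_data S w) (X w) - f (X w)) ^+ 2 * a +
     `|hat_var s (tv (labeled_data S w)) (X w) - sigma (X w) ^+ 2| * b +
     g (labeled_data S w, X w) * c)%R%:E =
   a%:E * mean_sqr_error +
   b%:E * mean_var_error +
   c%:E * \int[P]_w (g (labeled_data S w, X w))%:E)%E.
Proof.
move=> a0 b0 c0 mg g0; have [m1 m2 _] := measurable_fit_errors.
have mDX : measurable_fun setT (fun w => (labeled_data S w, X w)).
  by apply: measurable_fun_pair => //; exact: measurable_labeled_data.
have n1 := measurableT_comp m1 mDX; have n2 := measurableT_comp m2 mDX.
have n3 := measurableT_comp mg mDX.
have IZ (k : R) (q : Omega -> R) : 0 <= k -> (forall w, 0 <= q w) -> measurable_fun setT q ->
    (\int[P]_w (q w * k)%:E = k%:E * \int[P]_w (q w)%:E)%E.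
  move=> k0 q0 mq; under eq_integral do rewrite mulrC EFinM.
  by rewrite ge0_integralZl//; [exact/measurable_EFinP|move=> w _; rewrite lee_fin].
rewrite /mean_sqr_error /mean_var_error unlock.
rewrite -(IZ a _ a0 (fun w => sqr_ge0 _) n1) -(IZ b _ b0 (fun w => normr_ge0 _) n2).
rewrite -(IZ c _ c0 (fun w => g0 _) n3).
have k1 : measurable_fun setT (fun w => ((fh (labeled_data S w) (X w) - f (X w)) ^+ 2 * a)%:E).
  by apply/measurable_EFinP; exact: measurable_funM.
have k2 : measurable_fun setT (fun w =>
    (`|hat_var s (tv (labeled_data S w)) (X w) - sigma (X w) ^+ 2| * b)%:E).
  by apply/measurable_EFinP; exact: measurable_funM.
have k3 : measurable_fun setT (fun w => (g (labeled_data S w, X w) * c)%:E).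
  by apply/measurable_EFinP; exact: measurable_funM.
rewrite -ge0_integralD//; last 2 first.
- by move=> w _; rewrite lee_fin mulr_ge0 ?sqr_ge0.
- by move=> w _; rewrite lee_fin mulr_ge0.
rewrite -ge0_integralD//.
- by move=> w _; rewrite -EFinD lee_fin addr_ge0 ?(mulr_ge0 (sqr_ge0 _) a0) ?mulr_ge0.
- exact: emeasurable_funD.
- by move=> w _; rewrite lee_fin mulr_ge0.
Qed.

Lemma mean_misfitE : (mean_error =
  (eta ^- 2)%:E * mean_sqr_error +
  (eta^-1)%:E * mean_var_error +
  ((s - (t1 - dl)^-1)^-1)%:E * mean_abs_f)%E.
Proof.
have [_ _ m3] := measurable_fit_errors.
rewrite [X in (_ + _ * X)%E](_ : _ = \int[P]_w (`|f (X w)|)%:E)%E; last by rewrite /mean_abs_f unlock.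
rewrite -(fit_error_integral (g := fun q => `|f q.2|))//.
- by rewrite invr_ge0 sqr_ge0.
- by rewrite invr_ge0 ltW.
- by rewrite invr_ge0 ltW.
Qed.

Lemma mean_gross_misfitE : (mean_gross =
  (16 / s ^+ 2)%:E * mean_sqr_error +
  (v0^-1)%:E * mean_var_error +
  P [set w | (s / 4 < `|f (X w)|)%R])%E.
Proof.
have [_ _ m3] := measurable_fit_errors.
have mb : measurable_fun setT (fun q : data * d.-tuple R => (s / 4 < `|f q.2|)%R%:R : R).
  by apply: measurable_boolR; exact: measurable_fun_ltr.
have mE : measurable [set w | s / 4 < `|f (X w)|].
  apply: measurable_bool_set; apply: measurable_fun_ltr => //.
  by apply: measurableT_comp => //; exact: measurableT_comp.
rewrite [X in (_ + X)%E](_ : _ = 1%:E * \int[P]_w ((s / 4 < `|f (X w)|)%R%:R)%:E)%E; last first.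
  rewrite mul1e -[in LHS](setIT [set w | _]) -integral_indic//.
  by apply: eq_integral => w _; rewrite indicE mem_setE.
rewrite -(fit_error_integral (g := fun q => (s / 4 < `|f q.2|)%R%:R))//.
- by apply: eq_integral => w _; rewrite mulr1.
- by rewrite divr_ge0 ?sqr_ge0.
- by rewrite invr_ge0 ltW.
Qed.

End fixed_sizes.

(** * Limits in both sample sizes *)

Lemma near_pair_infty (A : nat -> nat -> Prop) (n0 : nat) :
  (forall n N, (n0 <= n)%N -> (n0 <= N)%N -> A n N) ->
  \forall p \near (\oo, \oo), A p.1 p.2.
Proof.
move=> h; exists ([set n | (n0 <= n)%N], [set N | (n0 <= N)%N]) => /=.
  by split; exists n0.
by move=> [n N] [/= nn NN]; exact: h.
Qed.

Lemma near_fst_infty (A : nat -> Prop) :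
  (\forall n \near \oo, A n) -> \forall p \near (\oo, (\oo : set_system nat)), A p.1.
Proof.
move=> [n0 _ h]; exists ([set n | (n0 <= n)%N], setT) => /=.
  by split; [exists n0|exact: filterT].
by move=> [n N] [/= nn _]; exact: h.
Qed.

Lemma ge0_cvge0_near {R : realType} {T : Type} {F : set_system T} {FF : Filter F}
    (g : T -> \bar R) (r : R) :
  g x @[x --> F] --> 0%E -> 0 < r -> \forall x \near F, (g x <= r%:E)%E.
Proof.
move=> /fine_cvgP[gfin /cvgrPdist_le /(_ r)] /[apply] gr.
near=> x; have fx : g x \is a fin_num by near: x.
rewrite -(fineK fx) lee_fin.
have : `|0 - fine (g x)| <= r by near: x.
by rewrite sub0r normrN; apply: le_trans; exact: ler_norm.
Unshelve. all: by end_near. Qed.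

Lemma near_le_cvge0 {R : realType} {T : Type} {F : set_system T} {FF : Filter F}
    (g : T -> \bar R) :
  (forall x, (0 <= g x)%E) ->
  (forall r : R, 0 < r -> \forall x \near F, (g x <= r%:E)%E) ->
  g x @[x --> F] --> 0%E.
Proof.
move=> g0 gr; apply/fine_cvgP; split.
  have := gr 1 ltr01; apply: filterS => x gx.
  by rewrite ge0_fin_numE// (le_lt_trans gx)// ltry.
apply/cvgrPdist_le => r r0; have := gr _ r0; apply: filterS => x gx.
have fx : g x \is a fin_num by rewrite ge0_fin_numE// (le_lt_trans gx)// ltry.
by rewrite sub0r normrN /= ger0_norm ?fine_ge0// -lee_fin fineK.
Qed.

Section truncation.
Context {R : realType}.

Lemma trunc_level_ge (A : R) : \forall p \near (\oo, \oo), A <= trunc_level p.1 p.2.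
Proof.
pose k := (Num.truncn (expR A)).+1.
apply: (near_pair_infty (A := fun n N => A <= trunc_level n N) (n0 := k)) => n N kn kN.
have kmin : (k <= minn n N)%N by rewrite leq_min kn.
have ek : expR A <= k%:R by apply: ltW; exact: truncnS_gt.
have mk : expR A <= (minn n N)%:R by apply: (le_trans ek); rewrite ler_nat.
rewrite /trunc_level -(expRK A) ler_ln ?posrE ?expR_gt0//.
by apply: lt_le_trans mk; exact: expR_gt0.
Qed.

(** [ln N = 4 * ln (N ^ (1 / 4)) <= 4 * N ^ (1 / 4)], to be compared with the
    number of grid points, at least [4 * N ^ (1 / 2)]. *)
Lemma grid_step_small (M : nat -> nat -> nat) (r : R) : 0 < r ->
  (forall n N, 4 * Num.sqrt N%:R < (M n N)%:R :> R) ->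
  \forall p \near (\oo, \oo), 2 * trunc_level p.1 p.2 / (M p.1 p.2)%:R <= r.
Proof.
move=> r0 hM; pose k := (Num.truncn ((2 / r) ^+ 4)).+1.
apply: (near_pair_infty (A := fun n N => 2 * trunc_level n N / (M n N)%:R <= r) (n0 := k)).
move=> n N kn kN; set q := Num.sqrt (Num.sqrt N%:R) : R.
have N0 : (0 < N)%N by exact: leq_trans kN.
have Nr : 0 < N%:R :> R by rewrite ltr0n.
have q0 : 0 < q by rewrite !sqrtr_gt0.
have q2 : q ^+ 2 = Num.sqrt N%:R by rewrite sqr_sqrtr// sqrtr_ge0.
have q4 : q ^+ 4 = N%:R by rewrite (_ : 4 = (2 * 2))%N// exprM q2 sqr_sqrtr// ltW.
have sle : trunc_level n N <= 4 * q.
  have m0 : (0 < minn n N)%N by rewrite leq_min N0 (leq_trans _ kn).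
  apply: (@le_trans _ _ (ln (N%:R : R))).
    by rewrite /trunc_level ler_ln ?posrE ?ltr0n// ler_nat geq_minr.
  rewrite -q4 lnXn// -[X in X <= _]mulr_natl ler_pM2l//.
  have h : ln (1 + (q - 1)) <= q - 1 by apply: le_ln1Dx; lra.
  by move: h; rewrite [1 + _]addrC subrK; lra.
have qr : 2 / r <= q.
  rewrite -(@ler_pXn2r _ 4)// ?nnegrE ?(ltW q0) ?divr_ge0 ?(ltW r0)//.
  rewrite q4; apply: ltW; apply: (lt_le_trans (truncnS_gt _)).
  by rewrite ler_nat.
have M0 : 0 < (M n N)%:R :> R by apply: le_lt_trans (hM n N); rewrite mulr_ge0.
rewrite ler_pdivrMr//.
have h1 : 4 * q ^+ 2 < (M n N)%:R by rewrite q2.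
have h2 : 2 <= q * r by rewrite -ler_pdivrMr.
apply: (@le_trans _ _ (8 * q)); first lra.
apply: (@le_trans _ _ (r * (4 * q ^+ 2))); last by rewrite ler_pM2l// ltW.
have -> : r * (4 * q ^+ 2) = (q * r) * (4 * q) by ring.
by apply: (@le_trans _ _ (2 * (4 * q))); [lra|rewrite ler_pM2r ?mulr_gt0].
Qed.

End truncation.

(** [s * 1_(s / 4 < g) <= 4 * g * 1_(k < g)] as soon as [4 * k <= s], and
    the integral of the right-hand side tends to [0] by dominated convergence. *)
Lemma integrable_tail {disp : measure_display} {Omega : measurableType disp}
    {R : realType} (P : probability Omega R) (g : Omega -> R) (r : R) :
  measurable_fun setT g -> (forall w, 0 <= g w) ->
  (\int[P]_w (g w)%:E < +oo)%E -> 0 < r ->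
  exists2 A : R, 0 < A & forall s : R, A <= s ->
    (s%:E * P [set w | (s / 4 < g w)%R] <= r%:E)%E.
Proof.
move=> mg g0 gfin r0.
pose q (k : nat) w : \bar R := (g w * (k%:R < g w)%R%:R)%:E.
have mb t : measurable_fun setT (fun w => (t < g w)%R%:R : R).
  by apply: measurable_boolR; exact: measurable_fun_ltr.
have mq k : measurable_fun setT (q k) by apply/measurable_EFinP; exact: measurable_funM.
have gint : P.-integrable setT (EFin \o g).
  apply/integrableP; split; first exact/measurable_EFinP.
  by under eq_integral do rewrite /= ger0_norm//.
have q0 : (\int[P]_w q k w)%E @[k --> \oo] --> (\int[P]_w (cst 0 w))%E.
  apply: (@dominated_cvg _ _ _ P _ measurableT q (cst 0%E) (EFin \o g)) => //.
  - move=> w _; apply: cvg_near_cst; exists (Num.truncn (g w)).+1 => // k /= hk.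
    rewrite /q ltNge (_ : g w <= k%:R) ?mulr0//.
    by apply: (le_trans (ltW (truncnS_gt _))); rewrite ler_nat.
  - move=> k w _; rewrite /q /= lee_fin ger0_norm ?mulr_ge0//.
    by rewrite ler_piMr// lern1; case: (_ < _).
rewrite integral0 in q0.
have r40 : 0 < r / 4 by rewrite divr_gt0.
have [k _ hk] := ge0_cvge0_near q0 r40.
have qk : (\int[P]_w q k w <= (r / 4)%:E)%E by exact: hk (leqnn k).
exists (4 * k%:R + 1) => [|s ks]; first by rewrite ltr_wpDl// mulr_ge0.
have s0 : 0 < s by apply: lt_le_trans ks; rewrite ltr_wpDl// mulr_ge0.
have mE : measurable [set w | s / 4 < g w].
  by apply: measurable_bool_set; exact: measurable_fun_ltr.
have s40 : 0 < s / 4 by rewrite divr_gt0.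
have := @markov_event _ _ _ P _ (q k) (s / 4) mE s40.
have qk0 w : (0 <= q k w)%E by rewrite lee_fin mulr_ge0.
move=> /(_ qk0) mk; have {}mk : (P [set w | (s / 4 < g w)%R] <= ((s / 4)^-1)%:E * \int[P]_w q k w)%E.
  apply: mk => w /= sg; rewrite lee_fin (_ : k%:R < g w) ?mulr1 ?ltW//.
  by apply: le_lt_trans sg; rewrite ler_pdivlMr//; lra.
apply: (@le_trans _ _ (s%:E * (((s / 4)^-1)%:E * (r / 4)%:E))%E).
  rewrite lee_pmul2l ?lte_fin//; apply: (le_trans mk).
  by rewrite lee_pmul2l// lte_fin invr_gt0.
by rewrite -!EFinM lee_fin le_eqVlt; apply/orP; left; apply/eqP; field; rewrite gt_eqF.
Qed.

(** * Consistency *)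

Lemma le_each_summand (R : realType) (a1 a2 a3 a4 a5 x : R) :
  0 < a1 -> 0 < a2 -> 0 < a3 -> 0 < a4 -> 0 < a5 -> 1 + a1 + a2 + a3 + a4 + a5 <= x ->
  [/\ 1 <= x, a1 <= x, a2 <= x & [/\ a3 < x, a4 <= x - a3 & a5 <= x]].
Proof. by move=> ? ? ? ? ? ?; split; [lra|lra|lra|split; lra]. Qed.

(** The levels [t1], [t2], [dl] are fixed first, from the oracle alone; then the
    tolerance [eta]; then the sample sizes are taken large. The truncation level
    multiplies [gross_misfit] only, whose mean is small compared to [s^-1]. *)
Lemma mean_loss_near
  (disp : measure_display) (Omega : measurableType disp) (R : realType)
  (P : probability Omega R) (d : nat) (X : {RV P >-> d.-tuple R}) (Y : {RV P >-> R})
  (f sigma : d.-tuple R -> R) (sigma0 sigma1 : R)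
  (f_meas : measurable_fun setT f)
  (sigma_meas : measurable_fun setT sigma)
  (sigma0_gt0 : 0 < sigma0)
  (sigma_bounds : forall x, sigma0 <= sigma x <= sigma1)
  (f_int : exists2 C1 : R, 0 < C1 & ('E_P[fun w => `|f (X w)|%R] <= C1%:E)%E)
  (tail_cont : forall y : R, {in `]0, +oo[, continuous
    (fun t : R => fine (distribution P X [set x | t <= cond_density f sigma y x]))})
  (u : nat -> R) (u_gt0 : forall n, 0 < u n)
  (u_cvg : u @ \oo --> (0 : R))
  (S : forall n N : nat, sampling P d n N)
  (S_valid : forall n N, valid_sampling X Y (u_gt0 n) (S n N))
  (fhat tvar : forall n, n.-tuple (d.-tuple R * R) -> d.-tuple R -> R)
  (fhat_meas : forall n, measurable_fun setT
    (fun q : n.-tuple (d.-tuple R * R) * d.-tuple R => fhat n q.1 q.2))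
  (tvar_meas : forall n, measurable_fun setT
    (fun q : n.-tuple (d.-tuple R * R) * d.-tuple R => tvar n q.1 q.2))
  (tvar_ge0 : forall n (D : n.-tuple (d.-tuple R * R)) x, 0 <= tvar n D x)
  (M : nat -> nat -> nat)
  (M_gt : forall n N, 4 * Num.sqrt N%:R < (M n N)%:R :> R)
  (l : R)
  (l_gt0 : 0 < l)
  (fhat_cvg :
    ((Num.sqrt (trunc_level p.1 p.2 : R))%:E * regression_error X f S fhat p.1 p.2)%E
      @[p --> (\oo, \oo)] --> (0 : \bar R)%E)
  (var_cvg :
    ((trunc_level p.1 p.2 `^ (5 / 2) : R)%:E * variance_error X sigma S tvar p.1 p.2)%E
      @[p --> (\oo, \oo)] --> (0 : \bar R)%E)
  (r : R) : 0 < r -> \forall p \near (\oo, \oo),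
  (mean_sym_diff_loss X f sigma l S fhat tvar M p.1 p.2 <= r%:E)%E.
Proof.
move=> r0; pose e := r / 2; have e0 : 0 < e by rewrite divr_gt0.
have lam0 : 0 < oracle_level P X f sigma l.
  exact: (oracle_level_gt0 P X f_meas sigma_meas sigma0_gt0 sigma_bounds l_gt0).
set lam := oracle_level P X f sigma l in lam0.
have [t1 [t2 [dl [dl0 dlt1 t1l t2l [m1 m2 m12]]]]] :=
  level_bracket f_meas sigma_meas sigma0_gt0 sigma_bounds tail_cont l_gt0 e0.
pose mass := level_mass P X f sigma.
pose kap := Num.min (mass (t1 + dl) - l) (l - mass (t2 - dl)).
have kap0 : 0 < kap by rewrite lt_min !subr_gt0 m1.
have kap1 : kap <= mass (t1 + dl) - l by rewrite ge_min lexx.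
have kap2 : kap <= l - mass (t2 - dl) by rewrite ge_min lexx orbT.
pose v0 := sigma0 ^+ 2 / 2.
have v00 : 0 < v0 by rewrite divr_gt0 ?exprn_gt0.
have [CL CL0 lip] := normal_pdf_lipschitz v00.
(* With errors below [eta <= 1], the Lipschitz bound is at most
   [CL * (3 * eta) <= dl / 2]. *)
pose eta := Num.min 1 (Num.min v0 (dl / (6 * CL))).
have eta0 : 0 < eta by rewrite !lt_min ltr01 v00 divr_gt0// mulr_gt0.
have eta1 : eta <= 1 by rewrite ge_min lexx.
have eta2 : eta <= v0 by rewrite !ge_min lexx orbT.
have eta3 : eta <= dl / (6 * CL) by rewrite !ge_min lexx !orbT.
have s10 : 0 < sigma1.
  by have /andP[a b] := sigma_bounds point; apply: lt_le_trans (le_trans a b).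
pose K := l + 1.
(* Any level below [tau] is exceeded by a moderate fitted density on a ball of
   radius [K]. *)
pose tau := (Num.sqrt ((sigma1 ^+ 2 + v0) * pi *+ 2))^-1 * expR (- (K ^+ 2 / (2 * v0))).
have tau0 : 0 < tau.
  by rewrite mulr_gt0 ?expR_gt0// invr_gt0 sqrtr_gt0 peak_arg_gt0// addr_gt0 ?exprn_gt0.
have t10 : 0 < t1 by exact: lt_trans dlt1.
pose ts := Num.min t1 (tau / 2).
have ts0 : 0 < ts by rewrite lt_min t10 divr_gt0.
have tst1 : ts <= t1 by rewrite ge_min lexx.
have tstau : ts < tau.
  by apply: (@le_lt_trans _ _ (tau / 2)); [rewrite ge_min lexx orbT|clear -tau0; lra].
have t2dl0 : 0 < t2 - dl by move: dlt1 t1l t2l; clear; lra.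
have t20 : 0 < t2 by clear -t2dl0 dl0; lra.
pose C := 2 / ts + lam^-1.
have C0 : 0 < C.
  have i1 : 0 < lam^-1 by rewrite invr_gt0.
  have i2 : 0 < 2 / ts by rewrite divr_gt0.
  exact: addr_gt0.
pose c3 := 3 / kap * ((t1 + dl)^-1 + 2 / t2).
have c30 : 0 < c3.
  have i1 : 0 < (t1 + dl)^-1 by rewrite invr_gt0 addr_gt0.
  have i2 : 0 < 2 / t2 by rewrite divr_gt0.
  by rewrite mulr_gt0 ?divr_gt0// addr_gt0.
have [C1 C10 fC1] := f_int.
pose b0 := eta ^- 2 + eta^-1 + 1.
have b00 : 0 < b0 by rewrite !addr_gt0 ?invr_gt0 ?exprn_gt0.
pose g0 := 96 + 6 / v0 + 6.
have g00 : 0 < g0.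
  have i1 : 0 < 6 / v0 by rewrite divr_gt0.
  by rewrite /g0; clear -i1; lra.
(* All the error terms will be at most [rho], with coefficients summing to [B]. *)
pose B := C * b0 + C * (2 + c3 * b0) + g0.
have B0 : 0 < B.
  have i1 : 0 < C * b0 by rewrite mulr_gt0.
  have i2 : 0 < C * (2 + c3 * b0) by rewrite mulr_gt0// addr_gt0// mulr_gt0.
  by rewrite /B; clear -i1 i2 g00; lra.
pose rho := e / B.
have rho0 : 0 < rho by rewrite divr_gt0.
have mabsf : measurable_fun setT (fun w => `|f (X w)|).
  by apply: measurableT_comp => //; exact: measurableT_comp.
have fint : (\int[P]_w (`|f (X w)|)%:E < +oo)%E.
  by apply: (@le_lt_trans _ _ C1%:E); [move: fC1; rewrite unlock|rewrite ltry].
have [At At0 tail] := integrable_tail mabsf (fun w => normr_ge0 _) fint rho0.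
pose K' := (t1 - dl)^-1.
have K'0 : 0 < K' by rewrite invr_gt0 subr_gt0.
(* Sample size beyond which the deviation bounds are at most [rho]. *)
pose D := ((t1 + dl)^-1 ^+ 2 + (t2 - dl)^-1 ^+ 2) / (kap / 3) ^+ 2 / rho.
pose n0 := (Num.truncn D).+1.
(* Each summand is a lower bound required from the truncation level. *)
pose sA := 1 + lam^-1 + 2 * K + K' + C1 / rho + At.
have u2 : 0 < Num.min (dl / 2) (ts / 2) by rewrite lt_min !divr_gt0.
have h2 : 0 < Num.min (kap / 3) 1 by rewrite lt_min divr_gt0//=.
near=> p.
have sge : sA <= trunc_level p.1 p.2 by near: p; exact: trunc_level_ge.
have regs : ((Num.sqrt (trunc_level p.1 p.2 : R))%:E *
    regression_error X f S fhat p.1 p.2 <= rho%:E)%E.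
  by near: p; exact: (ge0_cvge0_near fhat_cvg rho0).
have vars : ((trunc_level p.1 p.2 `^ (5 / 2) : R)%:E *
    variance_error X sigma S tvar p.1 p.2 <= rho%:E)%E.
  by near: p; exact: (ge0_cvge0_near var_cvg rho0).
have umin : u p.1 <= Num.min (dl / 2) (ts / 2).
  near: p; apply: (near_fst_infty (A := fun n => u n <= Num.min (dl / 2) (ts / 2))).
  exact: (cvgr_le _ u_cvg _ u2).
have hmin : 2 * trunc_level p.1 p.2 / (M p.1 p.2)%:R <= Num.min (kap / 3) 1.
  by near: p; exact: (grid_step_small h2 M_gt).
have Nn0 : (n0 <= p.2)%N.
  near: p; exact: (near_pair_infty (A := fun _ N => (n0 <= N)%N) (fun _ _ _ h => h)).
move: sge regs vars umin hmin Nn0.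
set n := p.1; set N := p.2; set s := trunc_level n N => sge regs vars umin hmin Nn0.
have N0 : (0 < N)%N by exact: leq_trans Nn0.
have Nr : 0 < N%:R :> R by rewrite ltr0n.
have M0 : (0 < M n N)%N.
  by rewrite -(ltr0n R); apply: le_lt_trans (M_gt n N); rewrite mulr_ge0 ?sqrtr_ge0.
have iK0 : 0 < lam^-1 by rewrite invr_gt0.
have iC0 : 0 < C1 / rho by rewrite divr_gt0.
have K0 : 0 < K by rewrite addr_gt0.
have K20 : 0 < 2 * K by rewrite mulr_gt0.
have [s1 slam sK [sK' sC sAt]] := le_each_summand iK0 K20 K'0 iC0 At0 sge.
have s0 : 0 < s by apply: lt_le_trans s1.
have [udl uts] : u n <= dl / 2 /\ u n <= ts / 2 by move: umin; rewrite le_min => /andP[].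
have [hkap h1] : 2 * s / (M n N)%:R <= kap / 3 /\ 2 * s / (M n N)%:R <= 1.
  by move: hmin; rewrite le_min => /andP[].
have v0s : 2 * v0 <= sigma0 ^+ 2 by rewrite /v0 mulrC divfK// pnatr_eq0.
have close (E : n.-tuple (d.-tuple R * R)) x : `|fhat n E x - f x| <= eta ->
    `|hat_var s (tvar n E) x - sigma x ^+ 2| <= eta -> forall y,
    `|hat_normal s (fhat n E) (tvar n E) y x - cond_density f sigma y x| <= dl / 2.
  move=> c1 c2 y; have sd0 := hat_sd_gt0 s0 (tvar_ge0 n E) x.
  have /andP[b1 b2] := sigma_bounds x.
  have sx0 : 0 < sigma x by exact: lt_le_trans b1.
  have sx2 : sigma0 ^+ 2 <= sigma x ^+ 2 by rewrite ler_pXn2r ?nnegrE ?(ltW sigma0_gt0) ?(ltW sx0).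
  have sdE := hat_sd_sqr s0 (tvar_ge0 n E) x.
  have sdv : v0 <= hat_sd s (tvar n E) x ^+ 2.
    by rewrite sdE; move: c2; rewrite ler_norml => /andP[c2 _]; clear -c2 sx2 v0s eta2; lra.
  have sv : v0 <= sigma x ^+ 2 by clear -sx2 v0s v00; lra.
  apply: (le_trans (lip (fhat n E x) (f x) _ _ y sd0 sx0 sdv sv)); rewrite sdE.
  have c12 : `|fhat n E x - f x| ^+ 2 <= eta.
    rewrite expr2; apply: (@le_trans _ _ (eta * 1)); last by rewrite mulr1.
    by apply: ler_pM => //; exact: le_trans eta1.
  apply: (@le_trans _ _ (CL * (3 * eta))); first by rewrite ler_pM2l//; clear -c1 c2 c12 eta0; lra.
  move: eta3; rewrite ler_pdivlMr ?mulr_gt0//; clear; lra.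
have mt1 : l + kap <= mass (t1 + dl) by rewrite addrC -lerBrDr.
have mt2 : mass (t2 - dl) <= l - kap by rewrite lerBrDl -lerBrDr.
have main := mean_loss_le (S_valid n N) f_meas sigma_meas sigma0_gt0 sigma_bounds
  (@fhat_meas n) (@tvar_meas n) (@tvar_ge0 n) s0 l_gt0 M0 N0 lam0 dl0 dlt1 t1l t2l kap0 mt1 mt2
  (ltW e0) m12 eta0 close ts0 tst1 udl uts v00 v0s tstau sK sK' hkap h1.
have misE := mean_misfitE X (S n N) f_meas sigma_meas (@fhat_meas n) (@tvar_meas n) eta0 sK'.
have groE := mean_gross_misfitE X (S n N) f_meas sigma_meas (@fhat_meas n) (@tvar_meas n) s v00.
rewrite misE groE in main.
have reg0 : (0 <= regression_error X f S fhat n N)%E.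
  by rewrite /regression_error unlock; apply: integral_ge0 => w _; rewrite lee_fin sqr_ge0.
have var0 : (0 <= variance_error X sigma S tvar n N)%E.
  by rewrite /variance_error unlock; apply: integral_ge0 => w _; rewrite lee_fin.
have regle : (regression_error X f S fhat n N <= rho%:E)%E.
  apply: le_trans regs; rewrite -[leLHS]mul1e lee_wpmul2r// lee_fin.
  by rewrite -[1]sqrtr1 ler_wsqrtr.
have varle : (variance_error X sigma S tvar n N <= (s^-1 * rho)%:E)%E.
  rewrite EFinM lee_pdivlMl//; apply: le_trans vars; rewrite lee_wpmul2r// lee_fin.
  by rewrite -[leLHS]powRr1 ?(ltW s0)// ler_powR//; clear; lra.
have tails : (P [set w | (s / 4 < `|f (X w)|)%R] <= (s^-1 * rho)%:E)%E.
  by rewrite EFinM lee_pdivlMl//; exact: tail.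
have mul_le (a b : R) (x : \bar R) : 0 <= a -> (x <= b%:E)%E -> (a%:E * x <= (a * b)%:E)%E.
  by move=> a0 xb; rewrite EFinM lee_wpmul2l// lee_fin.
have si1 : s^-1 <= 1 by rewrite invf_le1.
have si0 : 0 < s^-1 by rewrite invr_gt0.
have sK'0 : 0 < s - K' by rewrite subr_gt0.
set beta := ((eta ^- 2)%:E * _ + _ + _)%E in main.
have betale : (beta <= (rho * b0)%:E)%E.
  rewrite (_ : rho * b0 = eta ^- 2 * rho + eta^-1 * rho + rho); last by rewrite /b0; ring.
  rewrite !EFinD; apply: leeD; first apply: leeD.
  - by apply: mul_le => //; rewrite invr_ge0 sqr_ge0.
  - apply: mul_le; first by rewrite invr_ge0 ltW.
    by apply: (le_trans varle); rewrite lee_fin ler_piMl// ltW.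
  - apply: (le_trans (mul_le _ _ _ _ fC1)); first by rewrite invr_ge0 ltW.
    by rewrite lee_fin mulrC ler_pdivrMr// -ler_pdivrMl// mulrC.
have devle (q : R) : q <= (t1 + dl)^-1 ^+ 2 + (t2 - dl)^-1 ^+ 2 ->
    q / (N%:R * (kap / 3) ^+ 2) <= rho.
  move=> qle; have k0 : 0 < (kap / 3) ^+ 2 by rewrite exprn_gt0// divr_gt0.
  have DN : D <= N%:R by apply: (le_trans (ltW (truncnS_gt D))); rewrite ler_nat.
  rewrite ler_pdivrMr ?mulr_gt0// mulrA; apply: (le_trans qle).
  by rewrite -ler_pdivrMr// (mulrC rho) -ler_pdivrMr.
set gam := ((16 / s ^+ 2)%:E * _ + _ + _)%E in main.
have gamle : ((2 * (2 * s + lam^-1))%:E * gam <= (rho * g0)%:E)%E.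
  pose q := 16 / s ^+ 2 * rho + v0^-1 * (s^-1 * rho) + s^-1 * rho.
  have q0 : 0 <= q.
    have i1 := mulr_ge0 (ltW si0) (ltW rho0).
    apply: addr_ge0 => //; apply: addr_ge0.
      by rewrite mulr_ge0 ?(ltW rho0)// divr_ge0 ?sqr_ge0.
    by rewrite mulr_ge0// invr_ge0 ltW.
  have gq : (gam <= q%:E)%E.
    rewrite !EFinD; apply: leeD => //; apply: leeD.
    - by apply: mul_le => //; rewrite divr_ge0 ?sqr_ge0.
    - by apply: mul_le => //; rewrite invr_ge0 ltW.
  have G0 : 0 <= 2 * (2 * s + lam^-1) by rewrite mulr_ge0// addr_ge0 ?(ltW iK0)// mulr_ge0 ?(ltW s0).
  apply: (le_trans (mul_le _ _ _ G0 gq)); rewrite lee_fin.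
  apply: (@le_trans _ _ (6 * s * q)); first by apply: ler_wpM2r => //; clear -slam s1; lra.
  have -> : 6 * s * q = rho * (96 * s^-1 + 6 / v0 + 6).
    by rewrite /q; field; rewrite !gt_eqF.
  by rewrite ler_pM2l// /g0 !lerD2r; clear -si1; lra.
apply: (le_trans main).
have Cp := ltW C0; have c3p := ltW c30.
have sq0 (t : R) : 0 <= t^-1 ^+ 2 by exact: sqr_ge0.
have -> : r = e + C * (rho * b0) + C * (rho + rho + c3 * (rho * b0)) + rho * g0.
  have rB : rho * B = e by rewrite /rho divfK// gt_eqF.
  have -> : r = e + rho * B by rewrite rB /e; field.
  by rewrite /B; ring.
rewrite (EFinD (e + _ + _)) (EFinD (e + _)) (EFinD e).
apply: leeD => //; apply: leeD.
  by apply: leeD => //; exact: mul_le.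
apply: mul_le => //; rewrite (EFinD (rho + rho)) (EFinD rho rho).
apply: leeD; last by rewrite (EFinM c3) lee_wpmul2l.
by apply: leeD; rewrite lee_fin devle// ?lerDl ?lerDr.
Unshelve. all: by end_near. Qed.

Theorem theorem1 (R : realType) (sigma0 : R) (sigma0_gt0 : 0 < sigma0) :
  exists2 C2 : R, 0 < C2 &
  forall (d : nat) (disp : measure_display) (Omega : measurableType disp)
    (P : probability Omega R)
    (X : {RV P >-> d.-tuple R}) (Y eps : {RV P >-> R})
    (f sigma : d.-tuple R -> R)
    (f_meas : measurable_fun setT f) (sigma_meas : measurable_fun setT sigma)
    (eps_normal : has_law P eps (normal_prob 0 1))
    (eps_indep : independent_rv P X eps)
    (Y_model : forall w, Y w = f (X w) + sigma (X w) * eps w)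
    (u : nat -> R) (u_gt0 : forall n, 0 < u n)
    (S : forall n N : nat, sampling P d n N)
    (S_valid : forall n N, valid_sampling X Y (u_gt0 n) (S n N))
    (fhat tvar : forall n, n.-tuple (d.-tuple R * R) -> d.-tuple R -> R)
    (fhat_meas : forall n, measurable_fun setT
       (fun q : n.-tuple (d.-tuple R * R) * d.-tuple R => fhat n q.1 q.2))
    (tvar_meas : forall n, measurable_fun setT
       (fun q : n.-tuple (d.-tuple R * R) * d.-tuple R => tvar n q.1 q.2))
    (tvar_ge0 : forall n D x, 0 <= tvar n D x)
    (M : nat -> nat -> nat)
    (M_gt : forall n N, 4 * Num.sqrt N%:R < (M n N)%:R :> R)
    (l : R) (l_gt0 : 0 < l)
    (sigma1 : R) (sigma01 : sigma0 < sigma1)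
    (sigma_bounds : forall x, sigma0 <= sigma x <= sigma1)
    (f_int : exists2 C1 : R, 0 < C1 &
       ('E_P[fun w => `|f (X w)|%R] <= C1%:E)%E)
    (tail_cont : forall y : R, {in `]0, +oo[, continuous
       (fun t : R =>
          fine (distribution P X [set x | t <= cond_density f sigma y x]))})
    (u_cvg : u @ \oo --> (0 : R))
    (fhat_cvg :
       ((Num.sqrt (trunc_level p.1 p.2 : R))%:E
         * regression_error X f S fhat p.1 p.2)%E
       @[p --> (\oo, \oo)] --> (0 : \bar R)%E)
    (var_cvg :
       ((trunc_level p.1 p.2 `^ (5 / 2) : R)%:E
         * variance_error X sigma S tvar p.1 p.2)%E
       @[p --> (\oo, \oo)] --> (0 : \bar R)%E),
    (* s > 0 amounts to min(n, N) > 1 *)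
    (forall n N : nat, (0 < trunc_level n N :> R) ->
       (mean_excess_risk X Y f sigma l S fhat tvar M n N
        <= C2%:E * mean_sym_diff_loss X f sigma l S fhat tvar M n N)%E)
    /\ (C2%:E * mean_sym_diff_loss X f sigma l S fhat tvar M p.1 p.2)%E
         @[p --> (\oo, \oo)] --> (0 : \bar R)%E.
Proof.
have C20 : 0 < normal_peak sigma0 by rewrite normal_peak_gt0 ?gt_eqF.
exists (normal_peak sigma0) => //.
move=> d disp Omega P X Y eps f sigma f_meas sigma_meas eps_normal eps_indep Y_model
  u u_gt0 S S_valid fhat tvar fhat_meas tvar_meas tvar_ge0 M M_gt l l_gt0 sigma1 _
  sigma_bounds f_int tail_cont u_cvg fhat_cvg var_cvg.
have loss0 n N w : (0 <= sym_diff_loss P X (fresh_perturbation (S n N)) f sigma l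
    (empirical_set l S fhat tvar M n N w))%E.
  by apply: integral_ge0 => w' _; exact: measure_ge0.
split=> [n N s0|].
  have lam0 := oracle_level_gt0 P X f_meas sigma_meas sigma0_gt0 sigma_bounds l_gt0.
  have lamle := oracle_level_le P X f_meas sigma_meas sigma0_gt0 sigma_bounds l_gt0.
  have X_eps : indep_pair P X eps.
    move=> A B mA mB; apply: (mutually_independent2 (i := true) (j := false) eps_indep) => //;
      exact: sigma_of_preimage.
  apply: le_integralZl_nonmeas => // w.
  apply: (excess_risk_le f_meas sigma_meas sigma0_gt0 sigma_bounds eps_normal X_eps Y_model
    (zeta_indep_fresh (S_valid n N)) lam0 lamle).
  exact: (measurable_fitted_set (S n N) (@fhat_meas n) (@tvar_meas n) (@tvar_ge0 n) l (M n N) s0 w).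
apply: near_le_cvge0 => [p|r r0].
  apply: mule_ge0; first by rewrite lee_fin (ltW C20).
  by apply: integral_ge0 => w _; exact: loss0.
have rC : 0 < r / normal_peak sigma0 by rewrite divr_gt0.
have := mean_loss_near f_meas sigma_meas sigma0_gt0 sigma_bounds f_int tail_cont u_cvg S_valid
  fhat_meas tvar_meas tvar_ge0 M_gt l_gt0 fhat_cvg var_cvg rC.
apply: filterS => p hp.
by rewrite -lee_pdivlMl// -EFinM mulrC.
Qed.
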